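(* Let $A,H$ be nondegenerately dually paired Hopf algebras with bijective antipode, and let $\Lambda^1$ be a finite-dimensional right $A$-crossed module mutually adjoint to $\Lambda^{1*}$, a right $H$-crossed module. Then $A\#B_\pm(\Lambda^1)$ and $H\#B_\pm(\Lambda^{1*})$ are nondegenerately dually paired as (super-)Hopf algebras.
   Context: We work over a field $k$ of characteristic not $2$. A right $A$-crossed module is a vector space $V$ with right action $\triangleleft$ and right coaction $\Delta_Rv=v_0\otimes v_1$ of $A$ such that $\Delta_R(v\triangleleft a)=v_0\triangleleft a_{(2)}\otimes(Sa_{(1)})v_1a_{(3)}$; these form a braided category with $\Psi(v\otimes w)=w_0\otimes v\triangleleft w_1$. A right $A$-crossed module $V$ is mutually adjoint to a right $H$-crossed module $V'$ if $V',V$ are dually paired as vector spaces with $$\langle\phi\triangleleft h,v\rangle=\langle\phi,v_0\rangle\langle v_1,h\rangle,\qquad\langle\phi,v\triangleleft a\rangle=\langle\phi_0,v\rangle\langle a,\phi_1\rangle$$ for all $\phi\in V',v\in V,h\in H,a\in A$; here $V'=\Lambda^{1*}$ is the dual space of $V=\Lambda^1$ with evaluation pairing. With $\Psi_i$ denoting $\Psi$ in tensor factors $i,i+1$, let $[n,\Psi]=\mathrm{id}+\Psi_1+\Psi_1\Psi_2+\cdots+\Psi_1\cdots\Psi_{n-1}$ and $[n,\Psi]!=(\mathrm{id}\otimes[n-1,\Psi]!)[n,\Psi]$ on $V^{\otimes n}$. $T_\pm V$ is the tensor algebra of $V$ as a braided Hopf algebra ($+$) or braided-super Hopf algebra ($-$,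 with $V$ odd), with $\underline\Delta v=v\otimes1+1\otimes v$ for $v\in V$, and $B_\pm(V)=T_\pm V/\oplus_n\ker[n,\pm\Psi]!$. For a braided(-super) Hopf algebra $\Lambda$ in the category of right $A$-crossed modules, $A\#\Lambda$ is the (super-)Hopf algebra $A\otimes\Lambda$ with $(a\otimes\eta)(b\otimes\zeta)=ab_{(1)}\otimes(\eta\triangleleft b_{(2)})\zeta$ and $\Delta(a\otimes\eta)=a_{(1)}\otimes(\eta^1)_0\otimes a_{(2)}(\eta^1)_1\otimes\eta^2$, where $\underline\Delta\eta=\eta^1\otimes\eta^2$; it is an ordinary Hopf algebra for $B_+$ and a super-Hopf algebra for $B_-$. *)

(* Defs.v *)
From HB Require Import structures.
From mathcomp Require Import all_boot all_order all_algebra.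
From mathcomp Require Import boolp.
Set Implicit Arguments.
Unset Strict Implicit.
Unset Printing Implicit Defensive.
Import GRing.Theory.
Local Open Scope ring_scope.
Local Open Scope quotient_scope.

(* [umod P] is spanned by symbols [gen x], x : X, and two formal linear
   combinations are identified exactly when every map f : X -> U in the class P
   gives them the same value.  Hence every f in P factors uniquely through gen
   as a linear map, [ulift f]. *)
Section UniversalModule.
Variables (k : fieldType) (X : choiceType).
Variable P : forall U : lmodType k, (X -> U) -> Prop.
Arguments P {U}.

Definition feval (U : lmodType k) (f : X -> U) (s : seq (k * X)) : U :=
  \sum_(p <- s) p.1 *: f p.2.

Definition urel (s t : seq (k * X)) : bool :=
  `[< forall (U : lmodType k) (f : X -> U), P f -> feval f s = feval f t >].

Lemma urel_equiv : equiv_class_of urel.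
Proof.
split.
- by move=> s; apply/asboolP.
- move=> s t; apply/asboolP/asboolP => E U f Pf; exact/esym/E.
- move=> t s u /asboolP E1 /asboolP E2; apply/asboolP => U f Pf.
  by rewrite E1 // E2.
Qed.

Canonical urel_equivRel := EquivRelPack urel_equiv.

Definition umod : Type := {eq_quot urel_equivRel}.
HB.instance Definition _ := Choice.on umod.
HB.instance Definition _ := EqQuotient.on umod.

Lemma umodE (s t : seq (k * X)) :
  (\pi_umod s = \pi_umod t) <->
  (forall (U : lmodType k) (f : X -> U), P f -> feval f s = feval f t).
Proof. by split=> [/eqmodP/asboolP|E]; last by apply/eqmodP/asboolP. Qed.

Lemma feval_cat (U : lmodType k) (f : X -> U) s t :
  feval f (s ++ t) = feval f s + feval f t.
Proof. by rewrite /feval big_cat. Qed.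

Definition fscale (a : k) (s : seq (k * X)) := [seq (a * p.1, p.2) | p <- s].

Lemma feval_scale (U : lmodType k) (f : X -> U) a s :
  feval f (fscale a s) = a *: feval f s.
Proof.
rewrite /feval big_map scaler_sumr; apply: eq_bigr => p _ /=.
by rewrite scalerA.
Qed.

Lemma feval_nil (U : lmodType k) (f : X -> U) : feval f [::] = 0.
Proof. by rewrite /feval big_nil. Qed.

Lemma feval_repr (U : lmodType k) (f : X -> U) s :
  P f -> feval f (repr (\pi_umod s)) = feval f s.
Proof. by move=> Pf; apply: (umodE _ s).1 => //; rewrite reprK. Qed.

Definition uzero : umod := \pi_umod [::].
Definition uadd (x y : umod) : umod := \pi_umod (repr x ++ repr y).
Definition uscale (a : k) (x : umod) : umod := \pi_umod (fscale a (repr x)).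
Definition uopp (x : umod) : umod := uscale (-1) x.

Lemma uaddA : associative uadd.
Proof.
move=> x y z; apply/umodE => U f Pf.
by rewrite !feval_cat !feval_repr // !feval_cat addrA.
Qed.
Lemma uaddC : commutative uadd.
Proof.
by move=> x y; apply/umodE => U f Pf; rewrite !feval_cat addrC.
Qed.
Lemma uadd0 : left_id uzero uadd.
Proof.
move=> x; rewrite -[RHS]reprK; apply/umodE => U f Pf.
by rewrite feval_cat feval_repr // feval_nil add0r.
Qed.
Lemma uaddN : left_inverse uzero uopp uadd.
Proof.
move=> x; apply/umodE => U f Pf.
rewrite feval_cat feval_repr // feval_scale feval_nil.
by rewrite scaleN1r addNr.
Qed.
HB.instance Definition _ :=
  GRing.isZmodule.Build umod uaddA uaddC uadd0 uaddN.

Lemma uscaleA a b x : uscale a (uscale b x) = uscale (a * b) x.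
Proof.
apply/umodE => U f Pf.
by rewrite feval_scale feval_repr // !feval_scale scalerA.
Qed.
Lemma uscale1 : left_id 1 uscale.
Proof.
move=> x; rewrite -[RHS]reprK; apply/umodE => U f Pf.
by rewrite feval_scale scale1r.
Qed.
Lemma uscaleDr : right_distributive uscale +%R.
Proof.
move=> a x y; apply/umodE => U f Pf.
rewrite feval_scale feval_repr // !feval_cat !feval_repr //.
by rewrite !feval_scale scalerDr.
Qed.
Lemma uscaleDl x : {morph uscale^~ x : a b / a + b}.
Proof.
move=> a b; apply/umodE => U f Pf.
rewrite feval_cat !feval_repr // !feval_scale.
by rewrite scalerDl.
Qed.
HB.instance Definition _ :=
  GRing.Zmodule_isLmodule.Build k umod uscaleA uscale1 uscaleDr uscaleDl.

Definition gen (x : X) : umod := \pi_umod [:: (1, x)].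

Definition ulift (U : lmodType k) (f : X -> U) (x : umod) : U :=
  feval f (repr x).

Lemma ulift_linear (U : lmodType k) (f : X -> U) : P f -> linear (ulift f).
Proof.
move=> Pf a x y; rewrite /ulift.
by rewrite feval_repr // feval_cat feval_repr // feval_scale.
Qed.

Lemma ulift_gen (U : lmodType k) (f : X -> U) x : P f -> ulift f (gen x) = f x.
Proof.
move=> Pf; rewrite /ulift feval_repr //.
by rewrite /feval big_seq1 scale1r.
Qed.

Lemma umod_genE (x : umod) : x = \sum_(p <- repr x) p.1 *: gen p.2.
Proof.
rewrite -[LHS]reprK; elim: (repr x) => [|[a z] s IH]; first by rewrite big_nil.
rewrite big_cons -IH; apply/umodE => U f Pf.
rewrite feval_cat !feval_repr // feval_scale feval_repr //.
by rewrite /feval big_cons /= big_seq1 scale1r.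
Qed.

Lemma ulift_uniq (U : lmodType k) (f : X -> U) (g : umod -> U) :
  linear g -> (forall x, g (gen x) = f x) -> g =1 ulift f.
Proof.
move=> lg gf x; rewrite {1}(umod_genE x) /ulift /feval.
have g0 : g 0 = 0.
  by have := lg (-1) 0 0; rewrite scaler0 addr0 scaleN1r addNr.
elim: (repr x) => [|p s IH]; first by rewrite !big_nil.
by rewrite !big_cons lg IH gf.
Qed.
End UniversalModule.

Definition bilin (k : fieldType) (V W U : lmodType k) (f : V * W -> U) : Prop :=
  (forall v, linear (fun w => f (v, w))) /\
  (forall w, linear (fun v => f (v, w))).

Definition tensor (k : fieldType) (V W : lmodType k) : lmodType k :=
  umod (@bilin k V W).

Definition tens (k : fieldType) (V W : lmodType k) (v : V) (w : W) :
  tensor V W := gen (@bilin k V W) (v, w).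
Notation "v ⊗ w" := (tens v w) (at level 40, left associativity) : ring_scope.

(* Sweedler notation: [sw t (fun x y => F x y)] is the value at t of the linear
   map V ⊗ W -> U sending x ⊗ y to F x y; for instance
   [sw (bcomul a) (fun a1 a2 => F a1 a2)] is F a_(1) a_(2). *)
Definition sw (k : fieldType) (V W U : lmodType k) (t : tensor V W)
  (f : V -> W -> U) : U := ulift (fun p : V * W => f p.1 p.2) t.

(* A map on words over V is multilinear if its restriction to words of each
   length n is an n-linear map V x ... x V -> U; the universal module for such
   maps is the direct sum of all V^{⊗n}. *)
Definition multilin (k : fieldType) (V U : lmodType k) (f : seq V -> U) : Prop :=
  forall s1 s2 : seq V, linear (fun v => f (s1 ++ v :: s2)).

Definition talg (k : fieldType) (V : lmodType k) : lmodType k :=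
  umod (@multilin k V).

(* word [:: v1; ..; vn] is v1 ⊗ ... ⊗ vn in V^{⊗n}. *)
Definition word (k : fieldType) (V : lmodType k) (s : seq V) : talg V :=
  gen (@multilin k V) s.

Definition tlift (k : fieldType) (V U : lmodType k) (f : seq V -> U)
  (x : talg V) : U := ulift f x.

Lemma bilin_tens (k : fieldType) (V W : lmodType k) :
  bilin (fun p : V * W => tens p.1 p.2).
Proof.
split=> v a x y; apply/umodE => U f [fr fl];
  rewrite feval_cat !feval_repr // feval_scale feval_repr //;
  by rewrite /feval !big_seq1 !scale1r /= ?fr ?fl.
Qed.

Lemma sw_tens (k : fieldType) (V W U : lmodType k) (f : V -> W -> U) v w :
  bilin (fun p => f p.1 p.2) -> sw (v ⊗ w) f = f v w.
Proof. by move=> bf; rewrite /sw ulift_gen. Qed.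

Lemma multilin_word (k : fieldType) (V : lmodType k) : multilin (@word k V).
Proof.
move=> s1 s2 a x y; apply/umodE => U f mf.
rewrite feval_cat !feval_repr // feval_scale feval_repr //.
by rewrite /feval !big_seq1 !scale1r mf.
Qed.

Lemma tlift_word (k : fieldType) (V U : lmodType k) (f : seq V -> U) s :
  multilin f -> tlift f (word s) = f s.
Proof. by move=> mf; rewrite /tlift ulift_gen. Qed.

Definition kills (k : fieldType) (T : lmodType k) (I : T -> Prop)
  (U : lmodType k) (f : T -> U) : Prop := linear f /\ forall x, I x -> f x = 0.

Definition quot (k : fieldType) (T : lmodType k) (I : T -> Prop) : lmodType k :=
  umod (@kills k T I).

Definition qpi (k : fieldType) (T : lmodType k) (I : T -> Prop) (x : T) :
  quot I := gen (@kills k T I) x.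

Definition qlift (k : fieldType) (T : lmodType k) (I : T -> Prop)
  (U : lmodType k) (f : T -> U) (x : quot I) : U := ulift f x.

Lemma qlift_qpi (k : fieldType) (T : lmodType k) (I : T -> Prop)
  (U : lmodType k) (f : T -> U) x :
  kills I f -> qlift f (qpi I x) = f x.
Proof. by move=> If; rewrite /qlift ulift_gen. Qed.

Lemma qpi_kills (k : fieldType) (T : lmodType k) (I : T -> Prop) :
  kills I (qpi I).
Proof.
split=> [a x y|x Ix]; apply/umodE => U f [lf f0].
  rewrite feval_cat !feval_repr // feval_scale feval_repr //.
  by rewrite /feval !big_seq1 !scale1r lf.
by rewrite /feval big_seq1 big_nil scale1r f0.
Qed.

Record bialgData (k : fieldType) := BialgData {
  bcar :> lmodType k;
  bmul : bcar -> bcar -> bcar;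
  bone : bcar;
  bcomul : bcar -> tensor bcar bcar;
  bcounit : bcar -> k }.

Arguments bone {k b}.

Definition is_algebra (k : fieldType) (D : bialgData k) : Prop :=
  [/\ bilin (fun p : D * D => bmul p.1 p.2),
      associative (@bmul k D),
      left_id bone (@bmul k D)
    & right_id bone (@bmul k D)].

Definition is_coalgebra (k : fieldType) (D : bialgData k) : Prop :=
  [/\ linear (@bcomul k D),
      linear (@bcounit k D : D -> k^o),
      forall x : D,
        sw (bcomul x) (fun x1 x2 => sw (bcomul x1) (fun y z => (y ⊗ z) ⊗ x2))
        = sw (bcomul x) (fun x1 x2 => sw (bcomul x2) (fun y z => (x1 ⊗ y) ⊗ z)),
      forall x : D, sw (bcomul x) (fun x1 x2 => bcounit x1 *: x2) = x
    & forall x : D, sw (bcomul x) (fun x1 x2 => bcounit x2 *: x1) = x].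

Definition is_antipode (k : fieldType) (D : bialgData k) (S : D -> D) : Prop :=
  [/\ linear S,
      forall x : D,
        sw (bcomul x) (fun x1 x2 => bmul (S x1) x2) = bcounit x *: bone
    & forall x : D,
        sw (bcomul x) (fun x1 x2 => bmul x1 (S x2)) = bcounit x *: bone].

Definition is_hopf (k : fieldType) (D : bialgData k) (S : D -> D) : Prop :=
  [/\ is_algebra D /\ is_coalgebra D,
      bcomul (bone : D) = bone ⊗ bone /\ bcounit (bone : D) = 1,
      forall x y : D, bcounit (bmul x y) = bcounit x * bcounit y,
      forall x y : D, bcomul (bmul x y) =
        sw (bcomul x) (fun x1 x2 => sw (bcomul y) (fun y1 y2 =>
          bmul x1 y1 ⊗ bmul x2 y2))
    & is_antipode S].

(* A Z/2-grading is given by the projections x |-> g i x onto the even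
   (i = false) and odd (i = true) components. *)
Definition is_grading (k : fieldType) (V : lmodType k) (g : bool -> V -> V) :
  Prop :=
  [/\ forall i, linear (g i),
      forall x, g false x + g true x = x
    & forall i j x, g i (g j x) = if i == j then g i x else 0].

(* All structure maps are even, and the coproduct is multiplicative for
   (a ⊗ b)(c ⊗ d) = (-1)^{|b||c|} ac ⊗ bd. *)
Definition is_super_hopf (k : fieldType) (D : bialgData k)
  (g : bool -> D -> D) (S : D -> D) : Prop :=
  [/\ is_algebra D /\ is_coalgebra D,
      is_grading g,
      [/\ forall i j (x y : D),
            g (i (+) j) (bmul (g i x) (g j y)) = bmul (g i x) (g j y),
          g false (bone : D) = bone,
          forall i (x : D), bcomul (g i x) =
            \sum_(j : bool)
              sw (bcomul x) (fun x1 x2 => g j x1 ⊗ g (i (+) j) x2),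
          forall x : D, bcounit (g true x) = 0
        & forall i (x : D), S (g i x) = g i (S x)],
      [/\ bcomul (bone : D) = bone ⊗ bone,
          bcounit (bone : D) = 1,
          forall x y : D, bcounit (bmul x y) = bcounit x * bcounit y
        & forall x y : D, bcomul (bmul x y) =
            \sum_(i : bool) \sum_(j : bool) (-1) ^+ (i && j) *:
              sw (bcomul x) (fun x1 x2 => sw (bcomul y) (fun y1 y2 =>
                bmul x1 (g j y1) ⊗ bmul (g i x2) y2))]
    & is_antipode S].

Definition bilin_form (k : fieldType) (V W : lmodType k) (p : V -> W -> k) :
  Prop := bilin (fun u : V * W => (p u.1 u.2 : k^o)).

Definition nondeg_form (k : fieldType) (V W : lmodType k) (p : V -> W -> k) :
  Prop :=
  (forall v, (forall w, p v w = 0) -> v = 0) /\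
  (forall w, (forall v, p v w = 0) -> w = 0).

Definition hopf_pairing (k : fieldType) (H A : bialgData k) (SH : H -> H)
  (SA : A -> A) (p : H -> A -> k) : Prop :=
  [/\ bilin_form p,
      forall (h h' : H) (a : A), p (bmul h h') a =
        sw (bcomul a) (fun a1 a2 => (p h a1 * p h' a2 : k^o)),
      forall (h : H) (a a' : A), p h (bmul a a') =
        sw (bcomul h) (fun h1 h2 => (p h1 a * p h2 a' : k^o)),
      (forall a : A, p bone a = bcounit a) /\
      (forall h : H, p h bone = bcounit h)
    & forall (h : H) (a : A), p (SH h) a = p h (SA a)].

(* No signs: the pairing is even and h ⊗ h' is paired with a ⊗ a' as
   <h,a><h',a'>. *)
Definition super_hopf_pairing (k : fieldType) (H A : bialgData k)
  (gH : bool -> H -> H) (gA : bool -> A -> A) (SH : H -> H) (SA : A -> A)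
  (p : H -> A -> k) : Prop :=
  hopf_pairing SH SA p /\
  forall i j (h : H) (a : A), i != j -> p (gH i h) (gA j a) = 0.

Record crossedData (k : fieldType) (A : bialgData k) (V : lmodType k) :=
  CrossedData {
    xact : V -> A -> V;
    xcoact : V -> tensor V A }.

Definition is_crossed (k : fieldType) (A : bialgData k) (S : A -> A)
  (V : lmodType k) (M : crossedData A V) : Prop :=
  [/\ bilin (fun p : V * A => xact M p.1 p.2),
      (forall v, xact M v bone = v) /\
      (forall v a b, xact M (xact M v a) b = xact M v (bmul a b)),
      linear (xcoact M),
      (forall v, sw (xcoact M v) (fun v0 v1 => bcounit v1 *: v0) = v) /\
      (forall v,
        sw (xcoact M v) (fun v0 v1 => xcoact M v0 ⊗ v1) =
        sw (xcoact M v) (fun v0 v1 => sw (bcomul v1) (fun a b =>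
          (v0 ⊗ a) ⊗ b)))
    & forall v a, xcoact M (xact M v a) =
        sw (xcoact M v) (fun v0 v1 =>
          sw (bcomul a) (fun a1 a' => sw (bcomul a') (fun a2 a3 =>
            xact M v0 a2 ⊗ bmul (bmul (S a1) v1) a3)))].

Definition mutually_adjoint (k : fieldType) (H A : bialgData k)
  (p : H -> A -> k) (V' V : lmodType k) (e : V' -> V -> k)
  (M' : crossedData H V') (M : crossedData A V) : Prop :=
  [/\ bilin_form e,
      forall phi h v, e (xact M' phi h) v =
        sw (xcoact M v) (fun v0 v1 => (e phi v0 * p h v1 : k^o))
    & forall phi v a, e phi (xact M v a) =
        sw (xcoact M' phi) (fun phi0 phi1 => (e phi0 v * p phi1 a : k^o))].

Record braidedData (k : fieldType) (A : bialgData k) := BraidedData {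
  rbialg :> bialgData k;
  rcrossed : crossedData A rbialg;
  rgrade : bool -> rbialg -> rbialg }.

(* Like the tensor algebra structure below, the product, coproduct, etc. of
   A#L are the unique linear extensions of the formulas on pure tensors. *)
Definition boson (k : fieldType) (A : bialgData k) (L : braidedData A) :
  bialgData k :=
  @BialgData k (tensor A L)
    (fun x y => sw x (fun a eta => sw y (fun b zeta =>
       sw (bcomul b) (fun b1 b2 =>
         bmul a b1 ⊗ bmul (xact (rcrossed L) eta b2) zeta))))
    (bone ⊗ bone)
    (fun x => sw x (fun a eta =>
       sw (bcomul a) (fun a1 a2 => sw (bcomul eta) (fun eta1 eta2 =>
         sw (xcoact (rcrossed L) eta1) (fun eta10 eta11 =>
           (a1 ⊗ eta10) ⊗ (bmul a2 eta11 ⊗ eta2))))))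
    (fun x => sw x (fun a eta => (bcounit a * bcounit eta : k^o))).

(* A is even in A#L. *)
Definition boson_grade (k : fieldType) (A : bialgData k) (L : braidedData A)
  (i : bool) (x : boson L) : boson L :=
  sw x (fun a eta => a ⊗ rgrade i eta).

Section TensorAlgebra.
Variables (k : fieldType) (A : bialgData k) (V : lmodType k).
Variable M : crossedData A V.
(* sigma = 1 for T_+ and B_+, sigma = -1 for T_- and B_-. *)
Variable sigma : k.

Definition tmul (x y : talg V) : talg V :=
  tlift (fun s => tlift (fun t => word (s ++ t)) y) x.

Definition tone : talg V := word [::].

Fixpoint wact (s : seq V) (a : A) : talg V :=
  if s is v :: s' then
    sw (bcomul a) (fun a1 a2 => tmul (word [:: xact M v a1]) (wact s' a2))
  else bcounit a *: tone.

Fixpoint wcoact (s : seq V) : tensor (talg V) A :=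
  if s is v :: s' then
    sw (xcoact M v) (fun v0 v1 => sw (wcoact s') (fun t0 t1 =>
      tmul (word [:: v0]) t0 ⊗ bmul v1 t1))
  else tone ⊗ bone.

Definition talg_crossed : crossedData A (talg V) :=
  CrossedData (fun x a => tlift (fun s => wact s a) x) (tlift wcoact).

(* y ⊗ z |-> sigma^{|y||z|} Psi(y ⊗ z) on T V ⊗ T V *)
Definition tbraid (y z : talg V) : tensor (talg V) (talg V) :=
  tlift (fun s => tlift (fun t => sigma ^+ (size s * size t) *:
    sw (wcoact t) (fun t0 t1 => t0 ⊗ wact s t1)) z) y.

(* the braided (super) tensor product algebra structure on T V ⊗ T V *)
Definition btmul (z z' : tensor (talg V) (talg V)) : tensor (talg V) (talg V) :=
  sw z (fun x y => sw z' (fun x' y' => sw (tbraid y x') (fun u w =>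
    tmul x u ⊗ tmul w y'))).

(* the algebra map with v |-> v ⊗ 1 + 1 ⊗ v *)
Definition tcomul : talg V -> tensor (talg V) (talg V) :=
  tlift (foldr (fun v z => btmul (word [:: v] ⊗ tone + tone ⊗ word [:: v]) z)
               (tone ⊗ tone)).

Definition tcounit (x : talg V) : k :=
  tlift (fun s => ((size s == 0)%N%:R : k^o)) x.

Definition tgrade (i : bool) : talg V -> talg V :=
  tlift (fun s => if odd (size s) == i then word s else 0).

Definition tensor_alg : braidedData A :=
  @BraidedData k A (BialgData tmul tone tcomul tcounit) talg_crossed tgrade.

(* Psi acting in the tensor factors number i and i+1, counted from 0. *)
Fixpoint wpsi (i : nat) (s : seq V) : talg V :=
  match i, s with
  | 0, v :: w :: s' =>
      sw (xcoact M w) (fun w0 w1 => word [:: w0, xact M v w1 & s'])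
  | i'.+1, v :: s' => tmul (word [:: v]) (wpsi i' s')
  | _, _ => 0
  end.

Definition tpsi (i : nat) : talg V -> talg V := tlift (wpsi i).

(* [n, sigma Psi] and [n, sigma Psi]! acting in the tensor factors
   m, m+1, ..., m+n-1, i.e. id^{⊗m} ⊗ [n, sigma Psi] etc. *)
Definition bint (m n : nat) (x : talg V) : talg V :=
  \sum_(j < n) foldr (fun i y => sigma *: tpsi i y) x (iota m j).

Fixpoint bfact (m n : nat) (x : talg V) : talg V :=
  if n is n'.+1 then bfact m.+1 n' (bint m n x) else x.

(* the component of x in V^{⊗n} *)
Definition tcomp (n : nat) : talg V -> talg V :=
  tlift (fun s => if size s == n then word s else 0).

Definition bker (x : talg V) : Prop := forall n, bfact 0 n (tcomp n x) = 0.

End TensorAlgebra.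

Section BraidedQuotient.
Variables (k : fieldType) (A : bialgData k) (L : braidedData A).
Variable I : L -> Prop.
Let Q := quot I.
Let pi : L -> Q := qpi I.
Local Notation lift f := (@qlift k L I _ f).

(* The maps induced on L/I by the structure maps of L, which descend to L/I
   when I is a braided (super-)Hopf ideal. *)
Definition braided_quot : braidedData A :=
  @BraidedData k A
    (@BialgData k Q
      (fun x y => lift (fun x' => lift (fun y' => pi (bmul x' y')) y) x)
      (pi bone)
      (lift (fun x' => sw (bcomul x') (fun x1 x2 => pi x1 ⊗ pi x2)))
      (fun x => lift (fun x' => (bcounit x' : k^o)) x))
    (CrossedData
      (fun x a => lift (fun x' => pi (xact (rcrossed L) x' a)) x)
      (lift (fun x' => sw (xcoact (rcrossed L) x') (fun x0 x1 => pi x0 ⊗ x1))))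
    (fun i => lift (fun x' => pi (rgrade i x'))).

End BraidedQuotient.

(* B_+(V) for sigma = 1, B_-(V) for sigma = -1 *)
Definition nichols (k : fieldType) (A : bialgData k) (V : lmodType k)
  (M : crossedData A V) (sigma : k) : braidedData A :=
  @braided_quot k A (tensor_alg M sigma) (bker M sigma).

Definition nichols_gen (k : fieldType) (A : bialgData k) (V : lmodType k)
  (M : crossedData A V) (sigma : k) (v : V) : nichols M sigma :=
  qpi (bker M sigma) (word [:: v]).

(* P restricts to the given pairings in degrees 0 and 1. *)
Definition extends_pairings (k : fieldType) (H A : bialgData k)
  (p : H -> A -> k) (V' V : lmodType k) (e : V' -> V -> k)
  (M' : crossedData H V') (M : crossedData A V) (sigma : k)
  (P : boson (nichols M' sigma) -> boson (nichols M sigma) -> k) : Prop :=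
  (forall h a, P (h ⊗ bone) (a ⊗ bone) = p h a) /\
  (forall phi v, P (bone ⊗ nichols_gen M' sigma phi)
                   (bone ⊗ nichols_gen M sigma v) = e phi v).

(* Main.v *)
(** Let [E = A # TV], and [E' = H # TV'] for [V'] the dual of [V].  From [1], the
    algebra [E] is generated by left multiplications by
      [a] in [A] and [v] in [V],
    and
      [Delta (a z) = a_1 z_1 ⊗ a_2 z_2],
      [Delta (v z) = v_0 z_1 ⊗ v_1 z_2 + gamma z_1 ⊗ v z_2],
    where [gamma = sigma ^ degree] absorbs every sign,
      so the (super-)Hopf axioms
    of [E] follow by induction on [z].  By mutual adjointness the pairings of
      [H]
    with [A] and of [V'] with [V] extend to a Hopf pairing of [E'] with [E].  It
    sends [(h ⊗ x, a ⊗ y)] to [<h, a> ev x y], and [ev] is the evaluation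
      twisted
    by [[n, sigma Psi]!] in degree [n], since the component of the coproduct of
    [V^{⊗n}] in [V ⊗ V^{⊗(n-1)}] is [[n, sigma Psi]].  Hence its radical on the
    right is [A ⊗ ker [n, sigma Psi]!] summed over [n], and symmetrically on the
    left.  Dividing by the radicals turns [E] and [E'] into [A # B(V)] and
    [H # B(V')], with their Hopf structures and a nondegenerate pairing. *)

Require Import Defs.
From mathcomp Require Import all_boot all_order all_algebra.
From mathcomp Require Import boolp.
Set Implicit Arguments.
Unset Strict Implicit.
Unset Printing Implicit Defensive.
Import GRing.Theory.
Local Open Scope ring_scope.

(** * Linear maps out of tensor products *)

(** The obstacle is the quotient: an operation lifted to it can be computed on classes only once it
    is known to kill [bker]. Instead of working with the factorials themselves, [bker] is recognized
    as the common kernel of the functionals [ev s]. The rules of a Hopf pairing move every operation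
    on TV to the other side, where stability of [bker] is formal. Coaction and coproduct take values
    in tensor products of quotients, so they also need that functionals separating the factors
    separate the tensor product ([tensor_sep]). The price of the pairing is one exchange identity
    ([pairing_exchange]): [phi h] and [h_1 (phi ◁ h_2)] must act alike on functionals of E. The
    crossed-module axiom enters there, in the antipode of E and in the coproduct of [v a], each time
    in the antipode-free form of [coact_act]. The two cases run together under [sigma * sigma = 1].
    The pairing carries no sign, so the two sides may be exchanged, and each lemma about one
    argument serves for both. *)

Definition lin (k : fieldType) (V W : lmodType k) (f : V -> W) : Prop :=
  linear f.

(** Curried form of [bilin], with the components in the opposite order: here [.1] is linearity in
    the left argument and [.2] in the right one. *)
Definition bl (k : fieldType) (V W U : lmodType k) (f : V -> W -> U) : Prop :=
  (forall y, lin (fun x => f x y)) /\ (forall x, lin (fun y => f x y)).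

Definition trl (k : fieldType) (V W X U : lmodType k) (f : V -> W -> X -> U) :
  Prop :=
  [/\ forall y z, lin (fun x => f x y z), forall x z, lin (fun y => f x y z)
    & forall x y, lin (fun z => f x y z)].

Section Lin.
Variable k : fieldType.
Implicit Types V W U : lmodType k.

Lemma lin0 V W (f : V -> W) : lin f -> f 0 = 0.
Proof. by move=> lf; have := lf (-1) 0 0; rewrite scaler0 addr0 scaleN1r addNr.
  Qed.
Lemma linD V W (f : V -> W) : lin f -> {morph f : x y / x + y}.
Proof. by move=> lf x y; have := lf 1 x y; rewrite !scale1r. Qed.
Lemma linZ V W (f : V -> W) a x : lin f -> f (a *: x) = a *: f x.
Proof. by move=> lf; have := lf a x 0; rewrite (lin0 lf) !addr0. Qed.
Lemma lin_sum V W (f : V -> W) (I : Type) (r : seq I) P (F : I -> V) :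
  lin f -> f (\sum_(i <- r | P i) F i) = \sum_(i <- r | P i) f (F i).
Proof.
move=> lf; apply: (big_morph f); [exact: linD | exact: lin0].
Qed.

Lemma linN V W (f : V -> W) x : lin f -> f (- x) = - f x.
Proof. by move=> lf; rewrite -scaleN1r linZ // scaleN1r. Qed.

Lemma lin_id V : lin (fun x : V => x).
Proof. by []. Qed.
Lemma lin_comp V W U (f : W -> U) (g : V -> W) :
  lin f -> lin g -> lin (fun x => f (g x)).
Proof. by move=> lf lg a x y; rewrite lg lf. Qed.
Lemma lin_zero V W : lin (fun _ : V => 0 : W).
Proof. by move=> a x y; rewrite scaler0 addr0. Qed.
Lemma lin_add V W (f g : V -> W) : lin f -> lin g -> lin (fun x => f x + g x).
Proof. by move=> lf lg a x y; rewrite lf lg scalerDr addrACA. Qed.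
Lemma lin_opp V W (f : V -> W) : lin f -> lin (fun x => - f x).
Proof. by move=> lf a x y; rewrite lf opprD scalerN. Qed.
Lemma lin_big V W (I : Type) (r : seq I) P (F : I -> V -> W) :
  (forall i, lin (F i)) -> lin (fun x => \sum_(i <- r | P i) F i x).
Proof.
move=> lF a x y; rewrite scaler_sumr -big_split /=.
by apply: eq_bigr => i _; rewrite lF.
Qed.
Lemma lin_scaler V W (c : k) (f : V -> W) : lin f -> lin (fun x => c *: f x).
Proof. by move=> lf a x y; rewrite lf scalerDr !scalerA mulrC. Qed.
Lemma lin_scalel V W (f : V -> k) (w : W) :
  lin (f : V -> k^o) -> lin (fun x => f x *: w).
Proof. by move=> lf a x y; rewrite lf scalerDl -scalerA. Qed.
Lemma lin_mulr V (f : V -> k) (c : k) :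
  lin (f : V -> k^o) -> lin (fun x => f x * c : k^o).
Proof. move=> lf a x y; rewrite lf mulrDl; congr (_ + _); exact/esym/mulrA. Qed.
Lemma lin_mull V (f : V -> k) (c : k) :
  lin (f : V -> k^o) -> lin (fun x => c * f x : k^o).
Proof. move=> lf a x y; rewrite lf mulrDr; congr (_ + _); exact: mulrCA. Qed.
Lemma lin_if V W (b : bool) (f g : V -> W) :
  lin f -> lin g -> lin (fun x => if b then f x else g x).
Proof. by case: b. Qed.

Lemma bl_bilin V W U (f : V -> W -> U) : bl f -> bilin (fun p => f p.1 p.2).
Proof. by case=> f1 f2; split. Qed.
Lemma bilin_bl V W U (f : V -> W -> U) : bilin (fun p => f p.1 p.2) -> bl f.
Proof. by case=> f1 f2; split. Qed.
Lemma blI V W U (f : V -> W -> U) : (forall y, lin (fun x => f x y)) ->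
  (forall x, lin (fun y => f x y)) -> bl f.
Proof. by []. Qed.
Lemma trlI V W (X : lmodType k) U (f : V -> W -> X -> U) :
  (forall y z, lin (fun x => f x y z)) -> (forall x z, lin (fun y =>
    f x y z)) ->
  (forall x y, lin (fun z => f x y z)) -> trl f.
Proof. by []. Qed.

(** [sw t f] is a sum over the chosen representative of [t], whatever [f] is. Rules that leave [t]
    alone ([eq_sw], [sw_exch], [sw_add], [sw_lin]) therefore carry no side condition on [f];
    bilinearity has to be supplied only when the tensor itself changes ([sw_tensE], [sw_sw],
    [sw_argD]). *)
Lemma swE V W U (t : tensor V W) (f : V -> W -> U) :
  sw t f = \sum_(q <- repr t) q.1 *: f q.2.1 q.2.2.
Proof. by []. Qed.

Lemma eq_sw V W U (t : tensor V W) (f g : V -> W -> U) :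
  (forall x y, f x y = g x y) -> sw t f = sw t g.
Proof. by move=> fg; rewrite !swE; apply: eq_bigr => q _; rewrite fg. Qed.

Lemma eq_swk V W (t : tensor V W) (f g : V -> W -> k) :
  (forall x y, f x y = g x y) ->
  sw t (f : V -> W -> k^o) = sw t (g : V -> W -> k^o) :> k.
Proof. exact: (@eq_sw V W k^o). Qed.

Lemma lin_sw_arg V W U (f : V -> W -> U) : bl f -> lin (fun t => sw t f).
Proof.
by move=> bf a x y; rewrite /sw (ulift_linear (bl_bilin bf)).
Qed.

Lemma lin_swl (X : lmodType k) V W U (f : V -> W -> U) (e : X -> tensor V W) :
  lin e -> bl f -> lin (fun v => sw (e v) f).
Proof. by move=> le bf; exact: (lin_comp (lin_sw_arg bf) le). Qed.

Lemma lin_swr (X : lmodType k) V W U (t : tensor V W) (F : X -> V -> W -> U) :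
  (forall x y, lin (fun v => F v x y)) -> lin (fun v => sw t (F v)).
Proof.
move=> lF a x y; rewrite !swE scaler_sumr -big_split /=.
by apply: eq_bigr => q _; rewrite lF scalerDr !scalerA mulrC.
Qed.

Lemma sw_tensE V W U (f : V -> W -> U) v w :
  bl f -> sw (v ⊗ w) f = f v w.
Proof. by move=> bf; rewrite sw_tens //; exact: bl_bilin. Qed.

Lemma sw_lin V W U (X : lmodType k) (L : U -> X) (t : tensor V W) (f : V ->
  W -> U) :
  lin L -> L (sw t f) = sw t (fun x y => L (f x y)).
Proof.
move=> lL; rewrite !swE lin_sum //; apply: eq_bigr => q _; exact: linZ.
Qed.

Lemma sw_sw V W U (X Y : lmodType k) (t : tensor V W) (f : V -> W -> tensor X Y)
    (g : X -> Y -> U) :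
  bl g -> sw (sw t f) g = sw t (fun x y => sw (f x y) g).
Proof. by move=> bg; exact: (sw_lin t f (lin_sw_arg bg)). Qed.

Lemma sw_exch V W (X Y : lmodType k) U (t : tensor V W) (u : tensor X Y)
    (f : V -> W -> X -> Y -> U) :
  sw t (fun x y => sw u (f x y)) = sw u (fun z w => sw t (fun x y =>
    f x y z w)).
Proof.
rewrite !swE; under eq_bigr do rewrite swE scaler_sumr.
rewrite exchange_big /=; apply: eq_bigr => q _; rewrite swE scaler_sumr.
by apply: eq_bigr => r _; rewrite !scalerA mulrC.
Qed.

Lemma sw_add V W U (t : tensor V W) (f g : V -> W -> U) :
  sw t (fun x y => f x y + g x y) = sw t f + sw t g.
Proof.
by rewrite !swE -big_split /=; apply: eq_bigr => q _; rewrite scalerDr.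
Qed.
Lemma sw_scale V W U (t : tensor V W) (f : V -> W -> U) c :
  sw t (fun x y => c *: f x y) = c *: sw t f.
Proof. by rewrite (sw_lin _ _ (lin_scaler c (@lin_id U))). Qed.
Lemma sw_opp V W U (t : tensor V W) (f : V -> W -> U) :
  sw t (fun x y => - f x y) = - sw t f.
Proof. by rewrite (sw_lin _ _ (lin_opp (@lin_id U))). Qed.
Lemma sw_zero V W U (t : tensor V W) (f : V -> W -> U) :
  (forall x y, f x y = 0) -> sw t f = 0.
Proof.
by move=> f0; rewrite swE big1 // => q _; rewrite f0 scaler0.
Qed.
Lemma sw_zerok V W (t : tensor V W) (f : V -> W -> k) :
  (forall x y, f x y = 0) -> sw t (f : V -> W -> k^o) = 0 :> k.
Proof. exact: (@sw_zero V W k^o). Qed.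
Lemma sw_0 V W U (f : V -> W -> U) : bl f -> sw 0 f = 0.
Proof. by move=> bf; rewrite (lin0 (lin_sw_arg bf)). Qed.
Lemma sw_sum V W U I (r : seq I) P (t : tensor V W) (f : I -> V -> W -> U) :
  sw t (fun x y => \sum_(i <- r | P i) f i x y) =
  \sum_(i <- r | P i) sw t (f i).
Proof.
rewrite swE; under eq_bigr do rewrite scaler_sumr.
by rewrite exchange_big.
Qed.
Lemma sw_mull V W (t : tensor V W) (f : V -> W -> k) (c : k) :
  sw t (fun x y => c * f x y : k^o) = c * sw t (f : V -> W -> k^o).
Proof. by rewrite [RHS](sw_lin _ _ (lin_mull c (@lin_id k^o))). Qed.
Lemma sw_mulr V W (t : tensor V W) (f : V -> W -> k) (c : k) :
  sw t (fun x y => f x y * c : k^o) = sw t (f : V -> W -> k^o) * c.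
Proof. by rewrite [RHS](sw_lin _ _ (lin_mulr c (@lin_id k^o))). Qed.

Lemma lin_tens_l (X : lmodType k) V W (e : X -> V) (w : W) :
  lin e -> lin (fun v => e v ⊗ w).
Proof. by move=> le a x y; rewrite le (bilin_tens V W).2. Qed.
Lemma lin_tens_r (X : lmodType k) V W (e : X -> W) (w : V) :
  lin e -> lin (fun v => w ⊗ e v).
Proof. by move=> le a x y; rewrite le (bilin_tens V W).1. Qed.

Lemma tens0l V W (w : W) : (0 : V) ⊗ w = 0.
Proof. exact: (lin0 (lin_tens_l w (@lin_id V))). Qed.
Lemma tens0r V W (v : V) : v ⊗ (0 : W) = 0.
Proof. exact: (lin0 (lin_tens_r v (@lin_id W))). Qed.
Lemma tensDl V W (v v' : V) (w : W) : (v + v') ⊗ w = v ⊗ w + v' ⊗ w.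
Proof. exact: (linD (lin_tens_l w (@lin_id V))). Qed.
Lemma tensDr V W (v : V) (w w' : W) : v ⊗ (w + w') = v ⊗ w + v ⊗ w'.
Proof. exact: (linD (lin_tens_r v (@lin_id W))). Qed.
Lemma tensZl V W c (v : V) (w : W) : (c *: v) ⊗ w = c *: (v ⊗ w).
Proof. exact: (linZ _ _ (lin_tens_l w (@lin_id V))). Qed.
Lemma tensZr V W c (v : V) (w : W) : v ⊗ (c *: w) = c *: (v ⊗ w).
Proof. exact: (linZ _ _ (lin_tens_r v (@lin_id W))). Qed.
Lemma tens_sumr V W I (r : seq I) P (v : V) (F : I -> W) :
  v ⊗ (\sum_(i <- r | P i) F i) = \sum_(i <- r | P i) v ⊗ F i.
Proof. exact: (lin_sum _ _ _ (lin_tens_r v (@lin_id W))). Qed.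
Lemma sw_argD V W U (f : V -> W -> U) s t : bl f ->
  sw (s + t) f = sw s f + sw t f.
Proof. by move/lin_sw_arg/linD => ->. Qed.
Lemma sw_argZ V W U (f : V -> W -> U) c t : bl f ->
  sw (c *: t) f = c *: sw t f.
Proof. by move/lin_sw_arg => l; rewrite (linZ _ _ l). Qed.
Lemma sw_arg_sum V W U I (r : seq I) P (F : I -> tensor V W) (f : V -> W -> U) :
  bl f -> sw (\sum_(i <- r | P i) F i) f = \sum_(i <- r | P i) sw (F i) f.
Proof. by move/lin_sw_arg => l; rewrite (lin_sum _ _ _ l). Qed.

Lemma sw_id V W (t : tensor V W) : sw t (fun x y => x ⊗ y) = t.
Proof.
rewrite [RHS]umod_genE swE; apply: eq_bigr => q _; congr (_ *: _).
by rewrite /tens -surjective_pairing.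
Qed.

Lemma tensor_ext V W U (f g : tensor V W -> U) : lin f -> lin g ->
  (forall x y, f (x ⊗ y) = g (x ⊗ y)) -> f =1 g.
Proof.
by move=> lf lg fg t; rewrite -(sw_id t) !sw_lin //; apply: eq_sw.
Qed.

Lemma tensor_sum V W (t : tensor V W) :
  exists s : seq (V * W), t = \sum_(q <- s) q.1 ⊗ q.2.
Proof.
exists [seq (q.1 *: q.2.1, q.2.2) | q <- repr t].
rewrite big_map -[LHS]sw_id swE; apply: eq_bigr => q _ /=.
exact/esym/(linZ _ _ (lin_tens_l q.2.2 (@lin_id V))).
Qed.

End Lin.

Create HintDb lin.
#[export] Hint Resolve blI trlI lin_id lin_zero lin_add lin_opp lin_scaler
  lin_scalel
  lin_mulr lin_mull lin_swl lin_swr lin_tens_l lin_tens_r lin_big : lin.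
Ltac lin := solve [auto 100 with lin nocore].
Tactic Notation "swt" := rewrite sw_tensE; [|lin].

(** * Hopf algebras and crossed modules *)

Lemma lin_bmull (k : fieldType) (D : bialgData k) (X : lmodType k) (e : X ->
  D) c :
  is_algebra D -> lin e -> lin (fun v => bmul (e v) c).
Proof.
by move=> [bm _ _ _]; apply: (lin_comp (f := fun x => bmul x c)); exact: bm.2.
Qed.
Lemma lin_bmulr (k : fieldType) (D : bialgData k) (X : lmodType k) (e : X ->
  D) c :
  is_algebra D -> lin e -> lin (fun v => bmul c (e v)).
Proof.
by move=> [bm _ _ _]; apply: (lin_comp (f := bmul c)); exact: bm.1.
Qed.
Lemma lin_bcomul (k : fieldType) (D : bialgData k) (X : lmodType k) (e : X ->
  D) :
  is_coalgebra D -> lin e -> lin (fun v => bcomul (e v)).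
Proof. by move=> [l _ _ _ _]; exact: (lin_comp l). Qed.
Lemma lin_bcounit (k : fieldType) (D : bialgData k) (X : lmodType k) (e : X ->
  D) :
  is_coalgebra D -> lin e -> lin (fun v => bcounit (e v) : k^o).
Proof. by move=> [_ l _ _ _]; exact: (lin_comp (W := D) l). Qed.

Definition bl_act (k : fieldType) (A : bialgData k) (V : lmodType k)
  (M : crossedData A V) := bl (xact M).
Definition lin_coact (k : fieldType) (A : bialgData k) (V : lmodType k)
  (M : crossedData A V) := lin (xcoact M).
Lemma lin_xactl (k : fieldType) (A : bialgData k) (V : lmodType k)
  (M : crossedData A V) (X : lmodType k) (e : X -> V) a :
  bl_act M -> lin e -> lin (fun v => xact M (e v) a).
Proof. by move=> [l _]; exact: (lin_comp (l a)). Qed.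
Lemma lin_xactr (k : fieldType) (A : bialgData k) (V : lmodType k)
  (M : crossedData A V) (X : lmodType k) (e : X -> A) a :
  bl_act M -> lin e -> lin (fun v => xact M a (e v)).
Proof. by move=> [_ l]; exact: (lin_comp (l a)). Qed.
Lemma lin_xcoact (k : fieldType) (A : bialgData k) (V : lmodType k)
  (M : crossedData A V) (X : lmodType k) (e : X -> V) :
  lin_coact M -> lin e -> lin (fun v => xcoact M (e v)).
Proof. exact: lin_comp. Qed.

#[export] Hint Resolve lin_bmull lin_bmulr lin_bcomul lin_bcounit lin_xactl
  lin_xactr
  lin_xcoact : lin.

(* Hypotheses [lin f], [bl f] and [trl f] about local functions apply to [f (e v)] only after a
   higher-order unification; the patterns here extract the inner map [e] and hand it to
   [lin_comp]. *)
#[export] Hint Extern 3 (lin _) =>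
  match goal with
  | H : bl ?f |- lin (?f ?c) => exact (H.2 c)
  | |- lin ?f => lazymatch f with
                 | (fun _ => _) => fail
                 | _ => change (lin (fun v => f v))
                 end
  | H : lin ?f |- lin (fun v => ?f (@?e v)) => apply (lin_comp (g := e) H)
  | H : bl ?f |- lin (fun v => ?f (@?e v) ?c) =>
      apply (lin_comp (g := e) (H.1 c))
  | H : bl ?f |- lin (fun v => ?f ?c (@?e v)) =>
      apply (lin_comp (g := e) (H.2 c))
  | H : trl ?f |- lin (fun v => ?f (@?e v) ?b ?c) =>
      case: H => H _ _; apply (lin_comp (g := e) (H b c))
  | H : trl ?f |- lin (fun v => ?f ?b (@?e v) ?c) =>
      case: H => _ H _; apply (lin_comp (g := e) (H b c))
  | H : trl ?f |- lin (fun v => ?f ?b ?c (@?e v)) =>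
      case: H => _ _ H; apply (lin_comp (g := e) (H b c))
  end : lin.

Section BilinearSw.
Variables (k : fieldType) (V W U : lmodType k) (f : V -> W -> U).
Hypothesis bf : bl f.
Lemma bl_swl (X Y : lmodType k) (t : tensor X Y) (F : X -> Y -> V) w :
  f (sw t F) w = sw t (fun x y => f (F x y) w).
Proof. exact: (sw_lin (L := fun x => f x w) _ _ (bf.1 w)). Qed.
Lemma bl_swr (X Y : lmodType k) (t : tensor X Y) (F : X -> Y -> W) v :
  f v (sw t F) = sw t (fun x y => f v (F x y)).
Proof. exact: (sw_lin (L := fun x => f v x) _ _ (bf.2 v)). Qed.
Lemma blNl v w : f (- v) w = - f v w. Proof. exact: (linN _ (bf.1 w)). Qed.
Lemma blNr v w : f v (- w) = - f v w. Proof. exact: (linN _ (bf.2 v)). Qed.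
Lemma blZl c v w : f (c *: v) w = c *: f v w. Proof. exact: (linZ _ _ (bf.1
  w)). Qed.
Lemma blZr c v w : f v (c *: w) = c *: f v w. Proof. exact: (linZ _ _ (bf.2
  v)). Qed.
Lemma blDl v v' w : f (v + v') w = f v w + f v' w. Proof. exact: (linD (bf.1
  w)). Qed.
Lemma blDr v w w' : f v (w + w') = f v w + f v w'. Proof. exact: (linD (bf.2
  v)). Qed.
Lemma bl0l w : f 0 w = 0. Proof. exact: (lin0 (bf.1 w)). Qed.
Lemma bl0r v : f v 0 = 0. Proof. exact: (lin0 (bf.2 v)). Qed.
End BilinearSw.

Section Coalgebra.
Variables (k : fieldType) (D : bialgData k).
Hypothesis cD : is_coalgebra D.
Implicit Types U : lmodType k.

Definition coass_at (x : D) := forall U (f : D -> D -> D -> U), trl f ->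
  sw (bcomul x) (fun x1 x2 => sw (bcomul x1) (fun y z => f y z x2)) =
  sw (bcomul x) (fun x1 x2 => sw (bcomul x2) (fun y z => f x1 y z)).

(** Coassociativity in the form that rewrites under [sw]: the axiom is an equation in (D ⊗ D) ⊗ D,
    and the trilinear [f] is evaluated on both sides of it. *)
Lemma coass x : coass_at x.
Proof.
case: (cD) => _ _ /(_ x) E _ _ U f tf.
have := congr1 (fun t => sw t (fun u c => sw u (fun a b => f a b c))) E.
rewrite !sw_sw; [|lin..].
under eq_sw => x1 x2. rewrite sw_sw; [|lin].
  under eq_sw => y z. swt; swt. over. over.
move=> ->; apply: eq_sw => x1 x2; rewrite sw_sw; [|lin].
by apply: eq_sw => y z; swt; swt.
Qed.

Lemma counl U (f : D -> U) x : lin f ->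
  sw (bcomul x) (fun x1 x2 => bcounit x1 *: f x2) = f x.
Proof.
move=> lf; case: (cD) => _ _ _ /(_ x) E _.
by rewrite -[in RHS]E sw_lin //; apply: eq_sw => a b; rewrite linZ.
Qed.
Lemma counr U (f : D -> U) x : lin f ->
  sw (bcomul x) (fun x1 x2 => bcounit x2 *: f x1) = f x.
Proof.
move=> lf; case: (cD) => _ _ _ _ /(_ x) E.
by rewrite -[in RHS]E sw_lin //; apply: eq_sw => a b; rewrite linZ.
Qed.
End Coalgebra.

Section Hopf.
Variables (k : fieldType) (A : bialgData k) (SA : A -> A) (hA : is_hopf SA).
Implicit Types U : lmodType k.

Lemma hopf_alg : is_algebra A. Proof. by case: hA => -[]. Qed.
Lemma hopf_coalg : is_coalgebra A. Proof. by case: hA => -[]. Qed.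
Let algA := hopf_alg.
Lemma hopf_lin : lin SA. Proof. by case: hA => _ _ _ _ []. Qed.
Lemma bmulA_ (x y z : A) : bmul x (bmul y z) = bmul (bmul x y) z.
Proof. by case: algA. Qed.
Lemma bmul1_ (x : A) : bmul bone x = x. Proof. by case: algA. Qed.
Lemma bmul_1 (x : A) : bmul x bone = x. Proof. by case: algA. Qed.
Lemma counitM (x y : A) : bcounit (bmul x y) = bcounit x * bcounit y.
Proof. by case: hA. Qed.
Lemma counit1 : bcounit (bone : A) = 1. Proof. by case: hA => _ []. Qed.
Lemma sw_comul1 U (f : A -> A -> U) : bl f -> sw (bcomul (bone : A)) f =
  f bone bone.
Proof. by case: hA => _ [-> _] _ _ _ ?; swt. Qed.
Lemma sw_comulM U (f : A -> A -> U) x y : bl f ->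
  sw (bcomul (bmul x y)) f =
  sw (bcomul x) (fun x1 x2 => sw (bcomul y) (fun y1 y2 =>
    f (bmul x1 y1) (bmul x2 y2))).
Proof.
case: hA => _ _ _ -> _ bf; rewrite sw_sw //; apply: eq_sw => x1 x2.
by rewrite sw_sw //; apply: eq_sw => y1 y2; swt.
Qed.
Lemma antipl U (f : A -> U) x : lin f ->
  sw (bcomul x) (fun x1 x2 => f (bmul (SA x1) x2)) = bcounit x *: f bone.
Proof.
by case: hA => _ _ _ _ [_ E _] lf; rewrite -linZ // -E sw_lin.
Qed.
Lemma antipr U (f : A -> U) x : lin f ->
  sw (bcomul x) (fun x1 x2 => f (bmul x1 (SA x2))) = bcounit x *: f bone.
Proof.
by case: hA => _ _ _ _ [_ _ E] lf; rewrite -linZ // -E sw_lin.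
Qed.
End Hopf.

Section Crossed.
Variables (k : fieldType) (A : bialgData k) (SA : A -> A) (hA : is_hopf SA).
Variables (V : lmodType k) (M : crossedData A V) (hM : is_crossed SA M).
Implicit Types U : lmodType k.
Let algA := hopf_alg hA.
Let coalgA := hopf_coalg hA.
Let linS := hopf_lin hA.
Local Notation "v ◁ a" := (xact M v a) (at level 35).

Lemma crossed_act : bl_act M. Proof. by case: hM => b _ _ _ _;
  exact: (bilin_bl b). Qed.
Lemma crossed_coact : lin_coact M. Proof. by case: hM. Qed.
Let bM := crossed_act.
Let lM := crossed_coact.
Lemma act1 v : v ◁ bone = v. Proof. by case: hM => _ []. Qed.
Lemma actM v a b : (v ◁ a) ◁ b = v ◁ (bmul a b). Proof. by case: hM =>
  _ []. Qed.
Lemma coact_coun U (f : V -> U) v : lin f ->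
  sw (xcoact M v) (fun v0 v1 => bcounit v1 *: f v0) = f v.
Proof.
move=> lf; case: hM => _ _ _ [/(_ v) E _] _.
by rewrite -[in RHS]E sw_lin //; apply: eq_sw => a b; rewrite linZ.
Qed.
Lemma coact_coass U (f : V -> A -> A -> U) v : trl f ->
  sw (xcoact M v) (fun v0 v1 => sw (xcoact M v0) (fun u w => f u w v1)) =
  sw (xcoact M v) (fun v0 v1 => sw (bcomul v1) (fun a b => f v0 a b)).
Proof.
move=> tf; case: hM => _ _ _ [_ /(_ v) E] _.
have := congr1 (fun t => sw t (fun u c => sw u (fun a b => f a b c))) E.
rewrite !sw_sw; [|lin..].
under eq_sw => x1 x2. swt. over.
move=> ->; apply: eq_sw => x1 x2; rewrite sw_sw; [|lin].
by apply: eq_sw => y z; swt; swt.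
Qed.

(** The crossed-module axiom freed of its antipode: in [b_2 (v ◁ b_3)_1] the factor [b_2] meets the
    leading [S b_3] and cancels it. The component [b_1] is a spectator, kept because the coproduct
    of [v b] needs it ([LV2_LA2]). *)
Lemma coact_act U (f : V -> A -> A -> U) v b : trl f ->
  sw (bcomul b) (fun b1 b2 => sw (bcomul b1) (fun c1 c2 =>
    sw (xcoact M (v ◁ b2)) (fun w0 w1 => f w0 c1 (bmul c2 w1)))) =
  sw (xcoact M v) (fun v0 v1 => sw (bcomul b) (fun b1 b2 =>
    sw (bcomul b1) (fun c1 c2 => f (v0 ◁ c2) c1 (bmul v1 b2)))).
Proof.
move=> tf; rewrite coass //; last by lin.
rewrite [RHS]sw_exch.
under [RHS]eq_sw => b1 b2 do rewrite sw_exch.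
rewrite coass //; last by lin.
apply: eq_sw => b1 b2.
under eq_sw => c2 r.
  case: (hM) => _ _ _ _ ->; rewrite sw_sw; last by lin.
  under eq_sw => v0 v1.
    rewrite sw_sw; last by lin.
    under eq_sw => e1 e'.
      rewrite sw_sw; last by lin.
      under eq_sw => e2 e3. swt. rewrite !(bmulA_ hA). over.
      over.
    over.
  rewrite sw_exch.
  over.
rewrite -coass //; last by lin.
transitivity (sw (bcomul b2) (fun q e' => bcounit q *:
  sw (bcomul e') (fun e2 e3 => sw (xcoact M v) (fun v0 v1 =>
    f (v0 ◁ e2) b1 (bmul v1 e3))))); last first.
  by apply: (counl coalgA); lin.
apply: eq_sw => q e'.
(* [K] isolates the place where the product [q_1 (S q_2)] stands; the antipode axiom then replaces
   [K (q_1 (S q_2))] by [bcounit q *: K bone]. *)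
pose K x := sw (bcomul e') (fun e2 e3 =>
  sw (xcoact M v) (fun v0 v1 => f (v0 ◁ e2) b1 (bmul (bmul x v1) e3))).
have lK : lin K by rewrite /K; lin.
etransitivity; last first.
  transitivity (bcounit q *: K bone); first exact: (antipr hA).
  congr (_ *: _); apply: eq_sw => e2 e3; apply: eq_sw => v0 v1.
  by rewrite (bmul1_ hA).
apply: eq_sw => c e1; rewrite /K sw_exch.
by apply: eq_sw => e2 e3; apply: eq_sw => v0 v1.
Qed.

(** [coact_act] with its spectator contracted by the counit. *)
Lemma coact_act_counit U (f : V -> A -> U) v b : bl f ->
  sw (bcomul b) (fun b1 b2 =>
    sw (xcoact M (v ◁ b2)) (fun w0 w1 => f w0 (bmul b1 w1))) =
  sw (xcoact M v) (fun v0 v1 => sw (bcomul b) (fun b1 b2 =>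
    f (v0 ◁ b1) (bmul v1 b2))).
Proof.
move=> bf.
transitivity (sw (bcomul b) (fun b1 b2 => sw (bcomul b1) (fun c1 c2 =>
    sw (xcoact M (v ◁ b2)) (fun w0 w1 => bcounit c1 *: f w0 (bmul c2 w1))))).
  apply: eq_sw => b1 b2; under [RHS]eq_sw => c1 c2 do rewrite sw_scale.
  by rewrite (counl coalgA (f := fun c => sw (xcoact M (v ◁ b2)) (fun w0 w1 =>
    f w0 (bmul c w1)))) //; lin.
rewrite (coact_act (f := fun v c d => bcounit c *: f v d)); last by lin.
apply: eq_sw => v0 v1; apply: eq_sw => b1 b2.
by rewrite (counl coalgA (f := fun c => f (v0 ◁ c) (bmul v1 b2))) //; lin.
Qed.
End Crossed.

(** * The smash product A # TV *)

(* [d a s] stands for [a ⊗ word s] in [A # TV], and [LA], [LV] for left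
   multiplication by elements of [A] and [V].  The record isolates what the
   proofs need to know about [A # TV]; in particular it is symmetric in the
   two sides of the pairing. *)
Record smash (k : fieldType) (A : bialgData k) (SA : A -> A) (V : lmodType k)
    (M : crossedData A V) (sigma : k) (E : bialgData k) (d : A -> seq V -> E)
    (LA : A -> E -> E) (LV : V -> E -> E) (g : bool -> E -> E) : Prop := Smash {
  sm_hopf : is_hopf SA;
  sm_crossed : is_crossed SA M;
  sm_sigma2 : sigma * sigma = 1;
  sm_dl : forall s, lin (d^~ s);
  sm_dm : forall a, multilin (d a);
  sm_lift : forall (U : lmodType k) (f : A -> seq V -> U),
    (forall s, lin (f^~ s)) -> (forall a, multilin (f a)) ->
    exists2 F : E -> U, lin F & forall a s, F (d a s) = f a s;
  sm_span : forall x, exists r : seq (A * seq V), x = \sum_(q <- r) d q.1 q.2;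
  sm_LA : bl LA;
  sm_LV : bl LV;
  sm_g : forall i, lin (g i);
  sm_LAd : forall a b s, LA a (d b s) = d (bmul a b) s;
  sm_LVd : forall v b s,
    LV v (d b s) = sw (bcomul b) (fun b1 b2 => d b1 (xact M v b2 :: s));
  sm_gd : forall i a s, g i (d a s) = if odd (size s) == i then d a s else 0;
  sm_one : bone = d bone [::];
  sm_mul : bl (@bmul k E);
  sm_muld : forall a s w, bmul (d a s) w = LA a (foldr LV w s);
  sm_comul : lin (@bcomul k E);
  sm_comuld : forall a s, bcomul (d a s) =
    sw (bcomul a) (fun a1 a2 => sw (foldr (fun v t =>
      sw (xcoact M v) (fun v0 v1 => sw t (fun x y => LV v0 x ⊗ LA v1 y))
      + sw t (fun x y => (g false x + sigma *: g true x) ⊗ LV v y))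
      (bone ⊗ bone) s) (fun x y => LA a1 x ⊗ LA a2 y));
  sm_counit : lin (@bcounit k E : E -> k^o);
  sm_counitd : forall a s, bcounit (d a s) = bcounit a * (size s == 0)%N%:R }.

(* [is_super_hopf] with [-1] replaced by [sigma]; for [sigma = 1] the coproduct
   is multiplicative without signs. *)
Definition sig_hopf (k : fieldType) (sigma : k) (D : bialgData k)
  (g : bool -> D -> D) (S : D -> D) : Prop :=
  [/\ is_algebra D /\ is_coalgebra D,
      is_grading g,
      [/\ forall i j (x y : D),
            g (i (+) j) (bmul (g i x) (g j y)) = bmul (g i x) (g j y),
          g false (bone : D) = bone,
          forall i (x : D), bcomul (g i x) =
            \sum_(j : bool)
              sw (bcomul x) (fun x1 x2 => g j x1 ⊗ g (i (+) j) x2),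
          forall x : D, bcounit (g true x) = 0
        & forall i (x : D), S (g i x) = g i (S x)],
      [/\ bcomul (bone : D) = bone ⊗ bone,
          bcounit (bone : D) = 1,
          forall x y : D, bcounit (bmul x y) = bcounit x * bcounit y
        & forall x y : D, bcomul (bmul x y) =
            \sum_(i : bool) \sum_(j : bool) sigma ^+ (i && j) *:
              sw (bcomul x) (fun x1 x2 => sw (bcomul y) (fun y1 y2 =>
                bmul x1 (g j y1) ⊗ bmul (g i x2) y2))]
    & is_antipode S].

Section Smash.
Variables (k : fieldType) (A : bialgData k) (SA : A -> A).
Variables (V : lmodType k) (M : crossedData A V).
Variables (sigma : k) (E : bialgData k) (d : A -> seq V -> E).
Variables (LA : A -> E -> E) (LV : V -> E -> E) (g : bool -> E -> E).
Hypothesis smE : smash SA M sigma d LA LV g.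

Let hA := sm_hopf smE.
Let hM := sm_crossed smE.
Let sigma2 := sm_sigma2 smE.
Let coalgA := hopf_coalg hA.
Let bM := crossed_act hM.
Let lM := crossed_coact hM.
Local Notation "v ◁ a" := (xact M v a) (at level 35).
Let bLA := sm_LA smE.
Let bLV := sm_LV smE.
Let gl := sm_g smE.
Let bmE := sm_mul smE.
Let lcE := sm_comul smE.
Let leE := sm_counit smE.

Definition parity (x : E) : E := g false x + sigma *: g true x.
Local Notation gam := parity.
(** [LA2] and [LV2] are left multiplication on E ⊗ E by the coproducts of a and of v, namely
    [a_1 ⊗ a_2] and [v_0 ⊗ v_1 + 1 ⊗ v]. The sign from moving v past the first factor sits in
    [gam x]. *)
Definition LA2 (a : A) (t : tensor E E) : tensor E E :=
  sw (bcomul a) (fun a1 a2 => sw t (fun x y => LA a1 x ⊗ LA a2 y)).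
Definition LV2 (v : V) (t : tensor E E) : tensor E E :=
  sw (xcoact M v) (fun v0 v1 => sw t (fun x y => LV v0 x ⊗ LA v1 y))
      + sw t (fun x y => gam x ⊗ LV v y).

Lemma lin_g (X : lmodType k) (e : X -> E) i : lin e -> lin (fun v => g i (e v)).
Proof. exact: (lin_comp (gl i)). Qed.
Hint Resolve lin_g : lin.
Lemma gam_lin : lin gam.
Proof. by rewrite /parity; lin. Qed.
Let gaml := gam_lin.
Lemma LA2_bl : bl LA2.
Proof. by rewrite /LA2; lin. Qed.
Lemma LV2_bl : bl LV2.
Proof. by rewrite /LV2; lin. Qed.
Let bLA2 := LA2_bl.
Let bLV2 := LV2_bl.

Lemma smash_d1 s : d bone s = foldr LV bone s.
Proof.
elim: s => [|v s IH] /=; first by rewrite (sm_one smE).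
rewrite -IH (sm_LVd smE) (sw_comul1 hA) ?(act1 hM) //.
split=> x; first exact: (sm_dl smE).
by apply: (lin_comp (f := fun w => d x (w :: s)));
  [exact: (sm_dm smE x [::])|lin].
Qed.

Lemma smash_d a s : d a s = LA a (foldr LV bone s).
Proof. by rewrite -smash_d1 (sm_LAd smE) (bmul_1 hA). Qed.

Lemma smash_extd (U : lmodType k) (f h : E -> U) : lin f -> lin h ->
  (forall a s, f (d a s) = h (d a s)) -> f =1 h.
Proof.
move=> lf lh fh x; have [r ->] := sm_span smE x.
by rewrite !lin_sum //; apply: eq_bigr.
Qed.

(** E is spanned by iterated left multiplications applied to 1. This principle and its form
    [smash_ext] for linear maps carry nearly all later inductions. *)
Lemma smash_ind (Q : E -> Prop) : Q 0 -> (forall x y, Q x -> Q y ->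
  Q (x + y)) ->
  Q bone -> (forall a z, Q z -> Q (LA a z)) -> (forall v z, Q z ->
    Q (LV v z)) ->
  forall z, Q z.
Proof.
move=> Q0 QD Q1 QA QV z; have [r ->] := sm_span smE z.
elim/big_ind: _ => // -[a s] _; rewrite smash_d; apply: QA.
by elim: s => //= v s; exact: QV.
Qed.

Lemma smash_ext (U : lmodType k) (f h : E -> U) : lin f -> lin h ->
  f bone = h bone -> (forall a z, f z = h z -> f (LA a z) = h (LA a z)) ->
  (forall v z, f z = h z -> f (LV v z) = h (LV v z)) -> f =1 h.
Proof.
move=> lf lh; apply: smash_ind; first by rewrite !lin0.
by move=> x y; rewrite !linD // => -> ->.
Qed.

Lemma LA_LA a b z : LA a (LA b z) = LA (bmul a b) z.
Proof.
move: z; apply: smash_extd; [lin|lin|] => c s.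
by rewrite !(sm_LAd smE) (bmulA_ hA).
Qed.
Lemma LA_1 z : LA bone z = z.
Proof.
move: z; apply: smash_extd; [lin|lin|] => c s.
by rewrite !(sm_LAd smE) (bmul1_ hA).
Qed.
Lemma bl_dcons v s : bl (fun a b => d a (v ◁ b :: s)).
Proof.
split=> x; first exact: (sm_dl smE).
by apply: (lin_comp (f := fun w => d x (w :: s)));
  [exact: (sm_dm smE x [::])|lin].
Qed.
Lemma LV_LA v a z :
  LV v (LA a z) = sw (bcomul a) (fun a1 a2 => LA a1 (LV (v ◁ a2) z)).
Proof.
move: z; apply: smash_extd; [lin|lin|] => c s.
rewrite (sm_LAd smE) (sm_LVd smE) (sw_comulM hA); last exact: bl_dcons.
apply: eq_sw => a1 a2; rewrite (sm_LVd smE) sw_lin; last by lin.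
by apply: eq_sw => c1 c2; rewrite (sm_LAd smE) (actM hM).
Qed.

Lemma mul1E (w : E) : bmul bone w = w.
Proof. by rewrite (sm_one smE) (sm_muld smE) LA_1. Qed.
Lemma LA_mul a (z w : E) : bmul (LA a z) w = LA a (bmul z w).
Proof.
move: z; apply: smash_extd; [lin|lin|] => c s.
by rewrite (sm_LAd smE) !(sm_muld smE) LA_LA.
Qed.
Lemma LV_mul v (z w : E) : bmul (LV v z) w = LV v (bmul z w).
Proof.
move: z; apply: smash_extd; [lin|lin|] => c s.
rewrite (sm_LVd smE) (sw_lin (L := fun x => bmul x w)); last by lin.
rewrite (sm_muld smE) LV_LA.
by apply: eq_sw => c1 c2; rewrite (sm_muld smE).
Qed.
Lemma mulE1 (z : E) : bmul z bone = z.
Proof.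
move: z; apply: smash_ext; [lin|lin|exact: mul1E| |].
  by move=> a z IH; rewrite LA_mul IH.
by move=> v z IH; rewrite LV_mul IH.
Qed.
Lemma mulEA (x y z : E) : bmul x (bmul y z) = bmul (bmul x y) z.
Proof.
move: x; apply: smash_ext; [lin|lin|by rewrite !mul1E| |].
  by move=> a x IH; rewrite !LA_mul IH.
by move=> v x IH; rewrite !LV_mul IH.
Qed.
Lemma smash_alg : is_algebra E.
Proof.
by split; [exact: bl_bilin|exact: mulEA|exact: mul1E|exact: mulE1].
Qed.

Lemma counitE1 : bcounit (bone : E) = 1.
Proof. by rewrite (sm_one smE) (sm_counitd smE) (counit1 hA) mulr1. Qed.
Lemma counit_LA a z : bcounit (LA a z) = bcounit a * bcounit z.
Proof.
apply: (smash_extd (U := k^o) (f := fun z => bcounit (LA a z)) (h := fun z =>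
  bcounit a * bcounit z)); [lin|lin|] => c s.
by rewrite (sm_LAd smE) !(sm_counitd smE) (counitM hA) mulrA.
Qed.
Lemma counit_LV v z : bcounit (LV v z) = 0.
Proof.
apply: (smash_extd (U := k^o) (f := fun z => bcounit (LV v z)) (h := fun z =>
  0)); [lin|lin|] => c s.
rewrite (sm_LVd smE) (sw_lin (L := (@bcounit k E : E -> k^o))); last by lin.
by apply: sw_zero => c1 c2; rewrite (sm_counitd smE) mulr0.
Qed.
Lemma counitEM (x y : E) : bcounit (bmul x y : E) = bcounit x * bcounit y.
Proof.
apply: (smash_ext (U := k^o) (f := fun x => bcounit (bmul x y)) (h := fun x =>
  bcounit x * bcounit y)); [lin|lin|by rewrite mul1E counitE1 mul1r| |].
  by move=> a {}x IH; rewrite LA_mul !counit_LA IH mulrA.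
by move=> v {}x _; rewrite LV_mul !counit_LV mul0r.
Qed.

Lemma g_LA i a z : g i (LA a z) = LA a (g i z).
Proof.
move: z; apply: smash_extd; [lin|lin|] => c s.
by rewrite (sm_LAd smE) !(sm_gd smE); case: eqP;
  rewrite ?(sm_LAd smE) ?(bl0r bLA).
Qed.
Lemma g_LV i v z : g i (LV v z) = LV v (g (~~ i) z).
Proof.
move: z; apply: smash_extd; [lin|lin|] => c s.
rewrite (sm_LVd smE) sw_lin; last by lin.
under eq_sw => c1 c2 do rewrite (sm_gd smE) /= eqb_negLR.
rewrite (sm_gd smE); case: eqP => _; first by rewrite (sm_LVd smE).
by rewrite (lin0 (bLV.2 _)) sw_zero.
Qed.
Lemma g_1 i : g i bone = if i then 0 else bone.
Proof. by rewrite (sm_one smE) (sm_gd smE); case: i. Qed.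
Lemma g_g i j z : g i (g j z) = if i == j then g i z else 0.
Proof.
move: z; apply: smash_extd; [lin|by apply: lin_if; lin|] => c s.
rewrite !(sm_gd smE); have [<-|n] := altP (odd (size s) =P j).
  by rewrite (sm_gd smE) [i == _]eq_sym; case: eqP.
by rewrite (lin0 (gl i)); case: eqP => // ->; rewrite (negPf n).
Qed.
Lemma g_D z : g false z + g true z = z.
Proof.
move: z; apply: smash_extd; [lin|lin|] => c s.
by rewrite !(sm_gd smE); case: odd; rewrite ?add0r ?addr0.
Qed.
Lemma gam_LA a z : gam (LA a z) = LA a (gam z).
Proof. by rewrite /parity !g_LA (linD (bLA.2 a)) (linZ _ _ (bLA.2 a)). Qed.
Lemma gam_LV v z : gam (LV v z) = sigma *: LV v (gam z).
Proof.
rewrite /parity !g_LV (linD (bLV.2 v)) (linZ _ _ (bLV.2 v)) /=.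
by rewrite scalerDr scalerA sigma2 scale1r addrC.
Qed.
Lemma gam_1 : gam bone = bone.
Proof. by rewrite /parity !g_1 scaler0 addr0. Qed.
Lemma gam_g i z : gam (g i z) = sigma ^+ i *: g i z.
Proof.
by rewrite /parity !g_g; case: i => /=; rewrite ?scaler0 ?addr0 ?add0r ?scale1r.
Qed.

Lemma sw_LA2 (U : lmodType k) (f : E -> E -> U) a t : bl f ->
  sw (LA2 a t) f = sw (bcomul a) (fun a1 a2 => sw t (fun x y =>
    f (LA a1 x) (LA a2 y))).
Proof.
move=> bf; rewrite /LA2 sw_sw //; apply: eq_sw => a1 a2.
by rewrite sw_sw //; apply: eq_sw => x y; swt.
Qed.
Lemma sw_LV2 (U : lmodType k) (f : E -> E -> U) v t : bl f ->
  sw (LV2 v t) f =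
  sw (xcoact M v) (fun v0 v1 => sw t (fun x y => f (LV v0 x) (LA v1 y)))
  + sw t (fun x y => f (gam x) (LV v y)).
Proof.
move=> bf; rewrite /LV2 (linD (lin_sw_arg bf)); congr (_ + _).
  rewrite sw_sw //; apply: eq_sw => a1 a2.
  by rewrite sw_sw //; apply: eq_sw => x y; swt.
by rewrite sw_sw //; apply: eq_sw => x y; swt.
Qed.

Lemma LA2_LA2 a b t : LA2 a (LA2 b t) = LA2 (bmul a b) t.
Proof.
move: t; apply: tensor_ext; [lin|lin|] => x y.
rewrite /LA2 (sw_comulM hA); last by lin.
apply: eq_sw => a1 a2; rewrite sw_sw; last by lin.
apply: eq_sw => b1 b2; do !swt.
by rewrite !LA_LA.
Qed.

(** The relation [v b = b_1 (v ◁ b_2)] survives the coproduct. For the component [v_0 ⊗ v_1] this is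
    the crossed-module axiom ([coact_act]); for [1 ⊗ v] it is coassociativity of A. *)
Lemma LV2_LA2 v b t :
  LV2 v (LA2 b t) = sw (bcomul b) (fun b1 b2 => LA2 b1 (LV2 (v ◁ b2) t)).
Proof.
move: t; apply: tensor_ext; [lin|lin|] => x y.
transitivity (sw (xcoact M v) (fun v0 v1 => sw (bcomul b) (fun b1 b2 =>
    sw (bcomul b1) (fun c1 c2 => LA c1 (LV (v0 ◁ c2) x) ⊗ LA (bmul v1 b2) y)))
  + sw (bcomul b) (fun b1 b2 => sw (bcomul b2) (fun c1 c2 =>
      LA b1 (gam x) ⊗ LA c1 (LV (v ◁ c2) y)))).
  rewrite /LV2 /LA2; congr (_ + _).
    apply: eq_sw => v0 v1; rewrite sw_sw; last by lin.
    apply: eq_sw => b1 b2; do 2!swt.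
    rewrite LV_LA LA_LA (sw_lin (L := fun z => z ⊗ _)) //; lin.
  rewrite sw_sw; last by lin.
  apply: eq_sw => b1 b2; do 2!swt; rewrite gam_LA LV_LA sw_lin //; lin.
transitivity (sw (bcomul b) (fun b1 b2 => sw (bcomul b1) (fun c1 c2 =>
    sw (xcoact M (v ◁ b2)) (fun w0 w1 => LA c1 (LV w0 x) ⊗ LA (bmul c2 w1) y)))
  + sw (bcomul b) (fun b1 b2 => sw (bcomul b1) (fun c1 c2 =>
      LA c1 (gam x) ⊗ LA c2 (LV (v ◁ b2) y)))).
  congr (_ + _).
    by rewrite (coact_act hA hM (f := fun v a c =>
      LA a (LV v x) ⊗ LA c y)) //; lin.
  by rewrite coass //; lin.
rewrite -sw_add; apply: eq_sw => b1 b2; rewrite /LA2 -sw_add.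
apply: eq_sw => c1 c2; rewrite sw_LV2; last by lin.
congr (_ + _); last by swt.
by apply: eq_sw => w0 w1; swt; rewrite LA_LA.
Qed.

Lemma comul1 : bcomul (bone : E) = bone ⊗ bone.
Proof.
rewrite {1}(sm_one smE) (sm_comuld smE) (sw_comul1 hA) /=; last by lin.
by swt; rewrite !LA_1.
Qed.
Let LV2s s := foldr LV2 (bone ⊗ bone : tensor E E) s.
Lemma comul_d a s : bcomul (d a s) = LA2 a (LV2s s).
Proof. exact: (sm_comuld smE). Qed.
Lemma comul_LA a z : bcomul (LA a z) = LA2 a (bcomul z).
Proof.
move: z; apply: smash_extd; [lin|lin|] => b s.
by rewrite (sm_LAd smE) !comul_d LA2_LA2.
Qed.
(** The coproduct is given on [d b s], with b in front, whereas here v stands in front of b;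
    [LV2_LA2] lets [LV2 v] pass [LA2 b]. *)
Lemma comul_LV v z : bcomul (LV v z) = LV2 v (bcomul z).
Proof.
move: z; apply: smash_extd; [lin|lin|] => b s.
rewrite (sm_LVd smE) comul_d LV2_LA2 sw_lin; last by lin.
by apply: eq_sw => b1 b2; rewrite comul_d.
Qed.

Lemma g_gam i z : g i (gam z) = sigma ^+ i *: g i z.
Proof.
rewrite /parity (linD (gl i)) (linZ _ _ (gl i)) !g_g.
by case: i => /=; rewrite ?scaler0 ?addr0 ?add0r ?scale1r.
Qed.

(** The degree is additive under the coproduct, so [gam] is a coalgebra map. Coassociativity of E
    needs this for the summand [gam x ⊗ LV v y]. *)
Lemma comul_gam z :
  bcomul (gam z) = sw (bcomul z) (fun x y => gam x ⊗ gam y).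
Proof.
move: z; apply: smash_ext => [| | |a z IH|v z IH].
- by lin.
- by lin.
- by rewrite gam_1 comul1; swt; rewrite gam_1.
- rewrite gam_LA !comul_LA IH sw_LA2; last by lin.
  apply: eq_sw => a1 a2; rewrite sw_sw; last by lin.
  by apply: eq_sw => x y; swt; rewrite !gam_LA.
rewrite gam_LV linZ // !comul_LV IH sw_LV2; last by lin.
rewrite /LV2 scalerDr -!sw_scale; congr (_ + _).
  apply: eq_sw => v0 v1; rewrite sw_sw; last by lin.
  rewrite -sw_scale; apply: eq_sw => x y; swt.
  by rewrite gam_LV gam_LA tensZl.
rewrite sw_sw; last by lin.
apply: eq_sw => x y; swt.
by rewrite gam_LV tensZr.
Qed.

Lemma comul_g i z : bcomul (g i z) =
  \sum_(j : bool) sw (bcomul z) (fun x1 x2 => g j x1 ⊗ g (i (+) j) x2).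
Proof.
move: z i; apply: smash_ind => [|x y IHx IHy| |a z IH|v z IH] i.
- rewrite (lin0 (gl i)) (lin0 lcE) big1 // => j _; rewrite sw_0 //; lin.
- rewrite (linD (gl i)) (linD lcE) IHx IHy -big_split /=.
  by apply: eq_bigr => j _; rewrite (linD lcE) sw_argD //; lin.
- rewrite g_1 comul1 big_bool /=; do 2!swt; rewrite !g_1 addbT addbF.
  by case: i => /=; rewrite ?comul1 ?(lin0 lcE) tens0l ?tens0r add0r.
- rewrite g_LA !comul_LA IH (lin_sum _ _ _ (bLA2.2 a)); apply: eq_bigr => j _.
  rewrite sw_LA2; last by lin.
  rewrite /LA2; apply: eq_sw => a1 a2; rewrite sw_sw; last by lin.
  by apply: eq_sw => x y; swt; rewrite !g_LA.
rewrite g_LV !comul_LV IH (lin_sum _ _ _ (bLV2.2 v)).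
transitivity (\sum_(j : bool) (sw (xcoact M v) (fun v0 v1 => sw (bcomul z)
    (fun x y => LV v0 (g j x) ⊗ LA v1 (g (~~ i (+) j) y)))) +
  \sum_(j : bool) sw (bcomul z)
    (fun x y => gam (g j x) ⊗ LV v (g (~~ i (+) j) y))).
  rewrite -big_split; apply: eq_bigr => j _; rewrite /LV2 /=; congr (_ + _).
    apply: eq_sw => v0 v1; rewrite sw_sw; last by lin.
    by apply: eq_sw => x y; swt.
  rewrite sw_sw; last by lin.
  by apply: eq_sw => x y; swt.
(* Multiplying the first tensor factor by [v0] flips its parity, so the first sum is reindexed by
   negation. In the second sum v acts on the second factor and j stays. *)
rewrite (reindex_inj (inv_inj negbK)) -big_split; apply: eq_bigr => j _ /=.
rewrite sw_LV2; last by lin.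
congr (_ + _).
  apply: eq_sw => v0 v1; apply: eq_sw => x y.
  by rewrite g_LV g_LA addNb addbN negbK.
by apply: eq_sw => x y; rewrite g_gam gam_g g_LV addNb.
Qed.

Lemma gam_mul (x y : E) : gam (bmul x y) = bmul (gam x) (gam y).
Proof.
move: x; apply: smash_ext; [lin|lin|by rewrite gam_1 !mul1E| |].
  by move=> a x IH; rewrite LA_mul !gam_LA IH LA_mul.
move=> v x IH; rewrite LV_mul !gam_LV IH (blZl bmE) /= LV_mul //.
Qed.

Lemma g_mul i j (x y : E) :
  g (i (+) j) (bmul (g i x) (g j y)) = bmul (g i x) (g j y).
Proof.
move: x i; apply: smash_ind => [|x x' IHx IHy| |a z IH|v z IH] i.
- by rewrite (lin0 (gl i)) (bl0l bmE) (lin0 (gl _)).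
- by rewrite (linD (gl i)) (blDl bmE) (linD (gl _)) IHx IHy.
- rewrite g_1; case: i; first by rewrite (bl0l bmE) (lin0 (gl _)).
  by rewrite mul1E g_g eqxx.
- by rewrite g_LA LA_mul g_LA IH.
by rewrite g_LV LV_mul g_LV -addNb IH.
Qed.

Lemma g_grading : is_grading g.
Proof. by split; [exact: gl|exact: g_D|exact: g_g]. Qed.

Lemma counit_g x : bcounit (g true x) = 0.
Proof.
apply: (smash_extd (U := k^o) (f := fun z => bcounit (g true z)) (h := fun z =>
  0)); [lin|lin|] => c s.
rewrite (sm_gd smE); case: eqP => [|_]; last by rewrite (lin0 leE).
by rewrite (sm_counitd smE); case: s => //=; rewrite mulr0.
Qed.

Let gamj (j : bool) x := if j then gam x else x.
Let lin_gamj j : lin (gamj j). Proof. by rewrite /gamj; case: j; lin. Qed.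
Lemma gamjE j x : gamj j x = \sum_(i : bool) sigma ^+ (i && j) *: g i x.
Proof.
rewrite big_bool /= !scale1r; case: j => /=; last by rewrite addrC scale1r g_D.
by rewrite addrC.
Qed.

(** The form of multiplicativity suited to induction: summing the signs over the parity of [x2]
    first turns them into [gamj j x2], and [gam] commutes with [LA], and with [LV] up to the factor
    sigma. *)
Lemma comulM_gam (x y : E) : bcomul (bmul x y) =
  \sum_(j : bool) sw (bcomul x) (fun x1 x2 => sw (bcomul y) (fun y1 y2 =>
    bmul x1 (g j y1) ⊗ bmul (gamj j x2) y2)).
Proof.
have lj (X : lmodType k) (e : X -> E) j : lin e -> lin (fun v => gamj j (e v)).
  exact: (lin_comp (lin_gamj j)).
have bl1 j : bl (fun x1 x2 => sw (bcomul y) (fun y1 y2 =>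
    bmul x1 (g j y1) ⊗ bmul (gamj j x2) y2)).
  split=> z; first by lin.
  by apply: lin_swr => y1 y2; apply: lin_tens_r; apply: (lin_comp (bmE.1 y2));
    exact: lin_gamj.
move: x; apply: smash_ext => [| | |a x IH|v x IH].
- by lin.
- by apply: lin_big => j; apply: lin_swl => //; lin.
- rewrite mul1E comul1 big_bool /=; do 2!swt; rewrite gam_1 -sw_add.
  rewrite -[LHS]sw_id; apply: eq_sw => y1 y2; rewrite !mul1E.
  by rewrite -{1}[y1]g_D addrC tensDl.
- rewrite LA_mul !comul_LA IH (lin_sum _ _ _ (bLA2.2 a)); apply: eq_bigr => j _.
  rewrite sw_LA2 // /LA2; apply: eq_sw => a1 a2; rewrite sw_sw; last by lin.
  apply: eq_sw => x1 x2; rewrite sw_sw; last by lin.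
  apply: eq_sw => y1 y2; swt; rewrite LA_mul /gamj.
  by case: (j); rewrite ?gam_LA LA_mul.
rewrite LV_mul !comul_LV IH (lin_sum _ _ _ (bLV2.2 v)); apply: eq_bigr => j _.
rewrite sw_LV2 // /LV2; congr (_ + _).
  apply: eq_sw => v0 v1; rewrite sw_sw; last by lin.
  apply: eq_sw => x1 x2; rewrite sw_sw; last by lin.
  apply: eq_sw => y1 y2; swt; rewrite LV_mul /gamj.
  by case: (j); rewrite ?gam_LA LA_mul.
rewrite sw_sw; last by lin.
apply: eq_sw => x1 x2; rewrite sw_sw; last by lin.
(* For odd [y1] both sides acquire one factor sigma: on the left from [gam (g j y1)], on the right
   from moving [gam] past v in [gam (LV v x2)]. *)
apply: eq_sw => y1 y2; swt; rewrite gam_mul gam_g /gamj; case: (j) => /=.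
  rewrite gam_LV (blZl bmE) /= LV_mul (blZr bmE).
  by rewrite tensZl tensZr.
by rewrite scale1r LV_mul.
Qed.

Lemma comulEM (x y : E) : bcomul (bmul x y) =
  \sum_(i : bool) \sum_(j : bool) sigma ^+ (i && j) *:
    sw (bcomul x) (fun x1 x2 => sw (bcomul y) (fun y1 y2 =>
      bmul x1 (g j y1) ⊗ bmul (g i x2) y2)).
Proof.
rewrite comulM_gam [RHS]exchange_big /=; apply: eq_bigr => j _.
under [RHS]eq_bigr => i _ do rewrite -sw_scale.
rewrite -sw_sum; apply: eq_sw => x1 x2.
under [RHS]eq_bigr => i _ do rewrite -sw_scale.
rewrite -sw_sum; apply: eq_sw => y1 y2.
rewrite gamjE (lin_sum _ _ _ (bmE.1 _)) tens_sumr.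
apply: eq_bigr => i _.
by rewrite (blZl bmE) tensZr.
Qed.

Lemma smash_coass (z : E) (U : lmodType k) (f : E -> E -> E -> U) : trl f ->
  sw (bcomul z) (fun x1 x2 => sw (bcomul x1) (fun y z => f y z x2)) =
  sw (bcomul z) (fun x1 x2 => sw (bcomul x2) (fun y z => f x1 y z)).
Proof.
move=> tf; move: z U f tf; apply: smash_ind => [|x y IHx IHy| |a z IH|v z IH] U
  f tf.
- by rewrite (lin0 lcE) !sw_0 //; lin.
- rewrite (linD lcE) sw_argD; last by lin.
  rewrite [RHS]sw_argD; last by lin.
  by rewrite IHx // IHy.
- by rewrite comul1; do 2!swt; rewrite comul1; do 2!swt.
- rewrite comul_LA sw_LA2; last by lin.
  rewrite [RHS]sw_LA2; last by lin.
  under eq_sw => a1 a2.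
    under eq_sw => x y. rewrite comul_LA sw_LA2; last by lin.
      over.
    rewrite sw_exch. over.
  rewrite coass //; last by lin.
  apply: eq_sw => a1 a2; under [RHS]eq_sw => x y.
    rewrite comul_LA sw_LA2; last by lin.
    over.
  rewrite [RHS]sw_exch; apply: eq_sw => b1 b2.
  by rewrite IH //; lin.
rewrite comul_LV sw_LV2; last by lin.
rewrite [RHS]sw_LV2; last by lin.
(* The three summands come from the iterated coproduct of v: [v_0 ⊗ v_1 ⊗ v_2], [1 ⊗ v_0 ⊗ v_1] and
   [1 ⊗ 1 ⊗ v]. *)
transitivity ((sw (xcoact M v) (fun v0 v1 => sw (bcomul v1) (fun a b =>
    sw (bcomul z) (fun x y => sw (bcomul y) (fun y1 y2 =>
      f (LV v0 x) (LA a y1) (LA b y2)))))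
  + sw (xcoact M v) (fun v0 v1 => sw (bcomul z) (fun x y =>
      sw (bcomul y) (fun y1 y2 => f (gam x) (LV v0 y1) (LA v1 y2)))))
  + sw (bcomul z) (fun x y => sw (bcomul y) (fun y1 y2 =>
      f (gam x) (gam y1) (LV v y2)))).
  congr (_ + _).
    rewrite -(coact_coass hM (f := fun v0 a b => sw (bcomul z) (fun x y =>
      sw (bcomul y) (fun y1 y2 => f (LV v0 x) (LA a y1) (LA b y2)))));
      last by lin.
    rewrite -sw_add; apply: eq_sw => v0 v1.
    under eq_sw => x y.
      rewrite comul_LV sw_LV2; last by lin.
      over.
    rewrite sw_add sw_exch; congr (_ + _); last by rewrite IH //; lin.
    by apply: eq_sw => u0 u1; rewrite IH //; lin.
  rewrite -IH; last by lin.
  by apply: eq_sw => x y; rewrite comul_gam sw_sw; [apply: eq_sw => *; swt|lin].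
rewrite -addrA; congr (_ + _).
  apply: eq_sw => v0 v1; rewrite sw_exch; apply: eq_sw => x y.
  by rewrite comul_LA sw_LA2 //; lin.
rewrite sw_exch -sw_add; apply: eq_sw => x y.
by rewrite comul_LV sw_LV2 //; lin.
Qed.

Lemma smash_counl z : sw (bcomul z) (fun x1 x2 => bcounit x1 *: x2) = z :> E.
Proof.
move: z; apply: smash_ext => [| | |a z IH|v z IH]; [lin|lin|..].
- by rewrite comul1; swt; rewrite counitE1 scale1r.
- rewrite comul_LA sw_LA2; last by lin.
  under eq_sw => a1 a2. under eq_sw => x y.
    rewrite counit_LA -scalerA -(blZr bLA). over.
    rewrite sw_scale -sw_lin; last by lin.
    rewrite IH. over.
  by rewrite (counl coalgA (f := fun a => LA a z)) //; lin.
rewrite comul_LV sw_LV2; last by lin.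
rewrite sw_zero ?add0r; last first.
  by move=> v0 v1; apply: sw_zero => x y; rewrite counit_LV scale0r.
rewrite -[in RHS]IH [RHS]sw_lin; last by lin.
apply: eq_sw => x y; rewrite (blZr bLV); congr (_ *: _).
by rewrite -{2}[x]g_D /parity !(linD leE) (linZ _ _ leE) counit_g scaler0.
Qed.

Lemma smash_counr z : sw (bcomul z) (fun x1 x2 => bcounit x2 *: x1) = z :> E.
Proof.
move: z; apply: smash_ext => [| | |a z IH|v z IH]; [lin|lin|..].
- by rewrite comul1; swt; rewrite counitE1 scale1r.
- rewrite comul_LA sw_LA2; last by lin.
  under eq_sw => a1 a2. under eq_sw => x y.
    rewrite counit_LA -scalerA -(blZr bLA). over.
    rewrite sw_scale -sw_lin; last by lin.
    rewrite IH. over.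
  by rewrite (counr coalgA (f := fun a => LA a z)) //; lin.
rewrite comul_LV sw_LV2; last by lin.
rewrite addrC sw_zero ?add0r; last first.
  by move=> x y; rewrite counit_LV scale0r.
under eq_sw => v0 v1. under eq_sw => x y.
  rewrite counit_LA -scalerA -(blZr bLV). over.
  rewrite sw_scale -sw_lin; last by lin.
  rewrite IH. over.
by rewrite (coact_coun hM (f := fun v => LV v z)) //; lin.
Qed.

Lemma smash_coalg : is_coalgebra E.
Proof.
split; [exact: lcE|exact: leE| |exact: smash_counl|exact: smash_counr].
by move=> z; rewrite smash_coass //; lin.
Qed.

Lemma smash_sig_hopf S : is_antipode S -> (forall i x, S (g i x) = g i (S x)) ->
  sig_hopf sigma g S.
Proof.
move=> hS Sg; split; first by split; [exact: smash_alg|exact: smash_coalg].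
- exact: g_grading.
- split=> //; [exact: g_mul|by rewrite g_1|exact: comul_g|exact: counit_g].
- split; [exact: comul1|exact: counitE1|exact: counitEM|exact: comulEM].
- by [].
Qed.
End Smash.

(** * Antipodes: antimultiplicativity on A, construction on A # TV *)

Section AntipodeMul.
Variables (k : fieldType) (A : bialgData k) (SA : A -> A) (hA : is_hopf SA).
Let algA := hopf_alg hA.
Let coalgA := hopf_coalg hA.
Let linS := hopf_lin hA.

Lemma antip1 : SA bone = bone.
Proof.
have := antipl hA (f := fun x : A => x) bone (@lin_id k A).
by rewrite (sw_comul1 hA) ?(bmul_1 hA) ?(counit1 hA) ?scale1r //; lin.
Qed.

(** Both sides equal [S (a_1 b_1) a_2 b_2 (S b_3) (S a_3)]. Contracting the last four factors, from
    [b_2 (S b_3)] outwards, gives the left side; contracting the first three gives the right side.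
    [F] is the expression with its leading factor made a parameter. *)
Lemma antipM (a b : A) : SA (bmul a b) = bmul (SA b) (SA a).
Proof.
pose F (c a' b' : A) := sw (bcomul a') (fun a2 a3 =>
  sw (bcomul b') (fun b2 b3 =>
   bmul c (bmul (bmul a2 (bmul b2 (SA b3))) (SA a3)))).
have FE c a' b' : F c a' b' = bcounit a' *: (bcounit b' *: c).
  transitivity (sw (bcomul a') (fun a2 a3 =>
      bcounit b' *: bmul c (bmul a2 (SA a3)))).
    apply: eq_sw => a2 a3.
    rewrite (antipr hA (f := fun x => bmul c (bmul (bmul a2 x) (SA a3))))
      ?(bmul_1 hA) //; lin.
  rewrite sw_scale (antipr hA (f := fun x => bmul c x)) ?(bmul_1 hA) //;
    last by lin.
  by rewrite !scalerA mulrC.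
transitivity (sw (bcomul a) (fun a1 a' => sw (bcomul b) (fun b1 b' =>
    F (SA (bmul a1 b1)) a' b'))).
  rewrite -(counr coalgA (f := fun a => SA (bmul a b))); last by lin.
  apply: eq_sw => a1 a'.
  rewrite -(counr coalgA (f := fun b => SA (bmul a1 b))); last by lin.
  by rewrite -sw_scale; apply: eq_sw => b1 b'; rewrite FE.
rewrite /F; under eq_sw => a1 a' do rewrite sw_exch.
rewrite -coass //; last by lin.
transitivity (sw (bcomul a) (fun a' a3 => sw (bcomul b) (fun b' b3 =>
   bcounit a' *: (bcounit b' *: bmul (SA b3) (SA a3))))); last first.
  under eq_sw => a' a3.
    rewrite sw_scale (counl coalgA (f := fun b3 => bmul (SA b3) (SA a3)));
      last by lin.
    over.
  by rewrite (counl coalgA (f := fun a3 => bmul (SA b) (SA a3))) //; lin.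
apply: eq_sw => a' a3.
transitivity (sw (bcomul a') (fun a1 a2 => sw (bcomul b) (fun b' b3 =>
  sw (bcomul b') (fun b1 b2 => bmul (bmul (SA (bmul a1 b1)) (bmul a2 b2)) (bmul
    (SA b3) (SA a3)))))).
  apply: eq_sw => a1 a2; rewrite [RHS]coass //; last by lin.
  apply: eq_sw => b1 b'; apply: eq_sw => b2 b3.
  by rewrite !(bmulA_ hA).
rewrite sw_exch; apply: eq_sw => b' b3.
pose G x := bmul x (bmul (SA b3) (SA a3)).
have lG : lin G by rewrite /G; lin.
transitivity (G (bcounit (bmul a' b') *: bone)); last first.
  by rewrite (linZ _ _ lG) /G (bmul1_ hA) (counitM hA) scalerA.
rewrite (linZ _ _ lG) -(antipl hA (f := G)) // (sw_comulM hA) //; lin.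
Qed.
End AntipodeMul.

Section SmashAntipode.
Variables (k : fieldType) (A : bialgData k) (SA : A -> A).
Variables (V : lmodType k) (M : crossedData A V).
Variables (sigma : k) (E : bialgData k) (d : A -> seq V -> E).
Variables (LA : A -> E -> E) (LV : V -> E -> E) (g : bool -> E -> E).
Hypothesis smE : smash SA M sigma d LA LV g.

Let hA := sm_hopf smE.
Let hM := sm_crossed smE.
Let algA := hopf_alg hA.
Let coalgA := hopf_coalg hA.
Let linS := hopf_lin hA.
Let bM := crossed_act hM.
Let lM := crossed_coact hM.
Local Notation "v ◁ a" := (xact M v a) (at level 35).
Let bLA := sm_LA smE.
Let bLV := sm_LV smE.
Let gl := sm_g smE.
Let bmE := sm_mul smE.
Let lcE := sm_comul smE.
Let leE := sm_counit smE.
Local Notation gam := (parity sigma g).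
Let gaml : lin gam := gam_lin smE.

(** The antipode on a letter, forced by the antipode axiom on [v_0 ⊗ v_1 + 1 ⊗ v]: it reads
    [v_0 (S v_1) + S v = 0]. *)
Let SV v := - sw (xcoact M v) (fun v0 v1 => LV v0 (LA (SA v1) bone)).
Let lSV : lin SV. Proof. by rewrite /SV; lin. Qed.

(* Writing [X a] for either side, [a_1 (X a_2) = counit a (v z)], which determines
   [X a = S a_1 a_2 (X a_3)]. *)
Lemma LV_S v a z :
  sw (bcomul a) (fun a1 a2 => LV (v ◁ a1) (LA (SA a2) z)) = LA (SA a) (LV v z).
Proof.
pose X a := sw (bcomul a) (fun a1 a2 => LV (v ◁ a1) (LA (SA a2) z)).
have lX : lin X by rewrite /X; lin.
have H b : sw (bcomul b) (fun b1 b2 => LA b1 (X b2)) = bcounit b *: LV v z.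
  transitivity (sw (bcomul b) (fun b1 b2 => LV v (LA (bmul b1 (SA b2)) z))).
    under [RHS]eq_sw => b1 b2 do rewrite -(LA_LA smE) (LV_LA smE).
    rewrite [RHS]coass //; last by lin.
    by apply: eq_sw => b1 b2; rewrite /X sw_lin //; lin.
  rewrite (antipr hA (f := fun b => LV v (LA b z))) ?(LA_1 smE) //; lin.
rewrite -/(X a) -(counl coalgA (f := X)) //.
transitivity (sw (bcomul a) (fun a1 a2 => sw (bcomul a1) (fun b1 b2 =>
   LA (bmul (SA b1) b2) (X a2)))).
  apply: eq_sw => a1 a2; rewrite (antipl hA (f := fun b => LA b (X a2))).
    by rewrite (LA_1 smE).
  by lin.
rewrite coass //; last by lin.
rewrite -(counr coalgA (f := fun a => LA (SA a) (LV v z))); last by lin.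
apply: eq_sw => a1 a2; rewrite -(blZr bLA) -H sw_lin; last by lin.
by apply: eq_sw => b1 b2; rewrite (LA_LA smE).
Qed.

(** An antimultiplicative map with these values must respect [v a = a_1 (v ◁ a_2)], that is
    [S (v ◁ a_2) (S a_1) = (S a) (S v)]. The action inside the coaction is removed by
    [coact_act_counit], and [LV_S] moves [S a] to the front. *)
Lemma SV_act v a :
  sw (bcomul a) (fun a1 a2 => bmul (SV (v ◁ a2)) (LA (SA a1) bone)) =
  LA (SA a) (SV v).
Proof.
transitivity (- sw (bcomul a) (fun a1 a2 => sw (xcoact M (v ◁ a2)) (fun w0 w1 =>
   LV w0 (LA (SA (bmul a1 w1)) bone)))).
  rewrite -sw_opp; apply: eq_sw => a1 a2; rewrite /SV.
  rewrite (blNl bmE) (bl_swl bmE); congr (- _); apply: eq_sw => w0 w1.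
  rewrite (LV_mul smE) (LA_mul smE) (mul1E smE) (LA_LA smE).
  by rewrite (antipM hA).
rewrite /SV (blNr bLA); congr (- _).
rewrite (coact_act_counit hA hM (f := fun v c => LV v (LA (SA c) bone)));
  last by lin.
rewrite [RHS]sw_lin; last by lin.
apply: eq_sw => v0 v1; rewrite -LV_S; apply: eq_sw => a1 a2.
by rewrite (LA_LA smE) -(antipM hA).
Qed.

Lemma g_mulr i j (x y : E) : g j y = y -> g i (bmul x y) =
  bmul (g (i (+) j) x) y.
Proof.
move=> gy; rewrite -{1}[x](g_D smE) (blDl bmE) (linD (gl _)).
have H l : g i (bmul (g l x) y) = if i == l (+) j then bmul (g l x) y else 0.
  rewrite -{1}gy -(g_mul smE) (g_g smE) gy; case: eqP => // ->.
  by rewrite -{1}gy (g_mul smE) gy.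
by rewrite !H; case: (i); case: (j); rewrite /= ?addr0 ?add0r.
Qed.

(** The antipode of a word: letters are taken in reverse order, and v contributes the sign of its
    passage across the rest of the word. *)
Fixpoint Sw (s : seq V) : E :=
  if s is v :: s' then sigma ^+ odd (size s') *: bmul (Sw s') (SV v) else bone.

Lemma Sw_multilin : multilin Sw.
Proof.
move=> s1 s2; elim: s1 => [|w s1 IH] /=.
  by apply: lin_scaler; exact: (lin_comp (bmE.2 _)).
under eq_fun do rewrite size_cat /=.
apply: lin_scaler; exact: (lin_comp (bmE.1 (SV w)) IH).
Qed.

(** S is prescribed on [d a s] as the antipode of the word followed by that of a. Its rules on
    [LA a z] and [LV v z] ([SLA], [SLV]) reduce both antipode identities to an induction over
    generators. *)
Lemma smash_antipode : exists2 S : E -> E, is_antipode S &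
  forall i x, S (g i x) = g i (S x).
Proof.
have [|a s1 s2|S lS Sd] := sm_lift smE (f := fun a s =>
  bmul (Sw s) (LA (SA a) bone)).
- by move=> s; lin.
- exact: (lin_comp (bmE.1 _) (Sw_multilin s1 s2)).
have S1 : S bone = bone.
  by rewrite {1}(sm_one smE) Sd /= (mul1E smE) (antip1 hA) (LA_1 smE).
have SLA a z : S (LA a z) = bmul (S z) (LA (SA a) bone).
  move: z; apply: (smash_extd smE); [lin|lin|] => b s.
  rewrite (sm_LAd smE) !Sd -(mulEA smE); congr bmul.
  by rewrite (LA_mul smE) (mul1E smE) (LA_LA smE) (antipM hA).
have SLV v z : S (LV v z) = bmul (S (gam z)) (SV v).
  move: z; apply: (smash_extd smE); [lin|lin|] => b s.
  have -> : gam (d b s) = sigma ^+ odd (size s) *: d b s.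
    rewrite /parity !(sm_gd smE).
    by case: odd; rewrite ?scaler0 ?addr0 ?add0r ?scale1r.
  rewrite (linZ _ _ lS) Sd (blZl bmE) (sm_LVd smE) sw_lin //.
  transitivity (sw (bcomul b) (fun b1 b2 => sigma ^+ odd (size s) *:
     bmul (Sw s) (bmul (SV (v ◁ b2)) (LA (SA b1) bone)))).
    apply: eq_sw => b1 b2.
    by rewrite Sd /= (blZl bmE) (mulEA smE).
  rewrite sw_scale -sw_lin; last by lin.
  rewrite SV_act -(mulEA smE); congr (_ *: bmul _ _).
  by rewrite (LA_mul smE) (mul1E smE).
have gA a i : g i (LA a bone) = if i then 0 else LA a bone.
  by rewrite (g_LA smE) (g_1 smE); case: i; rewrite ?(bl0r bLA).
have gSV v : g true (SV v) = SV v.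
  rewrite /SV (linN _ (gl _)) sw_lin //; congr (- _); apply: eq_sw => v0 v1.
  by rewrite (g_LV smE) gA.
have Sg i z : S (g i z) = g i (S z).
  move: z i; apply: (smash_ind smE) => [|x y IHx IHy| |a z IH|v z IH] i.
  - by rewrite (lin0 (gl i)) (lin0 lS) (lin0 (gl i)).
  - by rewrite (linD (gl i)) !(linD lS) (linD (gl i)) IHx IHy.
  - by rewrite (g_1 smE) S1 (g_1 smE); case: i; rewrite ?(lin0 lS).
  - rewrite (g_LA smE) !SLA (@g_mulr _ false) ?gA // addbF IH //.
  rewrite (g_LV smE) !SLV (@g_mulr _ true) // addbT; congr bmul.
  have -> : S (gam z) = gam (S z).
    by rewrite /parity (linD lS) (linZ _ _ lS) !IH.
  by rewrite (gam_g smE) (linZ _ _ lS) IH (g_gam smE).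
exists S => //.
have Sgam z : S (gam z) = gam (S z).
  by rewrite /parity (linD lS) (linZ _ _ lS) !Sg.
split=> // z.
  move: z; apply: (smash_ext smE); [lin|lin|..].
  - by rewrite (comul1 smE); swt; rewrite S1 (mul1E smE) (counitE1 smE) scale1r.
  - move=> a z IH; rewrite (comul_LA smE) sw_LA2; last by lin.
    rewrite sw_exch (counit_LA smE) -scalerA -IH -sw_scale.
    apply: eq_sw => z1 z2.
    transitivity (sw (bcomul a) (fun a1 a2 => bmul (S z1) (LA (bmul (SA a1) a2)
      z2))).
      apply: eq_sw => a1 a2.
      by rewrite SLA -(mulEA smE) (LA_mul smE) (mul1E smE) (LA_LA smE).
    rewrite (antipl hA (f := fun a => bmul (S z1) (LA a z2))) ?(LA_1 smE) //;
      lin.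
  move=> v z IH; rewrite (comul_LV smE) sw_LV2; last by lin.
  rewrite (counit_LV smE) scale0r sw_exch -sw_add; apply: sw_zero => z1 z2.
  (* After [S (gam z1)] is factored out, what remains is [(S v_0) v_1 + v] acting on [z2], which
     vanishes by coassociativity and counitality of the coaction. *)
  transitivity (bmul (S (gam z1)) (sw (xcoact M v) (fun v0 v1 =>
    bmul (SV v0) (LA v1 z2)) + LV v z2)).
    rewrite (blDr bmE); congr (_ + _); rewrite [RHS]sw_lin; last by lin.
    by apply: eq_sw => v0 v1; rewrite SLV (mulEA smE).
  rewrite -[RHS](bl0r bmE (S (gam z1))); congr bmul; apply/eqP.
  rewrite addr_eq0; apply/eqP.
  transitivity (- sw (xcoact M v) (fun v0 v1 => sw (xcoact M v0) (fun u w =>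
     LV u (LA (bmul (SA w) v1) z2)))).
    rewrite -sw_opp; apply: eq_sw => v0 v1; rewrite /SV (blNl bmE).
    congr (- _); rewrite (bl_swl bmE).
    apply: eq_sw => u w.
    by rewrite (LV_mul smE) (LA_mul smE) (mul1E smE) (LA_LA smE).
  congr (- _).
  rewrite (coact_coass hM (f := fun u w v1 => LV u (LA (bmul (SA w) v1) z2)));
    last by lin.
  rewrite -[RHS](coact_coun hM (f := fun v => LV v z2)); last by lin.
  apply: eq_sw => v0 v1.
  rewrite (antipl hA (f := fun c => LV v0 (LA c z2))) ?(LA_1 smE) //; lin.
move: z; apply: (smash_ext smE); [lin|lin|..].
- by rewrite (comul1 smE); swt; rewrite S1 (mul1E smE) (counitE1 smE) scale1r.
- move=> a z IH; rewrite (comul_LA smE) sw_LA2; last by lin.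
  rewrite (counit_LA smE).
  transitivity (sw (bcomul a) (fun a1 a2 => LA a1 (bmul (sw (bcomul z) (fun z1
    z2 => bmul z1 (S z2))) (LA (SA a2) bone)))).
    apply: eq_sw => a1 a2; rewrite (bl_swl bmE).
    rewrite sw_lin; last by lin.
    apply: eq_sw => z1 z2.
    by rewrite SLA (LA_mul smE) (mulEA smE).
  have K : sw (bcomul a) (fun a1 a2 => LA (bmul a1 (SA a2)) bone) =
           bcounit a *: (bone : E).
    by rewrite (antipr hA (f := fun a => LA a bone)) ?(LA_1 smE) //; lin.
  rewrite IH mulrC -scalerA -K -sw_scale; apply: eq_sw => a1 a2.
  by rewrite (blZl bmE) (blZr bLA) (mul1E smE) (LA_LA smE).
move=> v z IH; rewrite (comul_LV smE) sw_LV2; last by lin.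
rewrite (counit_LV smE) scale0r.
(* Here the inner sum [z_1 (S z_2)] is closed up first, so that the induction hypothesis leaves
   [bcounit z] times [v_0 (S v_1) + S v = 0]. *)
transitivity (sw (xcoact M v) (fun v0 v1 =>
   LV v0 (bmul (sw (bcomul z) (fun z1 z2 => bmul z1 (S z2))) (LA (SA v1) bone)))
  + bmul (gam (sw (bcomul z) (fun z1 z2 => bmul z1 (S z2)))) (SV v)).
  congr (_ + _).
    apply: eq_sw => a1 a2; rewrite (bl_swl bmE).
    rewrite [RHS]sw_lin; last by lin.
    apply: eq_sw => z1 z2.
    by rewrite SLA (LV_mul smE) (mulEA smE).
  rewrite (sw_lin (L := gam)) // (bl_swl bmE).
  apply: eq_sw => z1 z2.
  by rewrite (gam_mul smE) SLV Sgam (mulEA smE).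
rewrite IH (linZ _ _ gaml) (gam_1 smE) (blZl bmE) (mul1E smE) /SV scalerN
  -sw_scale.
apply/eqP; rewrite subr_eq0; apply/eqP; apply: eq_sw => v0 v1.
by rewrite (blZl bmE) (blZr bLV) (mul1E smE).
Qed.
End SmashAntipode.

(** * The Hopf pairing between H # TV' and A # TV *)

Section Projections.
Variables (k : fieldType) (A : bialgData k) (SA : A -> A).
Variables (V : lmodType k) (M : crossedData A V).
Variables (sigma : k) (E : bialgData k) (d : A -> seq V -> E).
Variables (LA : A -> E -> E) (LV : V -> E -> E) (g : bool -> E -> E).
Hypothesis smE : smash SA M sigma d LA LV g.
Local Notation "v ◁ a" := (xact M v a) (at level 35).
Let hA := sm_hopf smE.
Let hM := sm_crossed smE.
Let algA := hopf_alg hA.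
Let coalgA := hopf_coalg hA.
Let bM := crossed_act hM.
Let bLA := sm_LA smE.
Let bLV := sm_LV smE.
Let gl := sm_g smE.
Let lcE := sm_comul smE.
Let leE := sm_counit smE.
Local Notation gam := (parity sigma g).

Lemma pr_subproof : exists2 F : E -> A, lin F &
  forall a s, F (d a s) = (size s == 0)%N%:R *: a.
Proof.
apply: (sm_lift smE) => [s|a s1 s2]; first by lin.
move=> c x y; rewrite !size_cat /= !addnS.
by rewrite !scale0r scaler0 addr0.
Qed.
(** [sm_pr] is the Hopf projection of E onto A, and [sm_dg] below is the degree-one part with A
    contracted by its counit. Through these two maps the generators of the other side see E: h as
    [p h (pr z)] and phi as [e phi (dg z)]. *)
Definition sm_pr : E -> A := s2val (cid2 pr_subproof).
Lemma pr_lin : lin sm_pr. Proof. exact: (s2valP (cid2 pr_subproof)). Qed.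
Lemma pr_d a s : sm_pr (d a s) = (size s == 0)%N%:R *: a.
Proof. exact: (s2valP' (cid2 pr_subproof)). Qed.

Definition letter (s : seq V) : V := if s is [:: v] then v else 0.
Lemma letter_multilin : multilin letter.
Proof.
case=> [|u [|u' s1]] [|w s2] c x y //=; by rewrite scaler0 addr0.
Qed.
Lemma dg_subproof : exists2 F : E -> V, lin F &
  forall a s, F (d a s) = bcounit a *: letter s.
Proof.
apply: (sm_lift smE) => [s|a s1 s2]; first by lin.
by apply: lin_scaler; exact: letter_multilin.
Qed.
Definition sm_dg : E -> V := s2val (cid2 dg_subproof).
Lemma dg_lin : lin sm_dg. Proof. exact: (s2valP (cid2 dg_subproof)). Qed.
Lemma dg_d a s : sm_dg (d a s) = bcounit a *: letter s.
Proof. exact: (s2valP' (cid2 dg_subproof)). Qed.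
Let prl := pr_lin.
Let dgl := dg_lin.

Lemma pr_1 : sm_pr bone = bone.
Proof. by rewrite (sm_one smE) pr_d scale1r. Qed.
Lemma pr_LA a z : sm_pr (LA a z) = bmul a (sm_pr z).
Proof.
move: z; apply: (smash_extd smE); [lin|lin|] => b s.
rewrite (sm_LAd smE) !pr_d [RHS](linZ (f := bmul a)) //; lin.
Qed.
Lemma pr_LV v z : sm_pr (LV v z) = 0.
Proof.
move: z; apply: (smash_extd smE); [lin|lin|] => b s.
rewrite (sm_LVd smE) sw_lin //; apply: sw_zero => b1 b2.
by rewrite pr_d scale0r.
Qed.
Lemma pr_g i z : sm_pr (g i z) = if i then 0 else sm_pr z.
Proof.
move: z; apply: (smash_extd smE); [lin|apply: lin_if; lin|] => b s.
rewrite (sm_gd smE) !pr_d; case: s => [|v s] /=.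
  by case: i; rewrite /= ?(lin0 prl) ?pr_d.
by case: eqP; case: (i); rewrite ?(lin0 prl) ?pr_d ?scale0r.
Qed.
Lemma pr_gam z : sm_pr (gam z) = sm_pr z.
Proof. by rewrite /parity (linD prl) (linZ _ _ prl) !pr_g scaler0 addr0. Qed.
Lemma pr_counit z : bcounit (sm_pr z) = bcounit z.
Proof.
apply: (smash_extd smE (U := k^o) (f := fun z => bcounit (sm_pr z)) (h := fun z
  => bcounit z)); [lin|lin|] => b s.
have l : lin (@bcounit k A : A -> k^o) by lin.
by rewrite pr_d (linZ _ _ l) (sm_counitd smE) mulrC.
Qed.
Lemma comul_pr z :
  bcomul (sm_pr z) = sw (bcomul z) (fun x y => sm_pr x ⊗ sm_pr y).
Proof.
move: z; apply: (smash_ext smE); [lin|lin|..].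
- by rewrite pr_1 (comul1 smE); swt; rewrite pr_1; case: hA => _ [].
- move=> a z IH; rewrite pr_LA (comul_LA smE) sw_LA2; last by lin.
  rewrite -[LHS]sw_id (sw_comulM hA); last by lin.
  apply: eq_sw => a1 a2; rewrite IH sw_sw; last by lin.
  by apply: eq_sw => x y; swt; rewrite !pr_LA.
move=> v z IH; rewrite pr_LV (comul_LV smE) sw_LV2; last by lin.
rewrite sw_zero ?add0r; last first.
  by move=> v0 v1; apply: sw_zero => x y; rewrite pr_LV tens0l.
rewrite sw_zero; last by move=> x y; rewrite pr_LV tens0r.
have l : lin (@bcomul k A) by lin.
exact: (lin0 l).
Qed.
Lemma pr_comul (U : lmodType k) (f : A -> A -> U) z : bl f ->
  sw (bcomul (sm_pr z)) f = sw (bcomul z) (fun x y => f (sm_pr x) (sm_pr y)).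
Proof.
by move=> bf; rewrite comul_pr sw_sw //; apply: eq_sw => x y; swt.
Qed.

Lemma dg_1 : sm_dg bone = 0.
Proof. by rewrite (sm_one smE) dg_d scaler0. Qed.
Lemma dg_LA a z : sm_dg (LA a z) = bcounit a *: sm_dg z.
Proof.
move: z; apply: (smash_extd smE); [lin|lin|] => b s.
by rewrite (sm_LAd smE) !dg_d (counitM hA) scalerA.
Qed.
Lemma dg_LV v z : sm_dg (LV v z) = v ◁ (sm_pr z).
Proof.
move: z; apply: (smash_extd smE); [lin|lin|] => b s.
rewrite (sm_LVd smE) sw_lin // pr_d (blZr bM).
case: s => [|w s]; last first.
  by rewrite scale0r sw_zero // => b1 b2; rewrite dg_d scaler0.
rewrite scale1r -(counl coalgA (f := fun b => v ◁ b)); last by lin.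
by apply: eq_sw => b1 b2; rewrite dg_d.
Qed.
Lemma dg_g i z : sm_dg (g i z) = if i then sm_dg z else 0.
Proof.
move: z; apply: (smash_extd smE); [lin|apply: lin_if; lin|] => b s.
rewrite (sm_gd smE) !dg_d; case: s => [|v [|w s]] /=.
- by case: i; rewrite /= ?(lin0 dgl) ?dg_d ?scaler0.
- by case: i; rewrite /= ?(lin0 dgl) ?dg_d.
by case: eqP; case: (i); rewrite ?(lin0 dgl) ?dg_d /= ?scaler0.
Qed.
Lemma dg_gam z : sm_dg (gam z) = sigma *: sm_dg z.
Proof. by rewrite /parity (linD dgl) (linZ _ _ dgl) !dg_g add0r. Qed.
End Projections.

(** The last four fields are recursion rules: a generator multiplied on one side is paired with the
    first coproduct factor of the other. Both the left and the right rules are listed, which makes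
    the record stable under exchange of the sides. *)
Record smash_pairing (k : fieldType) (A H : bialgData k) (SA : A -> A)
    (SH : H -> H) (V V' : lmodType k) (M : crossedData A V)
    (M' : crossedData H V') (p : H -> A -> k) (e : V' -> V -> k) (sigma : k)
    (E E' : bialgData k) (d : A -> seq V -> E) (d' : H -> seq V' -> E')
    (LA : A -> E -> E) (LV : V -> E -> E) (LA' : H -> E' -> E')
    (LV' : V' -> E' -> E') (g : bool -> E -> E) (g' : bool -> E' -> E')
    (smE : smash SA M sigma d LA LV g) (smE' : smash SH M' sigma d' LA' LV' g')
    (P : E' -> E -> k) : Prop := SmashPairing {
  sp_p : bl (p : H -> A -> k^o);
  sp_e : bl (e : V' -> V -> k^o);
  sp_p1l : forall a, p bone a = bcounit a;
  sp_p1r : forall h, p h bone = bcounit h;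
  sp_bl : bl (P : E' -> E -> k^o);
  sp_1l : forall z, P bone z = bcounit z;
  sp_1r : forall x, P x bone = bcounit x;
  sp_LAl : forall h x z, P (LA' h x) z =
    sw (bcomul z) (fun z1 z2 => p h (sm_pr smE z1) * P x z2 : k^o);
  sp_LVl : forall phi x z, P (LV' phi x) z =
    sw (bcomul z) (fun z1 z2 => e phi (sm_dg smE z1) * P x z2 : k^o);
  sp_LAr : forall a x z, P x (LA a z) =
    sw (bcomul x) (fun x1 x2 => p (sm_pr smE' x1) a * P x2 z : k^o);
  sp_LVr : forall v x z, P x (LV v z) =
    sw (bcomul x) (fun x1 x2 => e (sm_dg smE' x1) v * P x2 z : k^o) }.

Section SmashPairing.
Variables (k : fieldType) (A H : bialgData k) (SA : A -> A) (SH : H -> H).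
Variables (V V' : lmodType k) (M : crossedData A V) (M' : crossedData H V').
Variables (p : H -> A -> k) (e : V' -> V -> k) (sigma : k).
Hypothesis hp : hopf_pairing SH SA p.
Hypothesis adj : mutually_adjoint p e M' M.
Variables (E E' : bialgData k) (d : A -> seq V -> E) (d' : H -> seq V' -> E').
Variables (LA : A -> E -> E) (LV : V -> E -> E) (LA' : H -> E' -> E')
    (LV' : V' -> E' -> E') (g : bool -> E -> E) (g' : bool -> E' -> E').
Hypothesis smE : smash SA M sigma d LA LV g.
Hypothesis smE' : smash SH M' sigma d' LA' LV' g'.
Local Notation pr := (sm_pr smE).
Local Notation pr' := (sm_pr smE').
Local Notation dg := (sm_dg smE).
Local Notation dg' := (sm_dg smE').
Let hA := sm_hopf smE.
Let hM := sm_crossed smE.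
Let algA := hopf_alg hA.
Let coalgA := hopf_coalg hA.
Let bM := crossed_act hM.
Let bLA := sm_LA smE.
Let lcE := sm_comul smE.
Let leE := sm_counit smE.
Let hH := sm_hopf smE'.
Let hM' := sm_crossed smE'.
Let coalgH := hopf_coalg hH.
Let bM' := crossed_act hM'.
Let bLA' := sm_LA smE'.
Let bLV' := sm_LV smE'.
Let lcE' := sm_comul smE'.
Let leE' := sm_counit smE'.
Let coalgE := smash_coalg smE.
Local Notation gam := (parity sigma g).
Local Notation gam' := (parity sigma g').
Let prl : lin pr := pr_lin smE.
Let prl' : lin pr' := pr_lin smE'.
Let dgl : lin dg := dg_lin smE.
Let dgl' : lin dg' := dg_lin smE'.
Let bp : bl (p : H -> A -> k^o).
Proof. by case: hp => b _ _ _ _; exact: (bilin_bl b). Qed.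
Let be : bl (e : V' -> V -> k^o).
Proof. by case: adj => b _ _; exact: (bilin_bl b). Qed.

Let pMl h h' a : p (bmul h h') a =
  sw (bcomul a) (fun a1 a2 => p h a1 * p h' a2 : k^o).
Proof. by case: hp. Qed.
Let pMr h a a' : p h (bmul a a') =
  sw (bcomul h) (fun h1 h2 => p h1 a * p h2 a' : k^o).
Proof. by case: hp. Qed.
Let p1l a : p bone a = bcounit a. Proof. by case: hp => _ _ _ []. Qed.
Let p1r h : p h bone = bcounit h. Proof. by case: hp => _ _ _ []. Qed.
Let adjl phi h v : e (xact M' phi h) v =
  sw (xcoact M v) (fun v0 v1 => e phi v0 * p h v1 : k^o).
Proof. by case: adj. Qed.
Let adjr phi v a : e phi (xact M v a) =
  sw (xcoact M' phi) (fun phi0 phi1 => e phi0 v * p phi1 a : k^o).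
Proof. by case: adj. Qed.

(** In E' one has [phi h = h_1 (phi ◁ h_2)], so the two products must agree as functionals of z. For
    z beginning with a letter v, adjointness trades the action of h for the coaction of V, and the
    crossed-module axiom of V does the rest. *)
Lemma pairing_exchange h phi z :
  sw (bcomul h) (fun h1 h2 => sw (bcomul z) (fun z1 z2 =>
    p h1 (pr z1) * e (xact M' phi h2) (dg z2) : k^o)) =
  sw (bcomul z) (fun z1 z2 => e phi (dg z1) * p h (pr z2) : k^o).
Proof.
move: z h; apply: (smash_ind smE) => [|x y IHx IHy| |a z IH|v z IH] h.
- rewrite (lin0 lcE) [RHS]sw_0; last by lin.
  by apply: sw_zero => h1 h2; rewrite sw_0 //; lin.
- rewrite (linD lcE) [RHS]sw_argD; last by lin.
  by rewrite -IHx -IHy -sw_add; apply: eq_sw => h1 h2; rewrite sw_argD //; lin.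
- rewrite (comul1 smE); swt; rewrite (dg_1 smE) (bl0r be) mul0r.
  by apply: sw_zero => h1 h2; swt; rewrite (dg_1 smE) (bl0r be) mulr0.
- rewrite (comul_LA smE) sw_LA2; last by lin.
  transitivity (sw (bcomul h) (fun h1 h2 => p h1 a *
     sw (bcomul h2) (fun h1 h2 => sw (bcomul z) (fun z1 z2 =>
    p h1 (pr z1) * e (xact M' phi h2) (dg z2) : k^o)) : k^o)).
    transitivity (sw (bcomul h) (fun h1 h2 => sw (bcomul z) (fun z1 z2 =>
       p h1 (bmul a (pr z1)) * e (xact M' phi h2) (dg z2) : k^o))).
      apply: eq_sw => h1 h2; rewrite sw_LA2; last by lin.
      rewrite sw_exch; apply: eq_sw => z1 z2.
      rewrite -[RHS](counr coalgA (f := fun a => p h1 (bmul a (pr z1)) * e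
        (xact M' phi h2) (dg z2) : k^o)); last by lin.
      apply: eq_sw => a1 a2; rewrite (pr_LA smE) (dg_LA smE) (blZr be).
      exact: mulrCA.
    under [RHS]eq_sw => h1 h2 do rewrite -sw_mull.
    rewrite -coass //; last by lin.
    apply: eq_sw => h1 h2; under [RHS]eq_sw => y1 y2 do rewrite -sw_mull.
    rewrite [RHS]sw_exch; apply: eq_sw => z1 z2; rewrite pMr -sw_mulr.
    by apply: eq_sw => y1 y2; rewrite mulrA.
  under eq_sw => h1 h2 do rewrite IH -sw_mull.
  rewrite sw_exch [RHS]sw_exch; apply: eq_sw => z1 z2.
  transitivity (e phi (dg z1) * p h (bmul a (pr z2))).
    by rewrite pMr -sw_mull; apply: eq_sw => h1 h2; rewrite mulrCA.
  rewrite -(counl coalgA (f := fun a => e phi (dg z1) * p h (bmul a (pr z2)) :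
    k^o)); last by lin.
  apply: eq_sw => a1 a2; rewrite (pr_LA smE) (dg_LA smE) (blZr be).
  exact: mulrA.
rewrite (comul_LV smE) sw_LV2; last by lin.
rewrite [X in _ + X]sw_zero ?addr0; last first.
  by move=> z1 z2; rewrite (pr_LV smE) (bl0r bp) mulr0.
transitivity (sw (bcomul (pr z)) (fun a1 a2 => sw (xcoact M (xact M v a2))
   (fun w0 w1 => e phi w0 * p h (bmul a1 w1) : k^o))).
  transitivity (sw (bcomul h) (fun h1 h2 => sw (bcomul (pr z)) (fun a1 a2 =>
    p h1 a1 * e (xact M' phi h2) (xact M v a2) : k^o))).
    apply: eq_sw => h1 h2; rewrite sw_LV2; last by lin.
    rewrite sw_zero ?add0r; last first.
      by move=> v0 v1; apply: sw_zero => z1 z2;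
        rewrite (pr_LV smE) (bl0r bp) mul0r.
    rewrite (pr_comul smE); last by lin.
    by apply: eq_sw => z1 z2; rewrite (pr_gam smE) (dg_LV smE).
  rewrite sw_exch; apply: eq_sw => a1 a2.
  under eq_sw => h1 h2 do rewrite adjl -sw_mull.
  rewrite sw_exch; apply: eq_sw => w0 w1; rewrite pMr -sw_mull.
  by apply: eq_sw => h1 h2; rewrite mulrCA.
rewrite (coact_act_counit hA hM (f := fun v a => e phi v * p h a : k^o));
  last by lin.
apply: eq_sw => v0 v1; rewrite (pr_comul smE); last by lin.
by apply: eq_sw => z1 z2; rewrite (dg_LV smE) (pr_LA smE).
Qed.

(** A Hopf pairing turns products into convolution, so left multiplication by h or by phi becomes
    the operator [opA h] or [opV phi] on functionals of E. [Pw s] is then the functional belonging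
    to the word s. *)
Let opA h (u : E -> k) (z : E) : k^o :=
  sw (bcomul z) (fun z1 z2 => p h (pr z1) * u z2 : k^o).
Let opV phi (u : E -> k) (z : E) : k^o :=
  sw (bcomul z) (fun z1 z2 => e phi (dg z1) * u z2 : k^o).
Let Pw (s : seq V') : E -> k := foldr opV (@bcounit k E) s.
Let Pw_lin s : lin (Pw s : E -> k^o).
Proof. by elim: s => [|phi s IH]; [exact: leE|rewrite /= /opV; lin]. Qed.
Let Pw_multilin z : multilin (fun s => Pw s z : k^o).
Proof.
move=> s1 s2; elim: s1 z => [|w s1 IH] z /=; rewrite /opV.
  by have l := Pw_lin s2; apply: lin_swr => z1 z2; lin.
apply: lin_swr => z1 z2; apply: lin_mull; exact: IH.
Qed.

(** P is built by recursion on its left argument, which yields the left rules, [pairing_exchange]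
    being what [sp_LVl] costs. The right rules follow by induction on the left argument, generator
    against generator. *)
Lemma smash_pairing_exists : exists P, smash_pairing p e smE smE' P.
Proof.
have Pex z : exists2 F : E' -> k^o, lin F &
    forall h s, F (d' h s) = opA h (Pw s) z.
  apply: (sm_lift smE') => [s|h s1 s2]; first by rewrite /opA; lin.
  rewrite /opA; apply: lin_swr => z1 z2; apply: lin_mull; exact: Pw_multilin.
pose P x z : k^o := s2val (cid2 (Pex z)) x.
have Pl z : lin (P^~ z) by exact: (s2valP (cid2 (Pex z))).
have Pd h s z : P (d' h s) z = opA h (Pw s) z by exact: (s2valP' (cid2 (Pex
  z))).
(* [sm_lift] produced P for each z separately, so linearity in z is read off from the explicit
   values on [d' h s]. *)
have Pr x : lin (P x).
  have [r ->] := sm_span smE' x => c y z.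
  rewrite !(lin_sum _ _ _ (Pl _)) scaler_sumr -big_split;
    apply: eq_bigr => -[h s] _.
  rewrite /= !Pd; have l := Pw_lin s.
  have L : lin (opA h (Pw s)) by rewrite /opA; lin.
  exact: L.
have bP : bl P by [].
have P1l z : P bone z = bcounit z.
  rewrite (sm_one smE') Pd /opA /= -(pr_counit smE) -p1l.
  rewrite -[RHS](counr coalgE (f := fun z => p bone (pr z) : k^o)); last by lin.
  by apply: eq_sw => z1 z2; exact: mulrC.
have PLA h x z : P (LA' h x) z =
    sw (bcomul z) (fun z1 z2 => p h (pr z1) * P x z2 : k^o).
  move: x; apply: (smash_extd smE'); [lin|lin|] => h2 s.
  rewrite (sm_LAd smE') !Pd /opA; have l := Pw_lin s.
  under [RHS]eq_sw => z1 z2 do rewrite Pd /opA -sw_mull.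
  rewrite -(smash_coass smE); last by lin.
  apply: eq_sw => z1 z2; rewrite pMl (pr_comul smE); last by lin.
  by rewrite -sw_mulr; apply: eq_sw => y1 y2; rewrite mulrA.
have PLV phi x z : P (LV' phi x) z =
    sw (bcomul z) (fun z1 z2 => e phi (dg z1) * P x z2 : k^o).
  move: x; apply: (smash_extd smE'); [lin|lin|] => h s.
  rewrite (sm_LVd smE') (bl_swl bP).
  under eq_sw => h1 h2 do rewrite Pd /opA /= /opV.
  under [RHS]eq_sw => z1 z2 do rewrite Pd /opA -sw_mull.
  rewrite -(smash_coass smE); last by lin.
  under eq_sw => h1 h2.
    under eq_sw => z1 z2 do rewrite -sw_mull.
    rewrite -(smash_coass smE); last by lin.
    over.
  rewrite sw_exch; apply: eq_sw => z1 z2.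
  transitivity (sw (bcomul z1) (fun z1 z2 => e phi (dg z1) * p h (pr z2) : k^o)
    * Pw s z2).
    rewrite -pairing_exchange -sw_mulr; apply: eq_sw => h1 h2.
    by rewrite -sw_mulr; apply: eq_sw => y1 y2; rewrite mulrA.
  by rewrite -sw_mulr; apply: eq_sw => y1 y2; rewrite mulrA.
have PLAr a x z : P x (LA a z) =
    sw (bcomul x) (fun x1 x2 => p (pr' x1) a * P x2 z : k^o).
  move: z a; move: x; apply: (smash_ind smE') => [|x y IHx IHy| |h x IH|phi x
    IH] z a.
  - by rewrite (bl0l bP) (lin0 lcE') sw_0 //; lin.
  - by rewrite (blDl bP) (linD lcE') sw_argD ?IHx ?IHy //; lin.
  - rewrite P1l (comul1 smE'); swt.
    by rewrite (pr_1 smE') p1l P1l (counit_LA smE).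
  - rewrite PLA (comul_LA smE) sw_LA2; last by lin.
    rewrite (comul_LA smE') sw_LA2; last by lin.
    transitivity (sw (bcomul h) (fun h1 h2 => sw (bcomul a) (fun a1 a2 =>
      sw (bcomul z) (fun z1 z2 => sw (bcomul x) (fun x1 x2 =>
        (p h1 a1 * p h2 (pr z1)) * (p (pr' x1) a2 * P x2 z2) : k^o))))).
      rewrite [RHS]sw_exch; apply: eq_sw => a1 a2.
      rewrite [RHS]sw_exch; apply: eq_sw => z1 z2.
      rewrite (pr_LA smE) pMr IH -sw_mulr; apply: eq_sw => h1 h2.
      by rewrite -sw_mull.
    apply: eq_sw => h1 h2.
    under eq_sw => a1 a2 do rewrite sw_exch.
    rewrite sw_exch; apply: eq_sw => x1 x2.
    rewrite PLA (pr_LA smE') pMl -sw_mulr; apply: eq_sw => a1 a2.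
    rewrite -sw_mull; apply: eq_sw => z1 z2.
    by rewrite mulrACA.
  rewrite PLV (comul_LA smE) sw_LA2; last by lin.
  rewrite (comul_LV smE') sw_LV2; last by lin.
  rewrite [X in X + _]sw_zero ?add0r; last first.
    by move=> v0 v1; apply: sw_zero => x1 x2; rewrite (pr_LV smE') (bl0l bp)
      mul0r.
  transitivity (sw (bcomul z) (fun z1 z2 => e phi (dg z1) * P x (LA a z2) :
    k^o)); last first.
    under eq_sw => z1 z2 do rewrite IH -sw_mull.
    rewrite sw_exch; apply: eq_sw => x1 x2.
    rewrite (pr_gam smE') PLV -sw_mull; apply: eq_sw => z1 z2; exact: mulrCA.
  rewrite sw_exch; apply: eq_sw => z1 z2.
  rewrite -[RHS](counl coalgA (f := fun a => e phi (dg z1) * P x (LA a z2) :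
    k^o)); last by lin.
  by apply: eq_sw => a1 a2; rewrite (dg_LA smE) (blZr be); exact/esym/mulrA.
have PLVr v x z : P x (LV v z) =
    sw (bcomul x) (fun x1 x2 => e (dg' x1) v * P x2 z : k^o).
  move: z; move: x; apply: (smash_ind smE') => [|x y IHx IHy| |h x IH|phi x IH]
    z.
  - by rewrite (bl0l bP) (lin0 lcE') sw_0 //; lin.
  - by rewrite (blDl bP) (linD lcE') sw_argD ?IHx ?IHy //; lin.
  - rewrite P1l (comul1 smE'); swt.
    by rewrite (dg_1 smE') (bl0l be) mul0r (counit_LV smE).
  - rewrite PLA (comul_LV smE) sw_LV2; last by lin.
    rewrite [X in X + _]sw_zero ?add0r; last first.
      by move=> v0 v1; apply: sw_zero => x1 x2;
        rewrite (pr_LV smE) (bl0r bp) mul0r.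
    rewrite (comul_LA smE') sw_LA2; last by lin.
    transitivity (sw (bcomul x) (fun x1 x2 => e (dg' x1) v * P (LA' h x2) z :
      k^o)).
      under [RHS]eq_sw => x1 x2 do rewrite PLA -sw_mull.
      rewrite [RHS]sw_exch; apply: eq_sw => z1 z2.
      rewrite (pr_gam smE) IH -sw_mull; apply: eq_sw => x1 x2; exact: mulrCA.
    rewrite [RHS]sw_exch; apply: eq_sw => x1 x2.
    rewrite -[LHS](counl coalgH (f := fun h => e (dg' x1) v * P (LA' h x2) z :
      k^o)); last by lin.
    by apply: eq_sw => h1 h2; rewrite (dg_LA smE') (blZl be); exact: mulrA.
  rewrite PLV (comul_LV smE) sw_LV2; last by lin.
  rewrite (comul_LV smE') sw_LV2; last by lin.
  congr (_ + _); last first.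
    under eq_sw => z1 z2 do rewrite (dg_gam smE) (blZr be) IH -sw_mull.
    rewrite sw_exch; apply: eq_sw => x1 x2.
    rewrite (dg_gam smE') (blZl be) PLV -sw_mull; apply: eq_sw => z1 z2.
    rewrite -[LHS]mulrA -[RHS]mulrA; congr (_ * _); exact: mulrCA.
  (* Letter against letter, in the summand with both coactions: one adjointness relation turns the
     left side, the other the right side, into this symmetric expression. *)
  transitivity (sw (xcoact M v) (fun v0 v1 => sw (xcoact M' phi) (fun f0 f1 =>
    sw (bcomul z) (fun z1 z2 => sw (bcomul x) (fun x1 x2 =>
      (e f0 v0 * p f1 (pr z1)) * (p (pr' x1) v1 * P x2 z2) : k^o))))).
    apply: eq_sw => v0 v1; rewrite [RHS]sw_exch; apply: eq_sw => z1 z2.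
    rewrite (dg_LV smE) adjr PLAr -sw_mulr; apply: eq_sw => f0 f1.
    by rewrite -sw_mull.
  rewrite sw_exch; apply: eq_sw => f0 f1.
  under eq_sw => v0 v1 do rewrite sw_exch.
  rewrite sw_exch; apply: eq_sw => x1 x2.
  rewrite (dg_LV smE') adjl PLA -sw_mulr; apply: eq_sw => v0 v1.
  by rewrite -sw_mull; apply: eq_sw => z1 z2; rewrite mulrACA.
exists P; split=> // x.
move: x; apply: (smash_ext smE' (U := k^o) (f := fun x =>
  P x bone) (h := fun x => bcounit x)); [lin|lin|..].
- by rewrite P1l (counitE1 smE) (counitE1 smE').
- move=> h x IH; rewrite PLA (comul1 smE); swt.
  by rewrite (pr_1 smE) p1r IH (counit_LA smE').
move=> phi x IH; rewrite PLV (comul1 smE); swt.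
by rewrite (dg_1 smE) (bl0r be) mul0r (counit_LV smE').
Qed.
End SmashPairing.

(** The pairing has no signs and reverses no order, so exchanging the sides only permutes the
    fields. Radicals on the left thus come from the results on the right. *)
Lemma smash_pairing_sym (k : fieldType) (A H : bialgData k) (SA : A -> A)
    (SH : H -> H) (V V' : lmodType k) (M : crossedData A V)
    (M' : crossedData H V') (p : H -> A -> k) (e : V' -> V -> k) (sigma : k)
    (E E' : bialgData k) (d : A -> seq V -> E) (d' : H -> seq V' -> E')
    (LA : A -> E -> E) (LV : V -> E -> E) (LA' : H -> E' -> E')
    (LV' : V' -> E' -> E') (g : bool -> E -> E) (g' : bool -> E' -> E')
    (smE : smash SA M sigma d LA LV g) (smE' : smash SH M' sigma d' LA' LV' g')
    (P : E' -> E -> k) :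
  smash_pairing p e smE smE' P ->
  smash_pairing (fun a h => p h a) (fun v phi => e phi v) smE' smE
    (fun z x => P x z).
Proof. by case=> -[? ?] [? ?] ? ? [? ?] ? ? ? ? ? ?; split. Qed.

(** * Products, gradings and antipodes under the pairing *)

Section PairingHopf.
Variables (k : fieldType) (A H : bialgData k) (SA : A -> A) (SH : H -> H).
Variables (V V' : lmodType k) (M : crossedData A V) (M' : crossedData H V').
Variables (p : H -> A -> k) (e : V' -> V -> k) (sigma : k).
Variables (E E' : bialgData k) (d : A -> seq V -> E) (d' : H -> seq V' -> E').
Variables (LA : A -> E -> E) (LV : V -> E -> E) (LA' : H -> E' -> E')
    (LV' : V' -> E' -> E') (g : bool -> E -> E) (g' : bool -> E' -> E').
Hypothesis smE : smash SA M sigma d LA LV g.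
Hypothesis smE' : smash SH M' sigma d' LA' LV' g'.
Local Notation pr := (sm_pr smE).
Local Notation pr' := (sm_pr smE').
Local Notation dg := (sm_dg smE).
Local Notation dg' := (sm_dg smE').
Let bLV := sm_LV smE.
Let leE := sm_counit smE.
Let gl' := sm_g smE'.
Let coalgE := smash_coalg smE.
Local Notation gam := (parity sigma g).
Local Notation gam' := (parity sigma g').
Let prl : lin pr := pr_lin smE.
Let dgl : lin dg := dg_lin smE.

Variable P : E' -> E -> k.
Hypothesis spP : smash_pairing p e smE smE' P.
Let bP := sp_bl spP.
Let bp := sp_p spP.
Let be := sp_e spP.

Lemma sp_mul (x y : E') (z : E) : P (bmul x y) z =
  sw (bcomul z) (fun z1 z2 => P x z1 * P y z2 : k^o).
Proof.
have bmE' := sm_mul smE'.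
move: z; move: x; apply: (smash_ind smE') => [|x x' IHx IHy| |h x IH|phi x IH]
  z.
- rewrite (bl0l bmE') (bl0l bP) sw_zero // => z1 z2.
  by rewrite (bl0l bP) mul0r.
- rewrite (blDl bmE') (blDl bP) IHx IHy -sw_add.
  apply: eq_swk => z1 z2.
  by rewrite (blDl bP) mulrDl.
- rewrite (mul1E smE'); under eq_sw => z1 z2 do rewrite (sp_1l spP).
  by rewrite (counl coalgE (f := fun z => P y z : k^o)) //; lin.
- rewrite (LA_mul smE') (sp_LAl spP).
  under eq_sw => z1 z2 do rewrite IH -sw_mull.
  rewrite -(smash_coass smE); last by lin.
  apply: eq_swk => z1 z2; rewrite (sp_LAl spP) -sw_mulr.
  by apply: eq_swk => y1 y2; rewrite mulrA.
rewrite (LV_mul smE') (sp_LVl spP).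
under eq_sw => z1 z2 do rewrite IH -sw_mull.
rewrite -(smash_coass smE); last by lin.
apply: eq_swk => z1 z2; rewrite (sp_LVl spP) -sw_mulr.
by apply: eq_swk => y1 y2; rewrite mulrA.
Qed.

(** [pr] sees only the even part and [dg] only the odd part of the first coproduct factor, so in
    each recursion rule the grading passes to the second factor, shifted exactly when a letter is
    removed. *)
Lemma sp_g i x z : P (g' i x) z = P x (g i z).
Proof.
move: z i; move: x; apply: (smash_ind smE') => [|x x' IHx IHy| |h x IH|phi x
  IH] z i.
- by rewrite (lin0 (gl' i)) !(bl0l bP).
- by rewrite (linD (gl' i)) !(blDl bP) IHx IHy.
- rewrite (g_1 smE') (sp_1l spP); case: i.
    by rewrite (bl0l bP) (counit_g smE).
  rewrite (sp_1l spP) -{1}[z](g_D smE) (linD leE) (counit_g smE) addr0 //.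
- rewrite (g_LA smE') !(sp_LAl spP) (comul_g smE) sw_arg_sum; last by lin.
  rewrite big_bool /= [X in _ = X + _]sw_sw; last by lin.
  rewrite [X in _ = X + _]sw_zero ?add0r; last first.
    by move=> z1 z2; swt; rewrite (pr_g smE) (bl0r bp) mul0r.
  rewrite sw_sw; last by lin.
  by apply: eq_swk => z1 z2; swt; rewrite (pr_g smE) IH addbF.
rewrite (g_LV smE') !(sp_LVl spP) (comul_g smE) sw_arg_sum; last by lin.
rewrite big_bool /= [X in _ = _ + X]sw_sw; last by lin.
rewrite [X in _ = _ + X]sw_zero ?addr0; last first.
  by move=> z1 z2; swt; rewrite (dg_g smE) (bl0r be) mul0r.
rewrite sw_sw; last by lin.
by apply: eq_swk => z1 z2; swt; rewrite (dg_g smE) IH addbT.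
Qed.

(** Under [pr] only the part of the coproduct with first factor in degree 0 survives. For a pure
    word this is [1 ⊗ s], because each summand [v_0 ⊗ v_1] puts a letter into the first factor. *)
Lemma sp_top (U : lmodType k) (f : A -> E -> U) s : bl f ->
  sw (bcomul (d bone s)) (fun z1 z2 => f (pr z1) z2) = f bone (d bone s).
Proof.
move=> bf; rewrite (smash_d1 smE); elim: s f bf => [|v s IH] f bf /=.
  by rewrite (comul1 smE); swt; rewrite (pr_1 smE).
rewrite (comul_LV smE) sw_LV2; last by lin.
rewrite sw_zero ?add0r; last first.
  by move=> v0 v1; apply: sw_zero => x y; rewrite (pr_LV smE) (bl0l bf).
under eq_sw => x y do rewrite (pr_gam smE).
by rewrite (IH (fun a z => f a (LV v z))) //; lin.
Qed.
End PairingHopf.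

Section PairingHopf2.
Variables (k : fieldType) (A H : bialgData k) (SA : A -> A) (SH : H -> H).
Variables (V V' : lmodType k) (M : crossedData A V) (M' : crossedData H V').
Variables (p : H -> A -> k) (e : V' -> V -> k) (sigma : k).
Variables (E E' : bialgData k) (d : A -> seq V -> E) (d' : H -> seq V' -> E').
Variables (LA : A -> E -> E) (LV : V -> E -> E) (LA' : H -> E' -> E')
    (LV' : V' -> E' -> E') (g : bool -> E -> E) (g' : bool -> E' -> E').
Hypothesis smE : smash SA M sigma d LA LV g.
Hypothesis smE' : smash SH M' sigma d' LA' LV' g'.
Local Notation pr := (sm_pr smE).
Local Notation pr' := (sm_pr smE').
Local Notation dg := (sm_dg smE).
Local Notation dg' := (sm_dg smE').
Let hA := sm_hopf smE.
Let algA := hopf_alg hA.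
Let coalgA := hopf_coalg hA.
Let coalgE := smash_coalg smE.
Let coalgE' := smash_coalg smE'.
Local Notation gam := (parity sigma g).
Local Notation gam' := (parity sigma g').
Let prl : lin pr := pr_lin smE.

Variable P : E' -> E -> k.
Hypothesis spP : smash_pairing p e smE smE' P.
Let spP' := smash_pairing_sym spP.
Let bP := sp_bl spP.
Let bp := sp_p spP.

Lemma sp_mulr (x : E') (z w : E) : P x (bmul z w) =
  sw (bcomul x) (fun x1 x2 => P x1 z * P x2 w : k^o).
Proof. exact: (sp_mul spP'). Qed.

(* [(x, z) |-> P (S' x) z] and [(x, z) |-> P x (S z)] are a left and a right
   convolution inverse of [P]. *)
Lemma sp_antipode S S' : is_antipode S -> is_antipode S' ->
  forall x z, P (S' x) z = P x (S z).
Proof.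
move=> [lS SL SR] [lS' SL' SR'] x z.
have lS1 : lin S by []. have lS1' : lin S' by [].
have algE := smash_alg smE. have algE' := smash_alg smE'.
pose T := sw (bcomul x) (fun x1 x' => sw (bcomul z) (fun z1 z' =>
  sw (bcomul x') (fun x2 x3 => sw (bcomul z') (fun z2 z3 =>
    (P (S' x1) z1 * P x2 z2) * P x3 (S z3) : k^o)))).
transitivity T.
  transitivity (sw (bcomul x) (fun x1 x' => sw (bcomul z) (fun z1 z' =>
    bcounit x' *: (bcounit z' *: (P (S' x1) z1 : k^o))))).
    rewrite -[LHS](counr coalgE' (f := fun x => P (S' x) z : k^o)); last by lin.
    apply: eq_swk => x1 x'; rewrite sw_scale.
    by rewrite (counr coalgE (f := fun z => P (S' x1) z : k^o)) //; lin.
  apply: eq_swk => x1 x'; apply: eq_swk => z1 z'.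
  transitivity (P (S' x1) z1 * P x' (sw (bcomul z') (fun z2 z3 =>
    bmul z2 (S z3)))).
    rewrite SR (blZr bP) (sp_1r spP).
    change (bcounit x' * (bcounit z' * P (S' x1) z1) =
      P (S' x1) z1 * (bcounit z' * bcounit x')).
    by rewrite mulrCA [RHS]mulrC mulrA.
  rewrite (bl_swr bP) -sw_mull.
  under eq_sw => z2 z3 do rewrite sp_mulr -sw_mull.
  rewrite sw_exch; apply: eq_swk => x2 x3; apply: eq_swk => z2 z3.
  exact: mulrA.
rewrite /T; under eq_sw => x1 x' do rewrite sw_exch.
rewrite -(smash_coass smE'); last by lin.
transitivity (sw (bcomul x) (fun x' x3 => sw (bcomul z) (fun z' z3 =>
  P (sw (bcomul x') (fun x1 x2 => bmul (S' x1) x2)) z' * P x3 (S z3) : k^o))).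
  apply: eq_swk => x' x3.
  under eq_sw => x1 x2.
    under eq_sw => z1 z' do idtac.
    rewrite -(smash_coass smE); last by lin.
    over.
  rewrite sw_exch; apply: eq_swk => z' z3.
  rewrite (bl_swl bP) -sw_mulr; apply: eq_swk => x1 x2.
  by rewrite (sp_mul spP) -sw_mulr.
transitivity (sw (bcomul x) (fun x' x3 => bcounit x' *: (P x3 (S z) : k^o))).
  apply: eq_swk => x' x3.
  rewrite -(counl coalgE (f := fun z => P x3 (S z) : k^o)); last by lin.
  rewrite -sw_scale; apply: eq_swk => z' z3.
  rewrite SL' (blZl bP) (sp_1l spP).
  by change (bcounit x' * bcounit z' * P x3 (S z3) =
    bcounit x' * (bcounit z' * P x3 (S z3))); rewrite mulrA.
by rewrite (counl coalgE' (f := fun x => P x (S z) : k^o)) //; lin.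
Qed.

Lemma sp_LA_top s a z : P (d' bone s) (LA a z) = bcounit a * P (d' bone s) z.
Proof.
rewrite (sp_LAr spP) (sp_top smE' (f := fun h x => p h a * P x z : k^o));
  last by lin.
by rewrite (sp_p1l spP).
Qed.

(** This splits P into p and a form on words, so that its radical can be computed on the tensor
    algebras alone. *)
Lemma sp_d h s a t : P (d' h s) (d a t) = p h a * P (d' bone s) (d bone t).
Proof.
rewrite (smash_d smE' h s) -(smash_d1 smE') (sp_LAl spP).
rewrite (smash_d smE a t) -(smash_d1 smE) (comul_LA smE) sw_LA2; last by lin.
under eq_sw => a1 a2.
  under eq_sw => z1 z2 do rewrite (pr_LA smE) sp_LA_top mulrCA.
  rewrite sw_mull (sp_top smE (f := fun b z => p h (bmul a1 b) * P (d' bone s)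
    z : k^o)); last by lin.
  rewrite (bmul_1 hA).
  over.
by rewrite (counr coalgA (f := fun a => p h a * P (d' bone s) (d bone t) :
  k^o)) //; lin.
Qed.
End PairingHopf2.

(** * The tensor algebra in the category of crossed modules *)

Section Separation.
Variable k : fieldType.
Implicit Types V W : lmodType k.

Definition separating V (F : (V -> k) -> Prop) : Prop :=
  (forall f, F f -> lin (f : V -> k^o)) /\
  forall v, (forall f, F f -> f v = 0) -> v = 0.

(** Induction on the number of terms of [t]. A linear relation among the right factors eliminates
    one term; if there is no such relation, each [f] kills every left factor, and these vanish by
    separation. *)
Lemma tensor_sep_l V W (F : (V -> k) -> Prop) (t : tensor V W) :
  separating F -> (forall f, F f -> sw t (fun v w => f v *: w) = 0) -> t = 0.
Proof.
case=> Fl Fsep.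
suff K n (v : 'I_n -> V) (w : 'I_n -> W) :
    (forall f, F f -> sw (\sum_i v i ⊗ w i) (fun v w => f v *: w) = 0) ->
    \sum_i v i ⊗ w i = 0.
  have [s ->] := tensor_sum t; rewrite (big_nth 0) big_mkord => H.
  exact: (K _ (fun i => (nth 0 s i).1) (fun i => (nth 0 s i).2)).
elim: n v w => [|n IH] v w H; first by rewrite big_ord0.
have HF f : F f -> \sum_i f (v i) *: w i = 0.
  move=> Ff; rewrite -[RHS](H f Ff) sw_arg_sum; last by have := Fl f Ff => ?;
    lin.
  by apply: eq_bigr => i _; have l := Fl f Ff; swt.
(* The scalars [f (v i)] are themselves the coefficients of a relation among the [w i], by [HF];
   hence they are all zero when no nontrivial relation exists. *)
have [[c [j cj cw]]|nc] := pselect (exists c : 'I_n.+1 -> k, exists2 j,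
  c j != 0 & \sum_i c i *: w i = 0).
  have wj : w j = - \sum_(i < n) (c j)^-1 *: (c (lift j i) *: w (lift j i)).
    move: cw; rewrite (bigD1_ord j) //= => /(congr1 (fun x => (c j)^-1 *: x)).
    rewrite scalerDr scaler0 scalerA mulVf // scale1r scaler_sumr => /eqP.
    by rewrite addr_eq0 => /eqP.
  have E : \sum_i v i ⊗ w i = \sum_(i < n)
      (v (lift j i) - ((c j)^-1 * c (lift j i)) *: v j) ⊗ w (lift j i).
    rewrite (bigD1_ord j) //= wj -sumrN tens_sumr -big_split /=.
    apply: eq_bigr => i _; rewrite addrC tensDl; congr (_ + _).
    by rewrite scalerA -!scaleNr tensZr tensZl.
  rewrite E; apply: (IH (fun i => v (lift j i) - ((c j)^-1 * c (lift j i)) *: v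
    j) (fun i => w (lift j i))).
  by move=> f Ff; have := H f Ff; rewrite E.
rewrite big1 // => i _; suff -> : v i = 0 by rewrite tens0l.
apply: Fsep => f Ff; apply/eqP/negPn/negP => fi.
by apply: nc; exists (fun i => f (v i)); exists i => //; exact: HF.
Qed.

Lemma tensor_sep V W (F : (V -> k) -> Prop) (G : (W -> k) -> Prop) t :
  separating F -> separating G ->
  (forall f h, F f -> G h -> sw t (fun v w => f v * h w : k^o) = 0) -> t = 0.
Proof.
move=> sF [Gl Gs] H; apply: (tensor_sep_l sF) => f Ff; apply: Gs => h Gh.
rewrite -[RHS](H f h Ff Gh) (sw_lin (X := k^o) (L := h)); last exact: Gl.
by apply: eq_swk => v w; exact: (linZ _ _ (Gl h Gh)).
Qed.
End Separation.

Section TensorAlgebraFacts.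
Variables (k : fieldType) (V : lmodType k).
Implicit Types U : lmodType k.

Lemma multilinI U (f : seq V -> U) :
  (forall s1 s2, lin (fun v => f (s1 ++ v :: s2))) -> multilin f.
Proof. by []. Qed.

Lemma lin_tlift U (X : lmodType k) (f : seq V -> U) (e : X -> talg V) :
  multilin f -> lin e -> lin (fun x => tlift f (e x)).
Proof. by move=> mf; apply: lin_comp; exact: (ulift_linear mf). Qed.
Lemma lin_tliftr U (X : lmodType k) (F : X -> seq V -> U) (t : talg V) :
  (forall s, lin (F^~ s)) -> lin (fun x => tlift (F x) t).
Proof.
move=> lF; rewrite /tlift /ulift /feval; apply: lin_big => q.
by apply: lin_scaler.
Qed.
Lemma word_sum (x : talg V) : exists r : seq (k * seq V), x =
  \sum_(q <- r) q.1 *: word q.2.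
Proof. exists (repr x); exact: umod_genE. Qed.
Lemma talg_ext U (f h : talg V -> U) : lin f -> lin h ->
  (forall s, f (word s) = h (word s)) -> f =1 h.
Proof.
move=> lf lh fh x; have [r ->] := word_sum x.
by rewrite !lin_sum //; apply: eq_bigr => q _; rewrite !linZ // fh.
Qed.
Lemma lin_word1 (X : lmodType k) (e : X -> V) s1 s2 :
  lin e -> lin (fun x => word (s1 ++ e x :: s2)).
Proof. exact: (lin_comp (multilin_word s1 s2)). Qed.
Lemma lin_letter (X : lmodType k) (e : X -> V) :
  lin e -> lin (fun x => word [:: e x]).
Proof. exact: (lin_word1 [::] [::]). Qed.
Lemma multilin_cat U (f : seq V -> U) s : multilin f -> multilin (fun t =>
  f (s ++ t)).
Proof. by move=> mf s1 s2 c x y; rewrite !catA; exact: mf. Qed.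
Lemma multilin_catr U (f : seq V -> U) t : multilin f -> multilin (fun s =>
  f (s ++ t)).
Proof. by move=> mf s1 s2 c x y; rewrite -!catA !cat_cons; exact: mf. Qed.
Lemma multilin_tlift_r U (F : seq V -> seq V -> U) t :
  (forall s, multilin (F^~ s)) -> multilin (fun s => tlift (F s) t).
Proof. by move=> mF s1 s2; apply: lin_tliftr => s; exact: mF. Qed.

Lemma tmul_bl : bl (@tmul k V).
Proof.
have m1 s : multilin (fun t => word (s ++ t : seq V)) by
  exact/multilin_cat/multilin_word.
have m2 t : multilin (fun s => word (s ++ t : seq V)) by
  exact/multilin_catr/multilin_word.
split=> [y|x]; rewrite /tmul; first by apply: lin_tlift => //;
  exact: multilin_tlift_r.
apply: lin_tliftr => s; exact: lin_tlift.
Qed.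
Lemma tmul_word (s t : seq V) : tmul (word s) (word t) = word (s ++ t).
Proof.
have m1 s' : multilin (fun t => word (s' ++ t : seq V)) by
  exact/multilin_cat/multilin_word.
have m2 t' : multilin (fun s => word (s ++ t' : seq V)) by
  exact/multilin_catr/multilin_word.
by rewrite /tmul tlift_word ?tlift_word //; exact: multilin_tlift_r.
Qed.
Lemma lin_tmull (X : lmodType k) (e : X -> talg V) c : lin e ->
  lin (fun x => tmul (e x) c).
Proof. exact: (lin_comp (tmul_bl.1 c)). Qed.
Lemma lin_tmulr (X : lmodType k) (e : X -> talg V) c : lin e ->
  lin (fun x => tmul c (e x)).
Proof. exact: (lin_comp (tmul_bl.2 c)). Qed.
End TensorAlgebraFacts.
#[export] Hint Resolve lin_letter lin_tmull lin_tmulr : lin.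

Section TensorAlgebraMul.
Variables (k : fieldType) (V : lmodType k).
Lemma tmulA (x y z : talg V) : tmul x (tmul y z) = tmul (tmul x y) z.
Proof.
move: x; apply: talg_ext; [lin|lin|] => s.
move: y; apply: talg_ext; [lin|lin|] => t.
move: z; apply: talg_ext; [lin|lin|] => u.
by rewrite !tmul_word catA.
Qed.
Lemma tmul1x (x : talg V) : tmul (tone V) x = x.
Proof. by move: x; apply: talg_ext; [lin|lin|] => s; rewrite tmul_word. Qed.
Lemma tmulx1 (x : talg V) : tmul x (tone V) = x.
Proof. by move: x; apply: talg_ext; [lin|lin|] => s;
  rewrite tmul_word cats0. Qed.
End TensorAlgebraMul.

Section TensorAlgebraCrossed.
Variables (k : fieldType) (A : bialgData k) (SA : A -> A) (hA : is_hopf SA).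
Variables (V : lmodType k) (M : crossedData A V) (hM : is_crossed SA M).
Implicit Types U : lmodType k.
Local Notation "v ◁ a" := (xact M v a) (at level 35).
Local Notation tone := (tone V).
Let algA := hopf_alg hA.
Let coalgA := hopf_coalg hA.
Let bM := crossed_act hM.
Let lM := crossed_coact hM.

Lemma wact_lin s : lin (wact M s).
Proof. elim: s => [|v s IH] /=; lin. Qed.
Lemma lin_wact (X : lmodType k) s (e : X -> A) : lin e -> lin (fun x =>
  wact M s (e x)).
Proof. exact: (lin_comp (wact_lin s)). Qed.
Hint Resolve lin_wact : lin.

Lemma wact_multilin a : multilin (fun s => wact M s a).
Proof.
apply: multilinI => s1 s2; elim: s1 a => [|w s1 IH] a /=; first by lin.
by apply: lin_swr => a1 a2; apply: lin_tmulr; exact: IH.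
Qed.

Lemma wact1 v a : wact M [:: v] a = word [:: v ◁ a].
Proof.
rewrite /= -[RHS](counr coalgA (f := fun a => word [:: v ◁ a])); last by lin.
apply: eq_sw => a1 a2.
by rewrite (blZr (tmul_bl V)) tmulx1.
Qed.

Lemma wcoact_multilin : multilin (wcoact M).
Proof.
apply: multilinI => s1 s2; elim: s1 => [|w s1 IH] /=; first by lin.
apply: lin_swr => v0 v1; apply: lin_swl; [exact: IH|lin].
Qed.
Lemma tcoact_word s : tlift (wcoact M) (word s) = wcoact M s.
Proof. exact/tlift_word/wcoact_multilin. Qed.
Lemma lin_tcoact (X : lmodType k) (e : X -> talg V) :
  lin e -> lin (fun x => tlift (wcoact M) (e x)).
Proof. exact/lin_tlift/wcoact_multilin. Qed.
Hint Resolve lin_tcoact : lin.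

Lemma tcoact_cons v (x : talg V) : tlift (wcoact M) (tmul (word [:: v]) x) =
  sw (xcoact M v) (fun v0 v1 => sw (tlift (wcoact M) x) (fun t0 t1 =>
      tmul (word [:: v0]) t0 ⊗ bmul v1 t1)).
Proof.
move: x; apply: talg_ext; [lin|lin|] => s.
by rewrite tmul_word !tcoact_word.
Qed.

Lemma wcoact_counit s : sw (wcoact M s) (fun t0 t1 => bcounit t1 *: t0) =
  word s.
Proof.
elim: s => [|v s IH] /=; first by swt; rewrite (counit1 hA) scale1r.
rewrite sw_sw; last by lin.
transitivity (sw (xcoact M v) (fun v0 v1 => bcounit v1 *: tmul (word [:: v0])
  (word s))).
  apply: eq_sw => v0 v1; rewrite sw_sw; last by lin.
  rewrite -IH (sw_lin (L := tmul (word [:: v0]))); last by lin.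
  rewrite -sw_scale; apply: eq_sw => t0 t1; swt.
  by rewrite (counitM hA) (blZr (tmul_bl V)) scalerA.
rewrite (coact_coun hM (f := fun v => tmul (word [:: v]) (word s)));
  last by lin.
by rewrite tmul_word.
Qed.

Lemma wcoact_coass U (f : talg V -> A -> A -> U) s : trl f ->
  sw (wcoact M s) (fun t0 t1 => sw (tlift (wcoact M) t0) (fun a b =>
    f a b t1)) =
  sw (wcoact M s) (fun t0 t1 => sw (bcomul t1) (fun a b => f t0 a b)).
Proof.
elim: s U f => [|v s IH] U f tf /=.
  swt; rewrite tcoact_word /=; swt; swt.
  by rewrite (sw_comul1 hA) //; lin.
rewrite sw_sw; last by lin.
rewrite [RHS]sw_sw; last by lin.
transitivity (sw (xcoact M v) (fun v0 v1 => sw (xcoact M v0) (fun u0 u1 =>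
  sw (wcoact M s) (fun t0 t1 => sw (bcomul t1) (fun a b =>
    f (tmul (word [:: u0]) t0) (bmul u1 a) (bmul v1 b)))))).
  apply: eq_sw => v0 v1; rewrite sw_sw; last by lin.
  under eq_sw => t0 t1.
    swt; rewrite tcoact_cons sw_sw; last by lin.
    under eq_sw => u0 u1.
      rewrite sw_sw; last by lin.
      under eq_sw => a b. swt. over.
      over.
    over.
  rewrite sw_exch; apply: eq_sw => u0 u1.
  by rewrite (IH _ (fun a b c => f (tmul (word [:: u0]) a) (bmul u1 b) (bmul v1
    c))) //; lin.
rewrite (coact_coass hM (f := fun u0 u1 v1 => sw (wcoact M s) (fun t0 t1 =>
  sw (bcomul t1) (fun a b => f (tmul (word [:: u0]) t0) (bmul u1 a) (bmul v1
    b)))));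
  last by lin.
apply: eq_sw => v0 v1; rewrite [RHS]sw_sw; last by lin.
rewrite sw_exch; apply: eq_sw => t0 t1; swt.
by rewrite (sw_comulM hA) //; lin.
Qed.

Lemma tgrade_multilin i : multilin (fun s : seq V =>
  if odd (size s) == i then word s else 0).
Proof.
move=> s1 s2 c x y; rewrite !size_cat /=; case: ifP => _.
  exact: multilin_word.
by rewrite scaler0 addr0.
Qed.
Lemma tgrade_word i s : tgrade i (word s : talg V) =
  if odd (size s) == i then word s else 0.
Proof. exact/tlift_word/tgrade_multilin. Qed.
Lemma lin_tgrade (X : lmodType k) i (e : X -> talg V) :
  lin e -> lin (fun x => tgrade i (e x)).
Proof. exact/lin_tlift/tgrade_multilin. Qed.
Hint Resolve lin_tgrade : lin.
Lemma tgrade_cons i v x :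
  tgrade i (tmul (word [:: v]) x : talg V) = tmul (word [:: v]) (tgrade (~~ i)
    x).
Proof.
move: x; apply: talg_ext; [lin|lin|] => s.
rewrite tmul_word !tgrade_word /= eqb_negLR; case: eqP => _;
  first by rewrite tmul_word.
by rewrite (bl0r (tmul_bl V)).
Qed.

Lemma wcoact_grade U (f : talg V -> A -> U) i s : bl f ->
  sw (wcoact M s) (fun t0 t1 => f (tgrade i t0) t1) =
  if odd (size s) == i then sw (wcoact M s) f else 0.
Proof.
elim: s i U f => [|v s IH] i U f bf /=.
  do !swt; rewrite tgrade_word /=; case: (i) => //=; exact: bl0l.
rewrite sw_sw; last by lin.
under eq_sw => v0 v1.
  rewrite sw_sw; last by lin.
  under eq_sw => t0 t1. swt; rewrite tgrade_cons. over.
  rewrite (IH _ _ (fun x y => f (tmul (word [:: v0]) x) (bmul v1 y)));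
    last by lin.
  over.
rewrite eqb_negLR; case: eqP => _; last by rewrite sw_zero.
rewrite [RHS]sw_sw //; apply: eq_sw => v0 v1; rewrite sw_sw //.
by apply: eq_sw => t0 t1; swt.
Qed.

Variable sigma : k.
Hypothesis sigma2 : sigma * sigma = 1.

Lemma sigma_odd n : sigma ^+ n = sigma ^+ odd n.
Proof.
elim: n => // n IH; rewrite exprS IH /=; case: odd => /=.
  by rewrite expr1 sigma2.
by rewrite expr0 mulr1.
Qed.

Local Notation T := (talg V).
Local Notation E := (boson (tensor_alg M sigma)).

(** This and the following definitions restate operations of [boson (tensor_alg M sigma)] on the
    explicit type [tensor A T]. Those that mirror a field of [boson] are convertible to it, and the
    database [lin] can work with them. *)
Definition bos_LA (a : A) (z : tensor A T) : tensor A T :=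
  sw z (fun b t => bmul a b ⊗ t).
Definition bos_LV (v : V) (z : tensor A T) : tensor A T :=
  sw z (fun b t => sw (bcomul b) (fun b1 b2 =>
    b1 ⊗ tmul (word [:: v ◁ b2]) t)).
Definition bos_mul (x y : tensor A T) : tensor A T :=
  sw x (fun a eta => sw y (fun b zeta => sw (bcomul b) (fun b1 b2 =>
         bmul a b1 ⊗ tmul (tlift (fun s => wact M s b2) eta) zeta))).
(* The coproduct of [A # TV] on [1 ⊗ x], as a function of the braided coproduct
   of [x]. *)
Definition bos_half (z : tensor T T) : tensor (tensor A T) (tensor A T) :=
  sw z (fun eta1 eta2 => sw (tlift (wcoact M) eta1) (fun eta10 eta11 =>
     (bone ⊗ eta10) ⊗ (eta11 ⊗ eta2))).
Definition bos_grade i (x : tensor A T) : tensor A T :=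
  sw x (fun a eta => a ⊗ tgrade i eta).

Lemma lin_tact_l (X : lmodType k) a (e : X -> T) :
  lin e -> lin (fun x => tlift (fun s => wact M s a) (e x)).
Proof. exact/lin_tlift/wact_multilin. Qed.
Lemma lin_tact_r (X : lmodType k) t (e : X -> A) :
  lin e -> lin (fun x => tlift (fun s => wact M s (e x)) t).
Proof. by move=> le; apply: lin_tliftr => s; lin. Qed.
Hint Resolve lin_tact_l lin_tact_r : lin.

Lemma bos_LA_bl : bl bos_LA. Proof. rewrite /bos_LA; lin. Qed.
Lemma bos_LV_bl : bl bos_LV. Proof. rewrite /bos_LV; lin. Qed.
Lemma bos_mul_bl : bl bos_mul. Proof. rewrite /bos_mul; lin. Qed.
Lemma bos_half_lin : lin bos_half. Proof. rewrite /bos_half; lin. Qed.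
Lemma bos_grade_lin i : lin (bos_grade i). Proof. rewrite /bos_grade; lin. Qed.
Let bLA := bos_LA_bl.
Let bLV := bos_LV_bl.
Let bmul_ := bos_mul_bl.

Lemma bos_ext U (f h : tensor A T -> U) : lin f -> lin h ->
  (forall a s, f (a ⊗ word s) = h (a ⊗ word s)) -> f =1 h.
Proof.
move=> lf lh fh; apply: tensor_ext => // a; apply: talg_ext => [||s];
  [lin|lin|].
exact: fh.
Qed.

Lemma bos_muld a s w : bos_mul (a ⊗ word s) w = bos_LA a (foldr bos_LV w s).
Proof.
elim: s a w => [|v s IH] a w.
  move: w; apply: bos_ext; [lin|lin|] => b t.
  rewrite /bos_mul /bos_LA /=; do !swt.
  rewrite -[RHS](counr coalgA (f := fun b => bmul a b ⊗ word t)); last by lin.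
  apply: eq_sw => b1 b2; rewrite tlift_word /=; last exact: wact_multilin.
  by rewrite (blZl (tmul_bl V)) tmul1x tensZr.
have IH1 : foldr bos_LV w s = bos_mul (bone ⊗ word s) w.
  rewrite IH /bos_LA -[LHS]sw_id; apply: eq_sw => b t.
  by rewrite (bmul1_ hA).
rewrite /= IH1; move: w {IH1}; apply: bos_ext; [lin|lin|] => b t.
rewrite /bos_mul; do !swt.
rewrite /bos_LA /bos_LV !sw_sw; [|lin..].
under [RHS]eq_sw => b1 b2.
  rewrite (bmul1_ hA); swt; rewrite sw_sw; last by lin.
  under eq_sw => c1 c2. swt. over.
  over.
rewrite [RHS]coass //; last by lin.
apply: eq_sw => b1 b2; rewrite !tlift_word; [|exact: wact_multilin..].
rewrite /= (sw_lin (L := fun x => bmul a b1 ⊗ tmul x (word t))); last by lin.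
apply: eq_sw => c1 c2; rewrite tlift_word; last exact: wact_multilin.
by rewrite tmulA.
Qed.

Lemma tbraid_bilin t : @multilin k V (tensor T T) (fun s => tlift (fun t0 =>
  sigma ^+ (size s * size t0) *:
    sw (wcoact M t0) (fun u0 u1 => u0 ⊗ wact M s u1)) t).
Proof.
apply: multilin_tlift_r => u s1 s2 c x y.
rewrite !size_cat /=; move: c x y; apply: (@lin_scaler k V (tensor T T)).
by apply: lin_swr => *; apply: lin_tens_r; exact: wact_multilin.
Qed.
Lemma tbraid_inner s : @multilin k V (tensor T T) (fun t0 : seq V =>
  sigma ^+ (size s * size t0) *:
    sw (wcoact M t0) (fun u0 u1 => u0 ⊗ wact M s u1)).
Proof.
move=> s1 s2 c x y; rewrite !size_cat /=; move: c x y;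
  apply: (@lin_scaler k V (tensor T T)).
by apply: lin_swl; [exact: wcoact_multilin|lin].
Qed.
Lemma lin_tbraid_l (X : lmodType k) (e : X -> T) t :
  lin e -> lin (fun x => tbraid M sigma (e x) t).
Proof. exact/lin_tlift/tbraid_bilin. Qed.
Lemma lin_tbraid_r (X : lmodType k) (e : X -> T) t :
  lin e -> lin (fun x => tbraid M sigma t (e x)).
Proof.
by move=> le; apply: lin_tliftr => s; apply: lin_tlift => //;
  exact: tbraid_inner.
Qed.
Hint Resolve lin_tbraid_l lin_tbraid_r : lin.
Lemma tbraid_word s t : tbraid M sigma (word s) (word t) =
  sigma ^+ (size s * size t) *: sw (wcoact M t) (fun u0 u1 => u0 ⊗ wact M s u1).
Proof.
rewrite /tbraid tlift_word; last exact: tbraid_bilin.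
by rewrite tlift_word //; exact: tbraid_inner.
Qed.
Lemma tbraid1 (x : T) : tbraid M sigma tone x = x ⊗ tone.
Proof.
move: x; apply: talg_ext; [lin|lin|] => t.
rewrite tbraid_word mul0n expr0 scale1r -[in RHS](wcoact_counit t).
rewrite (sw_lin (L := fun x => x ⊗ tone)); last by lin.
by apply: eq_sw => u0 u1; rewrite tensZl tensZr.
Qed.
Lemma btmul_lin z : lin (btmul M sigma z).
Proof. rewrite /btmul; lin. Qed.
Lemma lin_btmul (X : lmodType k) z (e : X -> tensor T T) :
  lin e -> lin (fun x => btmul M sigma z (e x)).
Proof. exact: (lin_comp (btmul_lin z)). Qed.
Hint Resolve lin_btmul : lin.
Lemma btmul_letter v s (y : T) :
  btmul M sigma (word [:: v] ⊗ tone + tone ⊗ word [:: v]) (word s ⊗ y) =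
  word (v :: s) ⊗ y + sigma ^+ odd (size s) *:
    sw (wcoact M s) (fun t0 t1 => t0 ⊗ tmul (word [:: v ◁ t1]) y).
Proof.
rewrite /btmul sw_argD; last by lin.
do !swt; rewrite tbraid1 tbraid_word; swt; rewrite tmul1x tmul_word.
congr (_ + _); rewrite mul1n sigma_odd sw_argZ; last by lin.
congr (_ *: _); rewrite sw_sw; last by lin.
by apply: eq_sw => t0 t1; swt; rewrite wact1 tmul1x.
Qed.

Let gam z := bos_grade false z + sigma *: bos_grade true z.
Definition bos_LV2 v (t : tensor (tensor A T) (tensor A T)) :=
  sw (xcoact M v) (fun v0 v1 => sw t (fun x y => bos_LV v0 x ⊗ bos_LA v1 y))
      + sw t (fun x y => gam x ⊗ bos_LV v y).
Let lgam (X : lmodType k) (e : X -> tensor A T) : lin e -> lin (fun x =>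
  gam (e x)).
Proof. by move=> le; rewrite /gam /bos_grade; lin. Qed.
Hint Resolve lgam : lin.

(** The bridge from the braided product on TV ⊗ TV to the ordinary one on E ⊗ E. Braiding v past x
    leaves [x_0 ⊗ (v ◁ x_1)]; after [bos_half] the element [x_1] stands in A, and v passes it by the
    smash relation, the two being matched by coassociativity of the coaction. *)
Lemma bos_half_LV2 v z :
  bos_half (btmul M sigma (word [:: v] ⊗ tone + tone ⊗ word [:: v]) z) =
  bos_LV2 v (bos_half z).
Proof.
have lh := bos_half_lin.
have l2 : lin (bos_LV2 v) by rewrite /bos_LV2; lin.
move: z; apply: tensor_ext; [lin|lin|] => x y; move: x.
apply: talg_ext; [lin|lin|] => s.
rewrite btmul_letter (linD lh) (linZ _ _ lh).
rewrite /bos_half; do !swt; rewrite !tcoact_word /bos_LV2 /=.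
rewrite [X in _ = _ + X]sw_sw; last by lin.
congr (_ + _).
  rewrite sw_sw; last by lin.
  apply: eq_sw => v0 v1; rewrite !sw_sw; [|lin..].
  apply: eq_sw => t0 t1; swt; swt.
  rewrite /bos_LV /bos_LA; swt; swt; rewrite (sw_comul1 hA); last by lin.
  by rewrite (act1 hM).
rewrite sw_sw; last by lin.
transitivity (sigma ^+ odd (size s) *: sw (wcoact M s) (fun t0 t1 =>
   sw (bcomul t1) (fun c1 c2 => ((bone : A) ⊗ t0) ⊗ (c1 ⊗ tmul (word [:: v ◁
     c2]) y)))).
  congr (_ *: _); rewrite -(wcoact_coass (f := fun a b c =>
    ((bone : A) ⊗ a) ⊗ (b ⊗ tmul (word [:: v ◁ c]) y)));
    last by lin.
  by apply: eq_sw => t0 t1; swt.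
pose f (t0 : T) t1 := ((bone : A) ⊗ t0) ⊗ bos_LV v (t1 ⊗ y).
have bf : bl f by rewrite /f; lin.
(* The coaction preserves length, so every [t0] has the parity of [size s], and the two terms of
   [gam] reduce to the single sign [sigma ^+ odd (size s)]. *)
transitivity (sw (wcoact M s) (fun t0 t1 => f (tgrade false t0) t1) +
   sigma *: sw (wcoact M s) (fun t0 t1 => f (tgrade true t0) t1)).
  rewrite !wcoact_grade //.
  have -> : sw (wcoact M s) f = sw (wcoact M s) (fun t0 t1 =>
   sw (bcomul t1) (fun c1 c2 => ((bone : A) ⊗ t0) ⊗ (c1 ⊗ tmul (word [:: v ◁
     c2]) y))).
    apply: eq_sw => t0 t1; rewrite /f /bos_LV; swt; rewrite sw_lin //; lin.
  by case: odd; rewrite /= ?scaler0 ?addr0 ?add0r ?scale1r ?expr1.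
rewrite -sw_scale -sw_add; apply: eq_sw => t0 t1; swt.
by rewrite /f /gam /bos_grade; do !swt; rewrite tensDl tensZl.
Qed.
End TensorAlgebraCrossed.

Section BosonSmash.
Variables (k : fieldType) (A : bialgData k) (SA : A -> A) (hA : is_hopf SA).
Variables (V : lmodType k) (M : crossedData A V) (hM : is_crossed SA M).
Variable sigma : k.
Hypothesis sigma2 : sigma * sigma = 1.
Local Notation "v ◁ a" := (xact M v a) (at level 35).
Local Notation tone := (tone V).
Local Notation T := (talg V).
Local Notation E := (boson (tensor_alg M sigma)).
Let algA := hopf_alg hA.
Let coalgA := hopf_coalg hA.
Let bM := crossed_act hM.

Lemma btmul_linl (X : lmodType k) (e : X -> tensor T T) z :
  lin e -> lin (fun x => btmul M sigma (e x) z).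
Proof.
have h1 (Y : lmodType k) (f : Y -> T) t : lin f -> lin (fun x =>
  tbraid M sigma (f x) t).
  exact: (lin_tbraid_l hM).
have h2 (Y : lmodType k) (f : Y -> T) t : lin f -> lin (fun x =>
  tbraid M sigma t (f x)).
  exact: (lin_tbraid_r hA hM).
move=> le; rewrite /btmul; apply: lin_swl => //.
apply: blI => [y|x].
  by apply: lin_swr => x' y'; apply: lin_swr => u w; lin.
apply: lin_swr => x' y'; apply: lin_swl; last by lin.
exact: h1.
Qed.

Lemma tcomul_multilin :
  multilin (foldr (fun v z => btmul M sigma (word [:: v] ⊗ tone + tone ⊗ word
    [:: v]) z)
               (tone ⊗ tone)).
Proof.
apply: multilinI => s1 s2; elim: s1 => [|w s1 IH] /=.
  by apply: btmul_linl; lin.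
exact: (lin_btmul hA hM).
Qed.
Lemma lin_tcomul (X : lmodType k) (e : X -> T) :
  lin e -> lin (fun x => tcomul M sigma (e x)).
Proof. exact/lin_tlift/tcomul_multilin. Qed.
Lemma tcomul_word s : tcomul M sigma (word s) =
  foldr (fun v z => btmul M sigma (word [:: v] ⊗ tone + tone ⊗ word [:: v]) z)
               (tone ⊗ tone) s.
Proof. exact/tlift_word/tcomul_multilin. Qed.

Lemma tcounit_multilin : multilin (fun s : seq V => ((size s == 0)%N%:R : k^o)).
Proof. by move=> s1 s2 c x y; rewrite !size_cat /= !addnS scaler0 addr0. Qed.
Lemma tcounit_word s : tcounit (word s : T) = (size s == 0)%N%:R.
Proof. exact: (tlift_word s tcounit_multilin). Qed.
Lemma lin_tcounit (X : lmodType k) (e : X -> T) :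
  lin e -> lin (fun x => tcounit (e x) : k^o).
Proof. exact/lin_tlift/tcounit_multilin. Qed.
Hint Resolve lin_tcomul lin_tcounit : lin.

Let ltc (X : lmodType k) (e : X -> T) :
  lin e -> lin (fun x => tlift (wcoact M) (e x)).
Proof. exact: (lin_tcoact hA hM). Qed.
Hint Resolve ltc : lin.

Lemma bos_half_word s : bos_half M (tcomul M sigma (word s)) =
  foldr (bos_LV2 M sigma) ((bone ⊗ tone) ⊗ (bone ⊗ tone)) s.
Proof.
elim: s => [|v s IH].
  rewrite tcomul_word /= /bos_half; swt.
  by rewrite (tcoact_word hA hM) /=; swt.
by rewrite /= -IH -(bos_half_LV2 hA hM sigma2) !tcomul_word.
Qed.

Definition bos_comul (x : tensor A T) : tensor (tensor A T) (tensor A T) :=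
  sw x (fun a eta => sw (bcomul a) (fun a1 a2 =>
    sw (tcomul M sigma eta) (fun eta1 eta2 => sw (tlift (wcoact M) eta1)
      (fun eta10 eta11 => (a1 ⊗ eta10) ⊗ (bmul a2 eta11 ⊗ eta2))))).
Definition bos_counit (x : tensor A T) : k :=
  sw x (fun a eta => (bcounit a * tcounit eta : k^o)).
Lemma bos_comul_lin : lin bos_comul. Proof. by rewrite /bos_comul; lin. Qed.
Lemma bos_counit_lin : lin (bos_counit : _ -> k^o).
Proof. by rewrite /bos_counit; lin. Qed.

Lemma bos_comuld a s : bos_comul (a ⊗ word s) = sw (bcomul a) (fun a1 a2 =>
  sw (foldr (bos_LV2 M sigma) ((bone ⊗ tone) ⊗ (bone ⊗ tone)) s)
    (fun x y => bos_LA a1 x ⊗ bos_LA a2 y)).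
Proof.
have bLA : bl (@bos_LA k A V) by exact: bos_LA_bl hA _.
rewrite -bos_half_word /bos_comul; swt.
apply: eq_sw => a1 a2; rewrite /bos_half sw_sw; last by lin.
apply: eq_sw => eta1 eta2; rewrite sw_sw; last by lin.
apply: eq_sw => t0 t1; swt; rewrite /bos_LA; do !swt.
by rewrite (bmul_1 hA).
Qed.

Lemma boson_smash : @smash k A SA V M sigma E (fun a s => a ⊗ word s)
  (@bos_LA k A V) (bos_LV M) (@boson_grade _ _ (tensor_alg M sigma)).
Proof.
split=> //.
- by move=> s; exact: (lin_tens_l (word s) (@lin_id k A)).
- by move=> a s1 s2; exact: (lin_tens_r a (multilin_word s1 s2)).
- move=> U f lf mf; exists (fun x => sw x (fun a eta => tlift (f a) eta)).
    apply: lin_sw_arg; apply: blI => [eta|a].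
      by apply: lin_tliftr => s; exact: lf.
    exact: (lin_tlift (mf a) (@lin_id k T)).
  move=> a s; rewrite sw_tensE ?tlift_word //; apply: blI => [eta|b].
    by apply: lin_tliftr => t; exact: lf.
  exact: (lin_tlift (mf b) (@lin_id k T)).
- move=> x; have [r ->] := tensor_sum x.
  elim: r => [|[a t] r [s E]]; first by exists [::]; rewrite !big_nil.
  have [r' ->] := word_sum t.
  exists ([seq (q.1 *: a, q.2) | q <- r'] ++ s).
  rewrite big_cons big_cat big_map /= E; congr (_ + _).
  by rewrite tens_sumr; apply: eq_bigr => q _; rewrite tensZr tensZl.
- exact: (bos_LA_bl hA).
- exact: (bos_LV_bl hA hM).
- exact: bos_grade_lin.
- by move=> a b s; rewrite /bos_LA; swt.
- move=> v b s; rewrite /bos_LV; swt.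
  by apply: eq_sw => b1 b2; rewrite tmul_word.
- move=> i a s; transitivity (@bos_grade k A V i (a ⊗ word s)) => //.
  rewrite /bos_grade sw_tensE; last first.
    have l (X : lmodType k) (e : X -> T) : lin e -> lin (fun x =>
      tgrade i (e x)).
      exact: lin_tgrade.
    by apply: blI => x; [lin|apply: lin_tens_r; exact: (l _ (fun x => x))].
  by rewrite tgrade_word; case: eqP => // _; rewrite tens0r.
- exact: (bos_mul_bl hA hM).
- exact: (bos_muld hA hM).
- exact: bos_comul_lin.
- exact: bos_comuld.
- exact: bos_counit_lin.
- move=> a s; transitivity (bos_counit (a ⊗ word s)) => //.
  by rewrite /bos_counit; swt; rewrite tcounit_word.
Qed.
End BosonSmash.

(** * Braided factorials and the pairing *)

Section NicholsKernel.
Variables (k : fieldType) (A : bialgData k) (SA : A -> A) (hA : is_hopf SA).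
Variables (V : lmodType k) (M : crossedData A V) (hM : is_crossed SA M).
Variable sigma : k.
Hypothesis sigma2 : sigma * sigma = 1.
Variables (V' : lmodType k) (e : V' -> V -> k).
Hypothesis be : bl (e : V' -> V -> k^o).
Local Notation "v ◁ a" := (xact M v a) (at level 35).
Local Notation tone := (tone V).
Local Notation T := (talg V).
Let algA := hopf_alg hA.
Let bM := crossed_act hM.
Let lM := crossed_coact hM.
Let btm := tmul_bl V.
Let ltc (X : lmodType k) (f : X -> T) :
  lin f -> lin (fun x => tcomul M sigma (f x)).
Proof. exact: (lin_tcomul hA hM). Qed.
Let lcoact (X : lmodType k) (f : X -> T) :
  lin f -> lin (fun x => tlift (wcoact M) (f x)).
Proof. exact: (lin_tcoact hA hM). Qed.
Let lcounit (X : lmodType k) (f : X -> T) :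
  lin f -> lin (fun x => tcounit (f x) : k^o).
Proof. exact: lin_tcounit. Qed.
Hint Resolve ltc lcoact lcounit : lin.

Lemma tcomp_multilin n : multilin (fun s : seq V =>
  if size s == n then word s else 0).
Proof.
move=> s1 s2 c x y; rewrite !size_cat /=; case: ifP => _.
  exact: multilin_word.
by rewrite scaler0 addr0.
Qed.
Lemma tcomp_word n s : tcomp n (word s : T) = if size s == n then word s else 0.
Proof. exact/tlift_word/tcomp_multilin. Qed.
Lemma lin_tcomp (X : lmodType k) n (f : X -> T) : lin f -> lin (fun x =>
  tcomp n (f x)).
Proof. exact/lin_tlift/tcomp_multilin. Qed.
Hint Resolve lin_tcomp : lin.
Lemma tcomp_cons n v (x : T) :
  tcomp n.+1 (tmul (word [:: v]) x) = tmul (word [:: v]) (tcomp n x).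
Proof.
move: x; apply: talg_ext; [lin|lin|] => s.
rewrite tmul_word !tcomp_word /= eqSS; case: eqP => _;
  first by rewrite tmul_word.
by rewrite (bl0r btm).
Qed.
Lemma tcomp_id n (x : T) : tcomp n (tcomp n x) = tcomp n x.
Proof.
move: x; apply: talg_ext; [lin|lin|] => s.
rewrite tcomp_word; case: eqP => E; first by rewrite tcomp_word E eqxx.
by apply: (lin0 (f := tcomp n)); lin.
Qed.

Definition dg1 (x : T) : V := tlift (@letter k V) x.
Lemma lin_dg1 (X : lmodType k) (f : X -> T) : lin f -> lin (fun x => dg1 (f x)).
Proof. exact/lin_tlift/letter_multilin. Qed.
Hint Resolve lin_dg1 : lin.
Lemma dg1_word s : dg1 (word s) = letter s.
Proof. exact/tlift_word/letter_multilin. Qed.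
Lemma dg1_cons v x : dg1 (tmul (word [:: v]) x) = tcounit x *: v.
Proof.
move: x; apply: talg_ext; [lin|lin|] => s.
by rewrite tmul_word dg1_word tcounit_word; case: s => [|w s] /=;
  rewrite ?scale1r ?scale0r.
Qed.
Lemma tcounit_cons v (x : T) : tcounit (tmul (word [:: v]) x) = 0.
Proof.
apply: (talg_ext (U := k^o) (f := fun x => tcounit (tmul (word [:: v]) x)) (h
  := fun=> 0)); [lin|lin|] => s.
by rewrite tmul_word tcounit_word.
Qed.
Lemma tcounit1 : tcounit tone = 1. Proof. by rewrite tcounit_word. Qed.

Lemma wcoact_dg1 (U : lmodType k) (f : V -> A -> U) s : bl f ->
  sw (wcoact M s) (fun t0 t1 => f (dg1 t0) t1) = sw (xcoact M (letter s)) f.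
Proof.
move=> bf; case: s => [|v [|w s]] /=.
- by swt; rewrite dg1_word /= (bl0l bf) (lin0 lM) sw_0.
- rewrite sw_sw; last by lin.
  apply: eq_sw => v0 v1; do !swt.
  by rewrite dg1_cons tcounit1 scale1r (bmul_1 hA).
rewrite (lin0 lM) sw_0 // sw_sw; last by lin.
apply: sw_zero => v0 v1; rewrite sw_sw; last by lin.
rewrite sw_sw; last by lin.
apply: sw_zero => w0 w1; rewrite sw_sw; last by lin.
apply: sw_zero => t0 t1; do !swt.
by rewrite dg1_cons tcounit_cons scale0r (bl0l bf).
Qed.
Lemma wcoact_tcounit (U : lmodType k) (f : A -> U) s : lin f ->
  sw (wcoact M s) (fun t0 t1 => tcounit t0 *: f t1) =
    tcounit (word s : T) *: f bone.
Proof.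
move=> lf; case: s => [|v s] /=; first by swt.
rewrite sw_sw; last by lin.
rewrite tcounit_word scale0r; apply: sw_zero => v0 v1; rewrite sw_sw;
  last by lin.
by apply: sw_zero => t0 t1; swt; rewrite tcounit_cons scale0r.
Qed.

Lemma tcomul_cons v s : tcomul M sigma (word (v :: s)) =
  btmul M sigma (word [:: v] ⊗ tone + tone ⊗ word [:: v]) (tcomul M sigma (word
    s)).
Proof. by rewrite !(tcomul_word hA hM). Qed.

Lemma tcomul_counit (x : T) : sw (tcomul M sigma x) (fun x1 x2 =>
  tcounit x1 *: x2) = x.
Proof.
move: x; apply: talg_ext; [lin|lin|] => s.
elim: s => [|v s IH].
  by rewrite (tcomul_word hA hM) /=; swt; rewrite tcounit1 scale1r.
have {2}-> : word (v :: s) = tmul (word [:: v]) (word s) by rewrite tmul_word.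
have lb (X : lmodType k) z (f : X -> tensor T T) : lin f -> lin (fun x =>
  btmul M sigma z (f x)).
  exact: (lin_btmul hA hM).
rewrite -[in RHS]IH tcomul_cons; move: (tcomul M sigma (word s)).
apply: tensor_ext; [lin|lin|] => x y; move: x.
apply: talg_ext; [lin|lin|] => t.
rewrite (btmul_letter hA hM sigma2) sw_argD; last by lin.
swt; swt; rewrite tcounit_word scale0r add0r sw_argZ; last by lin.
rewrite sw_sw; last by lin.
under eq_sw => t0 t1 do swt.
rewrite (wcoact_tcounit (f := fun a => tmul (word [:: v ◁ a]) y)); last by lin.
rewrite (act1 hM) (blZr btm) tcounit_word; case: t => [|w t] /=;
  last by rewrite !scale0r scaler0.
by rewrite expr0 scale1r.
Qed.

(* The component in [V ⊗ TV] of the braided coproduct; on [V^{⊗n}] it is the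
   braided integer [[n, sigma Psi]], see [bint_tder]. *)
Definition tder (x : T) : tensor V T :=
  sw (tcomul M sigma x) (fun x1 x2 => dg1 x1 ⊗ x2).
Lemma tder_lin : lin tder. Proof. by rewrite /tder; lin. Qed.
(** Prepends v by braiding it past the first factor: [w ⊗ y] goes to [Psi (v ⊗ w)] with its second
    leg multiplied into y. *)
Definition pushl v (z : tensor V T) : tensor V T :=
  sw z (fun w y => sw (xcoact M w) (fun w0 w1 => w0 ⊗ tmul (word [:: v ◁ w1])
    y)).

Lemma tder1 : tder tone = 0.
Proof. by rewrite /tder (tcomul_word hA hM) /=; swt;
  rewrite dg1_word tens0l. Qed.
(** The recursion [[n+1, sigma Psi] = id + sigma Psi_1 (id ⊗ [n, sigma Psi])]: either v is itself
    the degree-one factor, or it is braided past the letter that is. *)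
Lemma tder_cons v s :
  tder (word (v :: s)) = v ⊗ word s + sigma *: pushl v (tder (word s)).
Proof.
have lb (X : lmodType k) z (f : X -> tensor T T) : lin f -> lin (fun x =>
  btmul M sigma z (f x)).
  exact: (lin_btmul hA hM).
(* With [word s] written as the counit contraction of its own coproduct, both sides are linear in
   that coproduct, which may then be replaced by a pure tensor. *)
rewrite -[X in v ⊗ X]tcomul_counit /tder tcomul_cons;
  move: (tcomul M sigma (word s)).
rewrite /pushl; apply: tensor_ext; [lin|lin|] => x y; move: x.
apply: talg_ext; [lin|lin|] => t.
rewrite (btmul_letter hA hM sigma2) sw_argD; last by lin.
do !swt; rewrite dg1_word tcounit_word; congr (_ + _).
  by case: t => [|w t] /=; rewrite ?scale1r ?scale0r ?tens0l ?tens0r.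
rewrite sw_argZ; last by lin.
rewrite sw_sw; last by lin.
under eq_sw => t0 t1 do swt.
rewrite (wcoact_dg1 (f := fun w a => w ⊗ tmul (word [:: v ◁ a]) y));
  last by lin.
rewrite dg1_word; case: t => [|w [|w' t]] //=.
- by rewrite (lin0 lM) sw_0 ?scaler0 //; lin.
by rewrite (lin0 lM) sw_0 ?scaler0 //; lin.
Qed.

Definition consm (z : tensor V T) : T := sw z (fun v y => tmul (word [:: v]) y).

Lemma wpsi_multilin i : multilin (wpsi M i).
Proof.
elim: i => [|i IH]; apply: multilinI => s1 s2.
  case: s1 => [|w [|w' s1]] /=.
  - case: s2 => [|w s2]; first by lin.
    apply: lin_swr => w0 w1; apply: (lin_comp (multilin_word [:: w0] s2)); lin.
  - apply: lin_swl; first by lin.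
    apply: blI => [a|v]; first by apply: (lin_comp (multilin_word [::] (w ◁ a
      :: s2))); lin.
    by apply: (lin_comp (multilin_word [:: v] s2)); lin.
  apply: lin_swr => w0 w1; exact: (multilin_word [:: w0, w ◁ w1 & s1]).
case: s1 => [|w s1] /=; first by lin.
by apply: lin_tmulr; exact: IH.
Qed.
Lemma lin_tpsi (X : lmodType k) i (f : X -> T) : lin f -> lin (fun x =>
  tpsi M i (f x)).
Proof. exact/lin_tlift/wpsi_multilin. Qed.
Hint Resolve lin_tpsi : lin.
Lemma tpsi_word i s : tpsi M i (word s) = wpsi M i s.
Proof. exact/tlift_word/wpsi_multilin. Qed.
Lemma tpsi_cons i v x : tpsi M i.+1 (tmul (word [:: v]) x) =
  tmul (word [:: v]) (tpsi M i x).
Proof.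
by move: x; apply: talg_ext; [lin|lin|] => s; rewrite tmul_word !tpsi_word.
Qed.
Lemma tpsi0_cons v z :
  tpsi M 0 (tmul (word [:: v]) (consm z)) = consm (pushl v z).
Proof.
rewrite /consm /pushl; move: z; apply: tensor_ext; [lin|lin|] => w y.
do !swt; move: y; apply: talg_ext; [lin|lin|] => s.
rewrite !tmul_word tpsi_word /= sw_sw; last by lin.
by apply: eq_sw => w0 w1; swt; rewrite !tmul_word.
Qed.

Let fp (x : T) l := foldr (fun i y => sigma *: tpsi M i y) x l.
Lemma lin_fp (X : lmodType k) l (f : X -> T) : lin f -> lin (fun x =>
  fp (f x) l).
Proof. by move=> lf; elim: l => [|i l IH] //=; apply: lin_scaler;
  apply: lin_tpsi. Qed.
Lemma fp_cons m j v x :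
  fp (tmul (word [:: v]) x) (iota m.+1 j) = tmul (word [:: v]) (fp x (iota m
    j)).
Proof.
elim: j m => [|j IH] m //=.
by rewrite IH tpsi_cons (blZr btm).
Qed.
Lemma lin_bint (X : lmodType k) m n (f : X -> T) : lin f -> lin (fun x =>
  bint M sigma m n (f x)).
Proof. by move=> lf; apply: lin_big => j; exact: lin_fp. Qed.
Lemma bint_shift m n v x :
  bint M sigma m.+1 n (tmul (word [:: v]) x) = tmul (word [:: v]) (bint M sigma
    m n x).
Proof.
rewrite /bint (lin_sum _ _ _ (btm.2 _)); apply: eq_bigr => j _; exact: fp_cons.
Qed.
Lemma lin_bfact (X : lmodType k) m n (f : X -> T) : lin f -> lin (fun x =>
  bfact M sigma m n (f x)).
Proof. by elim: n m f => [|n IH] m f lf //=; apply: IH; exact: lin_bint. Qed.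
Hint Resolve lin_bint lin_bfact : lin.
Lemma bfact_shift m n v x :
  bfact M sigma m.+1 n (tmul (word [:: v]) x) = tmul (word [:: v]) (bfact M
    sigma m n x).
Proof. by elim: n m x => [|n IH] m x //=; rewrite bint_shift IH. Qed.

(** The summand for j = 0 is the identity; every other one has [tpsi 0] outermost, applied to a
    summand of the shifted integer. This is the recursion of [tder_cons], with positions counted
    from 0. *)
Lemma bint_tder s : bint M sigma 0 (size s) (word s) = consm (tder (word s)).
Proof.
elim: s => [|v s IH].
  by rewrite /bint big_ord0 tder1 /consm sw_0 //; lin.
rewrite tder_cons /consm sw_argD; last by lin.
swt; rewrite sw_argZ; last by lin.
rewrite -/(consm _) -tpsi0_cons -IH /bint big_ord_recl /=; congr (_ + _);
  first by rewrite tmul_word.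
rewrite (lin_sum _ _ _ (btm.2 _)) (lin_sum (f := tpsi M 0)); last by lin.
rewrite scaler_sumr; apply: eq_bigr => j _.
by rewrite add0n -/(fp _ _) -fp_cons tmul_word.
Qed.

Lemma tder_comp n s : size s = n.+1 ->
  sw (tder (word s)) (fun v y => v ⊗ tcomp n y) = tder (word s).
Proof.
elim: s n => [|v s IH] // n [E].
rewrite tder_cons sw_argD; last by lin.
swt; rewrite tcomp_word E eqxx sw_argZ; last by lin.
congr (_ + _ *: _); case: s E IH => [|w s] E IH.
  by rewrite tder1 /pushl !sw_0 //; lin.
case: n E => // n E; rewrite -[in RHS](IH n) //.
rewrite /pushl sw_sw; last by lin.
rewrite [RHS]sw_sw; last by lin.
apply: eq_sw => u y; swt.
rewrite sw_sw; last by lin.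
by apply: eq_sw => u0 u1; swt; rewrite tcomp_cons.
Qed.

Definition uncons (s : seq V) : tensor V T := if s is v :: s' then v ⊗ word s'
  else 0.
Lemma uncons_multilin : multilin uncons.
Proof.
apply: multilinI => -[|w s1] s2 /=; first by lin.
by apply: lin_tens_r; exact: multilin_word.
Qed.
Lemma lin_uncons (X : lmodType k) (f : X -> T) : lin f -> lin (fun x =>
  tlift uncons (f x)).
Proof. exact/lin_tlift/uncons_multilin. Qed.
Hint Resolve lin_uncons : lin.
Lemma uncons_cons v x : tlift uncons (tmul (word [:: v]) x) = v ⊗ x.
Proof.
move: x; apply: talg_ext; [lin|lin|] => s.
by rewrite tmul_word tlift_word //; exact: uncons_multilin.
Qed.

(** The untwisted evaluation, letter against letter in the same order. The twisted one, [evw], has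
    [tder] in place of [uncons]; the two are compared in [contr_bfact]. *)
Fixpoint contr (s : seq V') (x : T) : k :=
  if s is phi :: s' then
    sw (tlift uncons x) (fun v y => e phi v * contr s' y : k^o)
  else tcounit x.
Lemma contr_lin s : lin (contr s : T -> k^o).
Proof.
elim: s => [|phi s IH]; first exact: (lcounit (@lin_id k T)).
change (lin (fun x : T => sw (tlift uncons x)
  (fun v (y : T) => e phi v * contr s y : k^o))); lin.
Qed.
Lemma contr_cons phi s v x :
  contr (phi :: s) (tmul (word [:: v]) x) = e phi v * contr s x.
Proof. by have l := contr_lin s; rewrite /= uncons_cons; swt. Qed.

Hypothesis sep : forall v, (forall phi, e phi v = 0) -> v = 0.

(** Products of the functionals [e phi] separate tensors of degree n: contracting the first letter
    lowers the degree, and [tensor_sep_l] restores the letter. *)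
Lemma contr_sep n (x : T) : (forall s, size s = n -> contr s x = 0) ->
  tcomp n x = 0.
Proof.
elim: n x => [|n IH] x H.
  have -> : tcomp 0 x = tcounit x *: tone.
    move: (x); apply: talg_ext; [lin|lin|] => s.
    by rewrite tcomp_word tcounit_word; case: s => [|v s] /=;
      rewrite ?scale1r ?scale0r.
  by have -> : tcounit x = 0 := H [::] erefl; rewrite scale0r.
have -> : tcomp n.+1 x = consm (sw (tlift uncons x) (fun v y => v ⊗ tcomp n y)).
  rewrite /consm; move: (x); apply: talg_ext; [lin|lin|] => s.
  rewrite tcomp_word tlift_word; last exact: uncons_multilin.
  case: s => [|v s] /=; first by rewrite !sw_0 //; lin.
  by do !swt; rewrite tcomp_word eqSS; case: eqP => _;
    rewrite ?tmul_word ?(bl0r btm).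
suff -> : sw (tlift uncons x) (fun v y => v ⊗ tcomp n y) = 0.
  by rewrite /consm sw_0 //; lin.
apply: (tensor_sep_l (F := fun f => exists phi, f = e phi)).
  split=> [_ [phi ->]|v Hv]; first exact: be.2.
  by apply: sep => phi; apply: Hv; exists phi.
move=> _ [phi ->]; rewrite sw_sw; last by lin.
under eq_sw => v y. swt; rewrite -(linZ (f := tcomp n)); last by lin. over.
rewrite -(sw_lin (L := tcomp n)); last by lin.
apply: IH => s E; have l := contr_lin s.
rewrite (sw_lin (X := k^o) (L := contr s)) // -[RHS](H (phi :: s)) /= ?E //.
apply: eq_swk => v y; exact: (linZ _ _ l).
Qed.

Lemma tcomp_wpsi n i s : tcomp n (wpsi M i s) = if size s == n then wpsi M i s
  else 0.
Proof.
have l : lin (@tcomp k V n) by lin.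
elim: i n s l => [|i IH] n s l.
  case: s => [|v [|w s]]; rewrite ?(lin0 l); first by case: ifP.
    by case: ifP.
  rewrite /= sw_lin //; case: eqP => E.
    by apply: eq_sw => w0 w1; rewrite tcomp_word /= E eqxx.
  by apply: sw_zero => w0 w1; rewrite tcomp_word /=; case: eqP.
case: s => [|v s] /=; first by rewrite (lin0 l); case: ifP.
case: n l => [|n] l.
  have {1}-> : wpsi M i s = tcomp (size s) (wpsi M i s).
    by rewrite IH ?eqxx //; lin.
  move: (wpsi M i s); apply: (talg_ext (f := fun x =>
    tcomp 0 (tmul (word [:: v]) (tcomp (size s) x))) (h := fun=> 0));
      [lin|lin|] => t.
  rewrite tcomp_word; case: eqP => _; last by rewrite (bl0r btm) (lin0 l).
  by rewrite tmul_word tcomp_word.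
rewrite tcomp_cons IH; last by lin.
by rewrite eqSS; case: eqP => // _; rewrite (bl0r btm).
Qed.
Lemma tcomp_tpsi n i x : tcomp n (tpsi M i x) = tpsi M i (tcomp n x).
Proof.
move: x; apply: talg_ext; [lin|lin|] => s.
rewrite tpsi_word tcomp_wpsi tcomp_word; case: eqP => _;
  first by rewrite tpsi_word.
have l : lin (tpsi M i) by lin.
by rewrite (lin0 l).
Qed.
Lemma tcomp_bint n m j x : tcomp n (bint M sigma m j x) =
  bint M sigma m j (tcomp n x).
Proof.
have l : lin (@tcomp k V n) by lin.
rewrite /bint (lin_sum _ _ _ l); apply: eq_bigr => i _.
elim: (iota m i) => //= a r IH; by rewrite (linZ _ _ l) tcomp_tpsi IH.
Qed.
Lemma tcomp_bfact n m j x : tcomp n (bfact M sigma m j x) =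
  bfact M sigma m j (tcomp n x).
Proof. by elim: j m x => //= j IH m x; rewrite IH tcomp_bint. Qed.

Fixpoint evw (s : seq V') (x : T) : k :=
  if s is phi :: s' then sw (tder x) (fun v y => e phi v * evw s' y : k^o)
  else tcounit x.
Lemma evw_lin s : lin (evw s : T -> k^o).
Proof.
have l := tder_lin.
elim: s => [|phi s IH]; first exact: (lcounit (@lin_id k T)).
change (lin (fun x : T => sw (tder x)
  (fun v (y : T) => e phi v * evw s y : k^o))); lin.
Qed.

Lemma evw_comp_ne s n x : n != size s -> evw s (tcomp n x) = 0.
Proof.
have ld := tder_lin; elim: s n x => [|phi s IH] n x ne.
  have lc : lin (fun x : T => tcounit x : k^o) by lin.
  apply: (talg_ext (U := k^o) (f := fun x => tcounit (tcomp n x)) (h := fun=>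
    0)); [lin|lin|] => t.
  rewrite tcomp_word; case: eqP => [E|_]; last by rewrite (lin0 lc).
  by rewrite tcounit_word E (negPf ne).
have l := evw_lin s; have le := evw_lin (phi :: s).
apply: (talg_ext (U := k^o) (f := fun x => evw (phi :: s) (tcomp n x)) (h :=
  fun=> 0)); [|lin|] => [|t].
  by apply: (lin_comp le); lin.
rewrite tcomp_word; case: eqP => [E|_]; last by rewrite (lin0 le).
case: t E => [|v t] E; first by rewrite /= tder1 sw_0 //; lin.
rewrite /= -(tder_comp (n := size t)) // sw_sw; last by lin.
apply: sw_zero => w y; swt; rewrite IH ?mulr0 //.
by move: ne; rewrite -E.
Qed.

Lemma evw_comp s x : evw s (tcomp (size s) x) = evw s x.
Proof.
have l := evw_lin s.
apply: (talg_ext (U := k^o) (f := fun x => evw s (tcomp (size s) x)) (h := fun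
  x => evw s x)); [lin|lin|] => t.
rewrite tcomp_word; case: eqP => // /eqP ne.
have := evw_comp_ne (word t) ne.
by rewrite tcomp_word eqxx => ->; exact: (lin0 l).
Qed.

(** One step of [evw] applies [tder], which is [[n, sigma Psi]] by [bint_tder]; the remaining steps
    are [id ⊗ [n-1, sigma Psi]!] by induction. Together they form the recursion that defines the
    factorial. *)
Lemma contr_bfact s x :
  contr s (bfact M sigma 0 (size s) (tcomp (size s) x)) =
    evw s (tcomp (size s) x).
Proof.
elim: s x => [|phi s IH] x //.
have lc := contr_lin (phi :: s); have le := evw_lin (phi :: s).
have lc' := contr_lin s; have le' := evw_lin s; have ld := tder_lin.
apply: (talg_ext (U := k^o) (f := fun x => contr (phi :: s) (bfact M sigma 0
  (size (phi :: s)) (tcomp (size (phi :: s)) x))) (h := fun x =>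
    evw (phi :: s) (tcomp (size (phi :: s)) x))); [|by apply: (lin_comp le);
      lin|] => [|t].
  by apply: (lin_comp lc); lin.
rewrite tcomp_word; case: eqP => E; last first.
  have l0 : lin (bfact M sigma 0 (size (phi :: s))) by lin.
  by rewrite (lin0 l0) (lin0 lc) (lin0 le).
change (size (phi :: s)) with (size s).+1 in E |- *.
change (bfact M sigma 0 (size s).+1 (word t)) with
  (bfact M sigma 1 (size s) (bint M sigma 0 (size s).+1 (word t))).
rewrite -[X in bint _ _ _ X]E bint_tder.
change (evw (phi :: s) (word t)) with
  (sw (tder (word t)) (fun v y => e phi v * evw s y : k^o)).
rewrite -(tder_comp E) /consm.
rewrite sw_sw; last by lin.
rewrite [RHS]sw_sw; last by lin.
rewrite (sw_lin (L := bfact M sigma 1 (size s))); last by lin.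
rewrite (sw_lin (X := k^o) (L := contr (phi :: s))) //.
apply: eq_sw => v y; do !swt.
by rewrite bfact_shift contr_cons IH.
Qed.

(** [evw s] is [contr s] composed with the factorial, and in each degree the maps [contr s]
    separate. From here on the kernel is handled only through these functionals. *)
Lemma bker_evw x : bker M sigma x <-> forall s, evw s x = 0.
Proof.
split=> [H s|H n].
  rewrite -evw_comp -contr_bfact H.
  exact: (lin0 (contr_lin s)).
rewrite -tcomp_id -tcomp_bfact; apply: contr_sep => s E.
by rewrite -E contr_bfact evw_comp.
Qed.
End NicholsKernel.

(** * The quotient by the radical *)

Section Radical.
Variables (k : fieldType) (A H : bialgData k) (SA : A -> A) (SH : H -> H).
Variables (V V' : lmodType k) (M : crossedData A V) (M' : crossedData H V').
Variables (p : H -> A -> k) (e : V' -> V -> k) (sigma : k).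
Hypothesis hA : is_hopf SA.
Hypothesis hM : is_crossed SA M.
Hypothesis hH : is_hopf SH.
Hypothesis hM' : is_crossed SH M'.
Hypothesis sigma2 : sigma * sigma = 1.
Hypothesis p_sep : forall a, (forall h, p h a = 0) -> a = 0.
Hypothesis e_sep : forall v, (forall phi, e phi v = 0) -> v = 0.
Local Notation T := (talg V).
Local Notation T' := (talg V').
Local Notation tone := (tone V).
Local Notation E := (boson (tensor_alg M sigma)).
Local Notation E' := (boson (tensor_alg M' sigma)).
Local Notation smE := (boson_smash hA hM sigma2).
Local Notation smE' := (boson_smash hH hM' sigma2).
Variable P : E' -> E -> k.
Hypothesis spP : smash_pairing p e smE smE' P.
Let algA := hopf_alg hA.
Let coalgA := hopf_coalg hA.
Let bM := crossed_act hM.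
Let bP : @bl k (tensor H T') (tensor A T) k^o P := sp_bl spP.
Let bp := sp_p spP.
Let be := sp_e spP.
Let ltc (X : lmodType k) (f : X -> T) :
  lin f -> lin (fun x => tcomul M sigma (f x)).
Proof. exact: (lin_tcomul hA hM). Qed.
Let lcoact (X : lmodType k) (f : X -> T) :
  lin f -> lin (fun x => tlift (wcoact M) (f x)).
Proof. exact: (lin_tcoact hA hM). Qed.
Let lcounit (X : lmodType k) (f : X -> T) :
  lin f -> lin (fun x => tcounit (f x) : k^o).
Proof. exact: lin_tcounit. Qed.
Let lgrade (X : lmodType k) i (f : X -> T) :
  lin f -> lin (fun x => tgrade i (f x)).
Proof. exact: lin_tgrade. Qed.
Let lactl (X : lmodType k) a (f : X -> T) :
  lin f -> lin (fun x => tlift (fun s => wact M s a) (f x)).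
Proof. exact: (lin_tact_l hM). Qed.
Let lactr (X : lmodType k) t (f : X -> A) :
  lin f -> lin (fun x => tlift (fun s => wact M s (f x)) t).
Proof. exact: (lin_tact_r hA hM). Qed.
Hint Resolve ltc lcoact lcounit lgrade lactl lactr : lin.

Definition ev (s : seq V') (x : T) : k := P (bone ⊗ word s) (bone ⊗ x).
Lemma ev_lin s : lin (ev s : T -> k^o).
Proof. by rewrite /ev; lin. Qed.
Let evl := ev_lin.
Lemma lin_ev (X : lmodType k) s (f : X -> T) : lin f -> lin (fun x =>
  ev s (f x) : k^o).
Proof. exact: (lin_comp (evl s)). Qed.
Hint Resolve lin_ev : lin.

Lemma P_tens h s a x : P (h ⊗ word s) (a ⊗ x) = p h a * ev s x.
Proof.
apply: (talg_ext (U := k^o) (f := fun x => P (h ⊗ word s) (a ⊗ x)) (h := fun x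
  => p h a * ev s x)); [lin|lin|] => t.
exact: (sp_d spP).
Qed.

Lemma comul_1tens (U : lmodType k) (f : tensor A T -> tensor A T ->
  U) x : bl f ->
  sw (@bcomul k E (bone ⊗ x)) f = sw (tcomul M sigma x) (fun x1 x2 =>
    sw (tlift (wcoact M) x1) (fun t0 t1 => f (bone ⊗ t0) (t1 ⊗ x2))).
Proof.
move=> bf.
have -> : @bcomul k E (bone ⊗ x) = bos_half M (tcomul M sigma x).
  have lh := bos_half_lin hA hM.
  have lc : lin (@bos_comul k A V M sigma) by exact: (bos_comul_lin hA hM).
  apply: (talg_ext (f := fun x => bos_comul M sigma (bone ⊗ x)) (h := fun x =>
    bos_half M (tcomul M sigma x))); [lin|lin|] => s.
  rewrite (bos_comuld hA hM sigma2) (sw_comul1 hA); last first.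
    by have bb : bl (@bos_LA k A V) by [exact: bos_LA_bl hA _]; lin.
  rewrite -(bos_half_word hA hM sigma2) -[RHS]sw_id; apply: eq_sw => y z.
  have LA1 w : bos_LA bone w = w :> tensor A T by exact: (LA_1 smE).
  by rewrite !LA1.
rewrite /bos_half sw_sw //; apply: eq_sw => x1 x2; rewrite sw_sw //.
by apply: eq_sw => t0 t1; swt.
Qed.

Lemma tcounit_coact (U : lmodType k) (f : T -> U) x : lin f ->
  sw (tlift (wcoact M) x) (fun t0 t1 => bcounit t1 *: f t0) = f x.
Proof.
move=> lf; move: x; apply: talg_ext; [lin|lin|] => t.
rewrite (tcoact_word hA hM) -[in RHS](wcoact_counit hA hM) sw_lin //.
by apply: eq_sw => t0 t1; rewrite linZ.
Qed.

(** Inherited from the counit axiom of A # TV by contracting A with its counit; the coaction that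
    separates the two coproducts disappears under this contraction. *)
Lemma tcomul_counitr x : sw (tcomul M sigma x) (fun x1 x2 =>
  tcounit x2 *: x1) = x.
Proof.
pose F (z : tensor A T) : T := sw z (fun a t => bcounit a *: t).
have lF : lin F by rewrite /F; lin.
have F1 t : F (bone ⊗ t) = t by rewrite /F; swt; rewrite (counit1 hA) scale1r.
have cE a t : @bcounit k E (a ⊗ t) = bcounit a * tcounit t.
  by change (bos_counit (a ⊗ t) = bcounit a * tcounit t); rewrite /bos_counit;
    swt.
have lce : lin (@bos_counit k A V : _ -> k^o) by exact: bos_counit_lin hA _.
have := congr1 F (smash_counr smE (bone ⊗ x)); rewrite F1 => {2}<-.
rewrite (comul_1tens (f := fun z1 z2 => @bos_counit k A V z2 *: z1));
  last by lin.
rewrite sw_lin //; apply: eq_sw => x1 x2.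
rewrite sw_lin //; transitivity (sw (tlift (wcoact M) x1) (fun t0 t1 =>
  bcounit t1 *: (tcounit x2 *: t0))).
  by rewrite (tcounit_coact (f := fun t => tcounit x2 *: t)) //; lin.
apply: eq_sw => t0 t1; rewrite (linZ _ _ lF) F1 scalerA.
by congr (_ *: _); exact: esym (cE t1 x2).
Qed.

Lemma ev_nil x : ev [::] x = tcounit x.
Proof.
apply: (talg_ext (U := k^o) (f := ev [::]) (h := fun x => tcounit x));
  [exact: evl|lin|] => s.
rewrite /ev -[@tens _ H T' _ _]/(bone : E') (sp_1l spP).
by rewrite (sm_counitd smE) (counit1 hA) mul1r tcounit_word.
Qed.

(** In A # TV one has [(1 ⊗ x)(a ⊗ 1) = a_1 ⊗ (x ◁ a_2)], and pairing with [1 ⊗ s] contracts [a_1]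
    to its counit. This lemma, [ev_mul], [ev_coact] and [ev_comul] express the operations of TV
    through P, so that an x in the radical makes them vanish. *)
Lemma ev_act s x a : ev s (tlift (fun s => wact M s a) x) =
  sw (bcomul (bone ⊗ word s : E')) (fun y1 y2 => P y1 (bone ⊗ x) * P y2 (a ⊗
    tone) : k^o).
Proof.
rewrite -(sp_mulr spP).
change (@bmul k E) with (bos_mul (V := V) M).
rewrite /bos_mul; swt; swt.
rewrite (bl_swr bP).
transitivity (sw (bcomul a) (fun b1 b2 => bcounit b1 *: (ev s (tlift (fun s =>
  wact M s b2) x) : k^o))).
  by rewrite (counl coalgA (f := fun b => ev s (tlift (fun s =>
    wact M s b) x) : k^o)) //; lin.
apply: eq_swk => b1 b2.
by rewrite (bmul1_ hA) P_tens tmulx1 (sp_p1l spP).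
Qed.

Lemma ev_mul s x y : ev s (tmul x y) =
  sw (bcomul (bone ⊗ word s : E')) (fun y1 y2 => P y1 (bone ⊗ x) * P y2 (bone ⊗
    y) : k^o).
Proof.
rewrite -(sp_mulr spP) /ev; congr (P _ _).
have bm := bos_mul_bl hA hM.
apply: (talg_ext (f := fun x => bone ⊗ tmul x y) (h := fun x =>
  bos_mul M (bone ⊗ x) (bone ⊗ y))); [lin|lin|] => t.
rewrite (bos_muld hA hM) (LA_1 smE).
elim: t => [|v t IH] /=; first by rewrite tmul1x.
rewrite -IH /bos_LV; swt; rewrite (sw_comul1 hA); last by lin.
by rewrite (act1 hM) tmulA tmul_word.
Qed.

(** The coproduct of [1 ⊗ x] in A # TV contains the coaction of its first braided factor. Pairing
    the second leg with [h ⊗ 1] sees the second braided factor only through its counit, and the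
    coaction of x itself is left. *)
Lemma ev_coact s h x : sw (tlift (wcoact M) x) (fun x0 x1 =>
  ev s x0 * p h x1 : k^o) =
  P (bmul (bone ⊗ word s : E') (h ⊗ word [::])) (bone ⊗ x).
Proof.
rewrite (sp_mul spP) comul_1tens; last by lin.
transitivity (sw (tcomul M sigma x) (fun x1 x2 => tcounit x2 *:
   sw (tlift (wcoact M) x1) (fun x0 x1 => ev s x0 * p h x1 : k^o))).
  rewrite -[in LHS](tcomul_counitr x).
  rewrite (sw_lin (X := k^o) (L := fun x => sw (tlift (wcoact M) x) (fun x0 x1
    => ev s x0 * p h x1 : k^o))); last by lin.
  apply: eq_sw => x1 x2.
  rewrite (linZ (W := k^o) (f := fun x => sw (tlift (wcoact M) x) (fun x0 x1 =>
    ev s x0 * p h x1 : k^o))) //; lin.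
apply: eq_sw => x1 x2; rewrite -sw_scale; apply: eq_sw => t0 t1.
rewrite -/(ev s t0) P_tens ev_nil; change (tcounit x2 * (ev s t0 * p h t1) =
  ev s t0 * (p h t1 * tcounit x2)).
by rewrite mulrC mulrA.
Qed.

Lemma ev_comul s s' x : sw (tcomul M sigma x) (fun x1 x2 =>
  ev s x1 * ev s' x2 : k^o) =
  P (bmul (bone ⊗ word s : E') (bone ⊗ word s')) (bone ⊗ x).
Proof.
rewrite (sp_mul spP) comul_1tens; last by lin.
apply: eq_sw => x1 x2.
rewrite -(tcounit_coact (f := fun x => ev s x * ev s' x2 : k^o)); last by lin.
apply: eq_sw => t0 t1; rewrite -/(ev s t0) P_tens (sp_p1l spP).
by change (bcounit t1 * (ev s t0 * ev s' x2) = ev s t0 * (bcounit t1 * ev s'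
  x2)); rewrite mulrCA.
Qed.

Lemma ev_cons phi s x :
  ev (phi :: s) x = sw (tcomul M sigma x) (fun x1 x2 =>
    e phi (dg1 x1) * ev s x2 : k^o).
Proof.
have ldg (X : lmodType k) (f : X -> T) : lin f -> lin (fun x => dg1 (f x)).
  exact: lin_dg1.
have E1 := smash_d1 smE' (phi :: s); have E2 := smash_d1 smE' s.
rewrite /ev [bone ⊗ word (phi :: s)]E1 /= -E2 (sp_LVl spP).
have ldg' : @lin k (tensor A T) V (sm_dg smE) by exact: (dg_lin smE).
rewrite comul_1tens; last by lin.
have dgE t : sm_dg smE (bone ⊗ t) = dg1 t.
  apply: (@talg_ext k V V (fun t => sm_dg smE (bone ⊗ t)) (@dg1 k V)) t =>
    [||u]; [|exact: (ldg _ _ (@lin_id k T))|].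
    by change (lin (fun t : T => sm_dg smE (bone ⊗ t : tensor A T))); lin.
  by rewrite (dg_d smE) (counit1 hA) scale1r dg1_word.
apply: eq_swk => x1 x2.
rewrite -(tcounit_coact (f := fun x => e phi (dg1 x) * P (bone ⊗ word s) (bone
  ⊗ x2) : k^o)); last by lin.
apply: eq_swk => t0 t1; rewrite dgE P_tens (sp_p1l spP).
change (e phi (dg1 t0) * (bcounit t1 * ev s x2) =
  bcounit t1 * (e phi (dg1 t0) * ev s x2)).
by rewrite mulrCA.
Qed.

Lemma ev_evw s x : ev s x = evw M sigma e s x.
Proof.
have ldg (X : lmodType k) (f : X -> T) : lin f -> lin (fun x => dg1 (f x)).
  exact: lin_dg1.
elim: s x => [|phi s IH] x; first by rewrite ev_nil.
have lw : lin (evw M sigma e s : T -> k^o) by exact: (evw_lin hA hM sigma be).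
rewrite ev_cons /= /tder sw_sw; last by lin.
by apply: eq_swk => x1 x2; swt; rewrite IH.
Qed.

Let I := bker M sigma.
Lemma bker_ev x : I x <-> forall s, ev s x = 0.
Proof.
rewrite /I (bker_evw hA hM sigma2 be e_sep).
by split=> Ex s; have := Ex s; rewrite ev_evw.
Qed.

Lemma P_rad_tens a x y : I x -> P y (a ⊗ x) = 0.
Proof.
move=> /bker_ev Ix.
have [r ->] := sm_span smE' y.
rewrite (lin_sum (W := k^o) _ _ _ (bP.1 _)) big1 // => -[h s] _.
by rewrite P_tens Ix mulr0.
Qed.
Lemma bker_act a x : I x -> I (tlift (fun s => wact M s a) x).
Proof.
move=> Ix; apply/bker_ev => s; rewrite ev_act.
by apply: sw_zerok => y1 y2; rewrite P_rad_tens // mul0r.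
Qed.
Lemma bker_mull x y : I x -> I (tmul x y).
Proof.
move=> Ix; apply/bker_ev => s; rewrite ev_mul.
by apply: sw_zerok => y1 y2; rewrite P_rad_tens // mul0r.
Qed.
Lemma bker_mulr x y : I y -> I (tmul x y).
Proof.
move=> Ix; apply/bker_ev => s; rewrite ev_mul.
by apply: sw_zerok => y1 y2; rewrite (P_rad_tens _ _ Ix) mulr0.
Qed.
Lemma bker_grade i x : I x -> I (tgrade i x).
Proof.
move=> Ix; apply/bker_ev => s.
have := sp_g spP i (bone ⊗ word s) (bone ⊗ x).
rewrite P_rad_tens // => /esym.
change (@boson_grade _ _ (tensor_alg M sigma)) with (@bos_grade k A V).
by rewrite /bos_grade; swt.
Qed.
Lemma bker_counit x : I x -> tcounit x = 0.
Proof. by move=> /bker_ev /(_ [::]); rewrite ev_nil. Qed.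

Local Notation Q := (quot I).
Local Notation pi := (qpi I : T -> Q).
Lemma qpi_lin : lin pi. Proof. exact: (qpi_kills I).1. Qed.
Lemma qpi0 x : I x -> pi x = 0. Proof. exact: (qpi_kills I).2. Qed.
Let piT := qpi_lin.
Let lpi (X : lmodType k) (f : X -> T) : lin f -> lin (fun x => pi (f x)).
Proof. exact: (lin_comp piT). Qed.
Lemma lin_qlift (U X : lmodType k) (f : T -> U) (g : X -> Q) :
  kills I f -> lin g -> lin (fun x => qlift f (g x)).
Proof. by move=> kf; apply: lin_comp; exact: (ulift_linear kf). Qed.
Lemma lin_qliftr (U X : lmodType k) (F : X -> T -> U) (q : Q) :
  (forall x, lin (F^~ x)) -> lin (fun x => qlift (F x) q).
Proof.
move=> lF; rewrite /qlift /ulift /feval; apply: lin_big => r.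
by apply: lin_scaler.
Qed.
Lemma qpi_surj (q : Q) : exists x, q = pi x.
Proof.
have [r ->] : exists r : seq (k * T), q = \sum_(c <- r) c.1 *: pi c.2.
  by exists (repr q); exact: umod_genE.
exists (\sum_(c <- r) c.1 *: c.2); rewrite (lin_sum _ _ _ piT).
by apply: eq_bigr => c _; rewrite (linZ _ _ piT).
Qed.

Lemma ev_kills s : kills I (ev s : T -> k^o).
Proof. by split; [exact: evl|move=> x /bker_ev]. Qed.
Definition qev s : Q -> k := @qlift k T I k^o (ev s).
Lemma qev_lin s : lin (qev s : Q -> k^o).
Proof. exact: (lin_qlift (ev_kills s) (@lin_id k Q)). Qed.
Lemma qev_pi s x : qev s (pi x) = ev s x.
Proof. exact: (qlift_qpi x (ev_kills s)). Qed.
Lemma qev_sep : separating (fun f : Q -> k => exists s, f = qev s).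
Proof.
split=> [_ [s ->]|q Hq]; first exact: qev_lin.
have [x Ex] := qpi_surj q; rewrite Ex; apply: qpi0; apply/bker_ev => s.
by rewrite -qev_pi -Ex; apply: Hq; exists s.
Qed.
Lemma p_sep' : separating (fun f : A -> k => exists h, f = p h).
Proof.
split=> [_ [h ->]|a Ha]; first exact: bp.2.
by apply: p_sep => h; apply: Ha; exists h.
Qed.
Hint Resolve lpi : lin.

Lemma act_kills a : kills I (fun x : T => pi (tlift (fun s => wact M s a) x)).
Proof. by split=> [|x Ix]; [change (lin (fun x : T => pi (tlift (fun s =>
  wact M s a) x))); lin|apply: qpi0; exact: bker_act]. Qed.
Lemma mulr_kills x : kills I (fun y : T => pi (tmul x y)).
Proof. by split=> [|y Iy]; [change (lin (fun y : T => pi (tmul x y)));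
  lin|apply: qpi0; exact: bker_mulr]. Qed.
Lemma mull_kills q : kills I (fun x : T => @qlift k T I Q (fun y : T =>
  pi (tmul x y)) q).
Proof.
split=> [|x Ix].
  change (lin (fun x : T => @qlift k T I Q (fun y : T => pi (tmul x y)) q)).
  by apply: lin_qliftr => y; lin.
have [y ->] := qpi_surj q; rewrite (qlift_qpi _ (mulr_kills x)).
by apply: qpi0; exact: bker_mull.
Qed.
Lemma grade_kills i : kills I (fun x : T => pi (tgrade i x)).
Proof. by split=> [|x Ix]; [change (lin (fun x : T => pi (tgrade i x)));
  lin|apply: qpi0; exact: bker_grade]. Qed.
Lemma counit_kills : kills I (fun x : T => tcounit x : k^o).
Proof. by split=> [|x Ix]; [change (lin (fun x : T => tcounit x : k^o));
  lin|exact: bker_counit]. Qed.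
(** Vanishing in the tensor product of Q and A is tested on the functionals [qev s ⊗ p h]. Their
    values are pairings of x with [(1 ⊗ s)(h ⊗ 1)], zero for x in the radical. [comul_kills] is
    analogous, with [(1 ⊗ s)(1 ⊗ s')]. *)
Lemma coact_kills :
  kills I (fun x : T => sw (tlift (wcoact M) x) (fun x0 x1 => pi x0 ⊗ x1)).
Proof.
split=> [|x Ix].
  by change (lin (fun x : T => sw (tlift (wcoact M) x) (fun x0 x1 =>
    pi x0 ⊗ x1))); lin.
apply: (tensor_sep qev_sep p_sep') => _ _ [s ->] [h ->].
have lq := qev_lin s; rewrite sw_sw; last by lin.
transitivity (sw (tlift (wcoact M) x) (fun x0 x1 => ev s x0 * p h x1 : k^o)).
  by apply: eq_sw => x0 x1; swt; rewrite qev_pi.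
by rewrite ev_coact P_rad_tens.
Qed.
Lemma comul_kills :
  kills I (fun x : T => sw (tcomul M sigma x) (fun x1 x2 => pi x1 ⊗ pi x2)).
Proof.
split=> [|x Ix].
  by change (lin (fun x : T => sw (tcomul M sigma x) (fun x1 x2 =>
    pi x1 ⊗ pi x2))); lin.
apply: (tensor_sep qev_sep qev_sep) => _ _ [s ->] [s' ->].
have lq := qev_lin s; have lq' := qev_lin s'; rewrite sw_sw; last by lin.
transitivity (sw (tcomul M sigma x) (fun x1 x2 => ev s x1 * ev s' x2 : k^o)).
  by apply: eq_sw => x0 x1; swt; rewrite !qev_pi.
by rewrite ev_comul P_rad_tens.
Qed.

Definition bos_pi (z : tensor A T) : tensor A Q := sw z (fun a x => a ⊗ pi x).
Lemma bos_pi_lin : lin bos_pi. Proof. by rewrite /bos_pi; lin. Qed.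
Lemma bos_pi_tens a x : bos_pi (a ⊗ x) = a ⊗ pi x.
Proof. by rewrite /bos_pi; swt. Qed.
Lemma bos_pi_surj z : exists x, z = bos_pi x.
Proof.
have [r ->] := tensor_sum z; have lb := bos_pi_lin.
elim: r => [|[a q] r [x Ex]]; first by exists 0; rewrite big_nil (lin0 lb).
have [y Ey] := qpi_surj q; exists (a ⊗ y + x).
by rewrite big_cons (linD lb) bos_pi_tens /= Ey Ex.
Qed.

(** Pairing with [h ⊗ s] factors through [bos_pi] as [p h ⊗ qev s], and these functionals separate
    the quotient. This is at once well-definedness and nondegeneracy of the induced pairing. *)
Lemma bos_pi_rad z : bos_pi z = 0 <-> forall y, P y z = 0.
Proof.
have key h s w : P (h ⊗ word s) w = sw (bos_pi w) (fun a q =>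
  p h a * qev s q : k^o).
  have lq := qev_lin s; have lb := bos_pi_lin.
  apply: (tensor_ext (U := k^o) (f := fun w => P (h ⊗ word s) w) (g := fun w =>
    sw (bos_pi w) (fun a q => p h a * qev s q : k^o))); [lin|lin|] => a x.
  by rewrite bos_pi_tens P_tens; swt; rewrite qev_pi.
split=> [E0 y|rad].
  have [r ->] := sm_span smE' y.
  rewrite (lin_sum (W := k^o) _ _ _ (bP.1 _)) big1 // => -[h s] _.
  by rewrite key E0 sw_0 //; have lq := qev_lin s; lin.
apply: (tensor_sep p_sep' qev_sep) => _ _ [h ->] [s ->].
by rewrite -key.
Qed.

Let bpl := bos_pi_lin.
Let bm := bos_mul_bl hA hM.

(** Named copies of the induced maps in [braided_quot], convertible to them; linearity and the value
    on classes are recorded for each one. *)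
Definition Qmul (x y : Q) : Q :=
  @qlift k T I Q (fun x' => @qlift k T I Q (fun y' => pi (tmul x' y')) y) x.
Definition Qact (x : Q) (a : A) : Q :=
  @qlift k T I Q (fun x' => pi (tlift (fun s => wact M s a) x')) x.
Definition Qcoact (x : Q) : tensor Q A :=
  @qlift k T I _ (fun x' => sw (tlift (wcoact M) x') (fun x0 x1 =>
    pi x0 ⊗ x1)) x.
Definition Qcomul (x : Q) : tensor Q Q :=
  @qlift k T I _ (fun x' => sw (tcomul M sigma x') (fun x1 x2 =>
    pi x1 ⊗ pi x2)) x.
Definition Qcounit (x : Q) : k := @qlift k T I k^o (fun x' => tcounit x') x.
Definition Qgrade i (x : Q) : Q := @qlift k T I Q (fun x' =>
  pi (tgrade i x')) x.

Lemma Qmul_bl : bl Qmul.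
Proof.
split=> q; first exact: (lin_qlift (mull_kills q) (@lin_id k Q)).
apply: lin_qliftr => x; exact: (lin_qlift (mulr_kills x) (@lin_id k Q)).
Qed.
Lemma Qact_bl : bl Qact.
Proof.
split=> q; first exact: (lin_qlift (act_kills q) (@lin_id k Q)).
by apply: lin_qliftr => x; lin.
Qed.
Lemma Qcoact_lin : lin Qcoact.
Proof. exact: (lin_qlift coact_kills (@lin_id k Q)). Qed.
Lemma Qcomul_lin : lin Qcomul.
Proof. exact: (lin_qlift comul_kills (@lin_id k Q)). Qed.
Lemma Qcounit_lin : lin (Qcounit : Q -> k^o).
Proof. exact: (lin_qlift counit_kills (@lin_id k Q)). Qed.
Lemma Qgrade_lin i : lin (Qgrade i).
Proof. exact: (lin_qlift (grade_kills i) (@lin_id k Q)). Qed.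
Lemma Qmul_pi x y : Qmul (pi x) (pi y) = pi (tmul x y).
Proof.
by rewrite /Qmul (qlift_qpi _ (mull_kills _)) (qlift_qpi _ (mulr_kills _)).
Qed.
Lemma Qact_pi x a : Qact (pi x) a = pi (tlift (fun s => wact M s a) x).
Proof. exact: (qlift_qpi _ (act_kills a)). Qed.
Lemma Qcoact_pi x : Qcoact (pi x) = sw (tlift (wcoact M) x) (fun x0 x1 =>
  pi x0 ⊗ x1).
Proof. exact: (qlift_qpi _ coact_kills). Qed.
Lemma Qcomul_pi x : Qcomul (pi x) = sw (tcomul M sigma x) (fun x1 x2 =>
  pi x1 ⊗ pi x2).
Proof. exact: (qlift_qpi _ comul_kills). Qed.
Lemma Qcounit_pi x : Qcounit (pi x) = tcounit x.
Proof. exact: (qlift_qpi _ counit_kills). Qed.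
Lemma Qgrade_pi i x : Qgrade i (pi x) = pi (tgrade i x).
Proof. exact: (qlift_qpi _ (grade_kills i)). Qed.
Let Qmulb := Qmul_bl.
Let Qactb := Qact_bl.
Let Qcoactl := Qcoact_lin.
Let Qcomull := Qcomul_lin.
Let Qcounitl := Qcounit_lin.
Let Qgradel := Qgrade_lin.

Local Notation B := (boson (nichols M sigma)).

Definition Nmul (x y : tensor A Q) : tensor A Q :=
  sw x (fun a eta => sw y (fun b zeta => sw (bcomul b) (fun b1 b2 =>
         bmul a b1 ⊗ Qmul (Qact eta b2) zeta))).
Definition Ncomul (x : tensor A Q) : tensor (tensor A Q) (tensor A Q) :=
  sw x (fun a eta => sw (bcomul a) (fun a1 a2 =>
    sw (Qcomul eta) (fun eta1 eta2 => sw (Qcoact eta1)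
      (fun eta10 eta11 => (a1 ⊗ eta10) ⊗ (bmul a2 eta11 ⊗ eta2))))).
Definition Ncounit (x : tensor A Q) : k :=
  sw x (fun a eta => (bcounit a * Qcounit eta : k^o)).
Definition Ngrade i (x : tensor A Q) : tensor A Q :=
  sw x (fun a eta => a ⊗ Qgrade i eta).
Lemma Nmul_bl : bl Nmul. Proof. by rewrite /Nmul; lin. Qed.
Lemma Ncomul_lin : lin Ncomul. Proof. by rewrite /Ncomul; lin. Qed.
Lemma Ncounit_lin : lin (Ncounit : _ -> k^o). Proof. by rewrite /Ncounit;
  lin. Qed.
Lemma Ngrade_lin i : lin (Ngrade i).
Proof. by have l := Qgradel i; rewrite /Ngrade; lin. Qed.
Let Nmulb := Nmul_bl.
Let Ncomull := Ncomul_lin.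
Let Ncounitl := Ncounit_lin.

Lemma bos_pi_mul x y : @bmul k B (bos_pi x) (bos_pi y) = bos_pi (@bmul k E x y).
Proof.
change (Nmul (bos_pi x) (bos_pi y) = bos_pi (bos_mul M x y)).
move: x; apply: tensor_ext; [lin|lin|] => a s.
move: y; apply: tensor_ext; [lin|lin|] => b t.
rewrite !bos_pi_tens /Nmul /bos_mul; do !swt.
rewrite (sw_lin (L := bos_pi)) //; apply: eq_sw => b1 b2.
by rewrite bos_pi_tens Qact_pi Qmul_pi.
Qed.
Lemma bos_pi_comul x :
  @bcomul k B (bos_pi x) = sw (@bcomul k E x) (fun x1 x2 =>
    bos_pi x1 ⊗ bos_pi x2).
Proof.
have lc := bos_comul_lin hA hM sigma.
change (Ncomul (bos_pi x) = sw (bos_comul M sigma x) (fun x1 x2 =>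
  bos_pi x1 ⊗ bos_pi x2)).
move: x; apply: tensor_ext; [lin|lin|] => a s.
rewrite bos_pi_tens /Ncomul /bos_comul; do !swt.
rewrite [RHS]sw_sw; last by lin.
apply: eq_sw => a1 a2; rewrite [RHS]sw_sw; last by lin.
rewrite Qcomul_pi sw_sw; last by lin.
apply: eq_sw => s1 s2; rewrite [RHS]sw_sw; last by lin.
swt; rewrite Qcoact_pi sw_sw; last by lin.
by apply: eq_sw => t0 t1; do !swt; rewrite !bos_pi_tens.
Qed.
Lemma bos_pi_counit x : @bcounit k B (bos_pi x) = @bcounit k E x.
Proof.
have lc : lin (@bos_counit k A V : _ -> k^o) by exact: bos_counit_lin hA _.
change (Ncounit (bos_pi x) = bos_counit x).
apply: (tensor_ext (U := k^o) (f := fun x => Ncounit (bos_pi x)) (g := fun x =>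
  bos_counit x)); [lin|lin|] => a s.
by rewrite bos_pi_tens /Ncounit /bos_counit; do !swt; rewrite Qcounit_pi.
Qed.
Lemma bos_pi_grade i x : @boson_grade _ _ (nichols M sigma) i (bos_pi x) =
  bos_pi (@boson_grade _ _ (tensor_alg M sigma) i x).
Proof.
have lg : lin (@bos_grade k A V i) by exact: bos_grade_lin.
have lN := Ngrade_lin i; have lQ := Qgradel i.
change (Ngrade i (bos_pi x) = bos_pi (bos_grade i x)).
move: x; apply: tensor_ext; [lin|lin|] => a s.
rewrite bos_pi_tens /Ngrade /bos_grade; do !swt.
by rewrite bos_pi_tens Qgrade_pi.
Qed.
End Radical.

(** * Transfer of the Hopf axioms along a surjection *)

Section Transport.
Variables (k : fieldType) (D1 D2 : bialgData k) (f : D1 -> D2).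
Hypothesis fl : lin f.
Hypothesis fs : forall y, exists x, y = f x.
Hypothesis fM : forall x y, bmul (f x) (f y) = f (bmul x y).
Hypothesis f1 : f bone = bone.
Hypothesis fD : forall x, bcomul (f x) = sw (bcomul x) (fun x1 x2 =>
  f x1 ⊗ f x2).
Hypothesis fe : forall x, bcounit (f x) = bcounit x.

Lemma sw_push (U : lmodType k) (h : D2 -> D2 -> U) x : bl h ->
  sw (bcomul (f x)) h = sw (bcomul x) (fun x1 x2 => h (f x1) (f x2)).
Proof. by move=> bh; rewrite fD sw_sw //; apply: eq_sw => x1 x2; swt. Qed.

Variables (sigma : k) (g1 : bool -> D1 -> D1) (g2 : bool -> D2 -> D2).
Variables (S1 : D1 -> D1) (S2 : D2 -> D2).
Hypothesis fg : forall i x, g2 i (f x) = f (g1 i x).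
Hypothesis fS : forall x, S2 (f x) = f (S1 x).

Lemma transport_lin (U : lmodType k) (h : D2 -> U) : lin (fun x =>
  h (f x)) -> lin h.
Proof.
move=> lh a x y; have [x' ->] := fs x; have [y' ->] := fs y.
by rewrite -(linZ _ _ fl) -(linD fl) lh.
Qed.

(** Each axiom is an identity between elements obtained from arguments of D2; lifting these along
    [f] turns it into the image of the same axiom in D1. Linearity of the operations of D2 is
    obtained in the same way, by [transport_lin]. *)
Lemma transport_sig_hopf : sig_hopf sigma g1 S1 -> sig_hopf sigma g2 S2.
Proof.
case=> -[[bm mA m1l m1r] [lc le cA cl cr]] [gl gD gg] [gM g1_ gc ge gS] [c1 e1
  eM cM] [Sl SL SR].
have bmb : bl (@bmul k D1) := bilin_bl bm.
have bm2 : bl (@bmul k D2).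
  split=> x; have [x' ->] := fs x; apply: transport_lin.
    have -> : (fun y => bmul (f y) (f x')) = (fun y => f (bmul y x')) by
      apply: funext => y; exact: fM.
    by lin.
  have -> : (fun y => bmul (f x') (f y)) = (fun y => f (bmul x' y)) by
    apply: funext => y; exact: fM.
  by lin.
have lg1 i : lin (g1 i) by exact: gl.
have lg2 i : lin (g2 i).
  apply: transport_lin; have -> : (fun x => g2 i (f x)) = (fun x =>
    f (g1 i x)) by apply: funext => y; exact: fg.
  by have := lg1 i => ?; lin.
have lS2 : lin S2.
  apply: transport_lin; have -> : (fun x => S2 (f x)) = (fun x =>
    f (S1 x)) by apply: funext => y; exact: fS.
  by lin.
have lc2 : lin (@bcomul k D2).
  apply: transport_lin; have -> : (fun x => bcomul (f x)) = (fun x =>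
    sw (bcomul x) (fun x1 x2 => f x1 ⊗ f x2)) by apply: funext => y; exact: fD.
  by lin.
have le2 : lin (@bcounit k D2 : D2 -> k^o).
  apply: transport_lin; have -> : (fun x => bcounit (f x) : k^o) = (fun x =>
    bcounit x) by apply: funext => y; exact: fe.
  exact: le.
have alg2 : is_algebra D2.
  split=> [|x y z|x|x].
  - exact: bl_bilin.
  - have [x' ->] := fs x; have [y' ->] := fs y; have [z' ->] := fs z.
    by rewrite !fM mA.
  - by have [x' ->] := fs x; rewrite -f1 fM m1l.
  by have [x' ->] := fs x; rewrite -f1 fM m1r.
split.
- split=> //; split=> // x; have [x' ->] := fs x.
  + rewrite sw_push; last by lin.
    under eq_sw => x1 x2. rewrite sw_push; last by lin. over.
    rewrite coass //; last by lin.
    rewrite [RHS]sw_push; last by lin.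
    apply: eq_sw => x1 x2; rewrite [RHS]sw_push //; lin.
  + rewrite sw_push; last by lin.
    rewrite -[in RHS](cl x') sw_lin //; apply: eq_sw => x1 x2.
    by rewrite fe (linZ _ _ fl).
  rewrite sw_push; last by lin.
  rewrite -[in RHS](cr x') sw_lin //; apply: eq_sw => x1 x2.
  by rewrite fe (linZ _ _ fl).
- split=> [i|x|i j x]; first exact: lg2.
    by have [x' ->] := fs x; rewrite !fg -(linD fl) gD.
  have [x' ->] := fs x; rewrite !fg gg; case: eqP => // _; exact: (lin0 fl).
- split=> [i j x y||i x|x|i x].
  + have [x' ->] := fs x; have [y' ->] := fs y.
    by rewrite !fg !fM !fg gM.
  + by rewrite -f1 fg g1_.
  + have [x' ->] := fs x; rewrite fg fD gc.
    rewrite sw_arg_sum; last by lin.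
    apply: eq_bigr => j _; rewrite sw_sw; last by lin.
    rewrite sw_push; last by lin.
    by apply: eq_sw => x1 x2; swt; rewrite !fg.
  + by have [x' ->] := fs x; rewrite fg fe ge.
  by have [x' ->] := fs x; rewrite fg !fS fg gS.
- split=> [|||x y].
  + by rewrite -f1 fD c1; swt.
  + by rewrite -f1 fe e1.
  + by move=> x y; have [x' ->] := fs x; have [y' ->] := fs y;
    rewrite fM !fe eM.
  have [x' ->] := fs x; have [y' ->] := fs y; rewrite fM fD cM.
  rewrite sw_arg_sum; last by lin.
  apply: eq_bigr => i _; rewrite sw_arg_sum; last by lin.
  apply: eq_bigr => j _; rewrite sw_argZ; last by lin.
  congr (_ *: _); rewrite sw_sw; last by lin.
  rewrite sw_push; last by lin.
  apply: eq_sw => x1 x2; rewrite sw_sw; last by lin.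
  rewrite sw_push; last by lin.
  by apply: eq_sw => y1 y2; swt; rewrite !fg !fM.
split=> // x; have [x' ->] := fs x.
  rewrite sw_push; last by lin.
  under eq_sw => x1 x2 do rewrite fS fM.
  by rewrite -sw_lin // SL (linZ _ _ fl) f1 fe.
rewrite sw_push; last by lin.
under eq_sw => x1 x2 do rewrite fS fM.
by rewrite -sw_lin // SR (linZ _ _ fl) f1 fe.
Qed.
End Transport.

(** * The main theorem *)

(** With sigma = 1 the double sum over parities has no signs, and the even and odd components add up
    to the elements themselves. *)
Lemma sig_hopf1 (k : fieldType) (D : bialgData k) (g : bool -> D ->
  D) (S : D -> D) :
  sig_hopf 1 g S -> is_hopf S.
Proof.
case=> -[aD cD] [gl gD gg] _ [c1 e1 eM cM] hS; split=> // x y.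
have bm : bl (@bmul k D) by case: aD => b _ _ _; exact: (bilin_bl b).
rewrite cM !big_bool /= !expr1n !scale1r -!sw_add.
apply: eq_sw => x1 x2; rewrite -!sw_add; apply: eq_sw => y1 y2.
rewrite -!tensDl -!(blDr bm) addrC [g true y1 + _]addrC gD.
by rewrite -tensDr -(blDl bm) gD.
Qed.

Section Main.
Variables (k : fieldType) (A H : bialgData k) (SA : A -> A) (SH : H -> H).
Variables (V V' : lmodType k) (M : crossedData A V) (M' : crossedData H V').
Variables (p : H -> A -> k) (e : V' -> V -> k) (sigma : k).
Hypothesis hA : is_hopf SA.
Hypothesis hM : is_crossed SA M.
Hypothesis hH : is_hopf SH.
Hypothesis hM' : is_crossed SH M'.
Hypothesis hp : hopf_pairing SH SA p.
Hypothesis p_nondeg : nondeg_form p.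
Hypothesis adj : mutually_adjoint p e M' M.
Hypothesis e_nondeg : nondeg_form e.
Hypothesis sigma2 : sigma * sigma = 1.

Lemma nichols_boson_pairing :
  exists (S : boson (nichols M sigma) -> boson (nichols M sigma))
         (S' : boson (nichols M' sigma) -> boson (nichols M' sigma))
         (P : boson (nichols M' sigma) -> boson (nichols M sigma) -> k),
    [/\ sig_hopf sigma (@boson_grade _ _ (nichols M sigma)) S,
        sig_hopf sigma (@boson_grade _ _ (nichols M' sigma)) S',
        super_hopf_pairing (@boson_grade _ _ (nichols M' sigma))
          (@boson_grade _ _ (nichols M sigma)) S' S P,
        nondeg_form P
      & extends_pairings p e P].
Proof.
set smE := boson_smash hA hM sigma2; set smE' := boson_smash hH hM' sigma2.
have [P spP] := smash_pairing_exists hp adj smE smE'.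
have spP' := smash_pairing_sym spP.
have bP := sp_bl spP.
have [S0 hS0 S0g] := smash_antipode smE.
have [S0' hS0' S0g'] := smash_antipode smE'.
have shE := smash_sig_hopf smE hS0 S0g.
have shE' := smash_sig_hopf smE' hS0' S0g'.
case: p_nondeg => p_nd p_nd'; case: e_nondeg => e_nd e_nd'.
have rad := bos_pi_rad p_nd' e_nd' spP.
(* The radical on the other side, from the exchanged pairing: separation of H and of V' are the
   other halves of the two nondegeneracy hypotheses. *)
have rad' := bos_pi_rad p_nd e_nd spP'.
pose f : boson (tensor_alg M sigma) -> boson (nichols M sigma) := bos_pi M
  sigma.
pose f' : boson (tensor_alg M' sigma) -> boson (nichols M' sigma) := bos_pi M'
  sigma.
have fl : lin f := bos_pi_lin M sigma.
have fl' : lin f' := bos_pi_lin M' sigma.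
have fs : forall z, exists x, z = f x := @bos_pi_surj _ _ _ M sigma.
have fs' : forall z, exists x, z = f' x := @bos_pi_surj _ _ _ M' sigma.
have fM : forall x y, bmul (f x) (f y) = f (bmul x y) := bos_pi_mul e_nd' spP.
have fM' : forall x y, bmul (f' x) (f' y) = f' (bmul x y) := bos_pi_mul e_nd
  spP'.
have fD : forall x, bcomul (f x) = sw (bcomul x) (fun x1 x2 => f x1 ⊗ f x2) :=
  bos_pi_comul p_nd' e_nd' spP.
have fD' : forall x, bcomul (f' x) = sw (bcomul x) (fun x1 x2 =>
  f' x1 ⊗ f' x2) :=
  bos_pi_comul p_nd e_nd spP'.
have fe : forall x, bcounit (f x) = bcounit x := bos_pi_counit e_nd' spP.
have fe' : forall x, bcounit (f' x) = bcounit x := bos_pi_counit e_nd spP'.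
have fg : forall i x, boson_grade i (f x) = f (boson_grade i x) :=
  bos_pi_grade e_nd' spP.
have fg' : forall i x, boson_grade i (f' x) = f' (boson_grade i x) :=
  bos_pi_grade e_nd spP'.
have f1 : f bone = bone by exact: bos_pi_tens.
have f1' : f' bone = bone by exact: bos_pi_tens.
(* The antipodes and the pairing on the quotients are defined through arbitrarily chosen preimages.
   The choice has no effect, since by [rad] and [rad'] two preimages of one element differ by an
   element of the radical. *)
have [pre preK] := choice fs; have [pre' preK'] := choice fs'.
have adjS := sp_antipode spP hS0 hS0'.
have eq0 x z : f x = f z -> forall y, P y x = P y z.
  move=> E y; apply/eqP; rewrite -subr_eq0 -(linN (W := k^o) _ (bP.2 y)) -(linD
    (W := k^o) (bP.2 y)).
  by apply/eqP; apply: (rad _).1; rewrite -/(f _) (linD fl) (linN _ fl) E subrr.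
have eq0' x z : f' x = f' z -> forall y, P x y = P z y.
  move=> E y; apply/eqP; rewrite -subr_eq0 -(linN (W := k^o) _ (bP.1 y)) -(linD
    (W := k^o) (bP.1 y)).
  by apply/eqP; apply: (rad' _).1; rewrite -/(f' _) (linD fl') (linN _ fl') E
    subrr.
have eqf x z : (forall y, P y x = P y z) -> f x = f z.
  move=> E; apply/eqP; rewrite -subr_eq0 -(linN _ fl) -(linD fl); apply/eqP.
  apply: (rad _).2 => y.
  by rewrite (linD (W := k^o) (bP.2 y)) (linN (W := k^o) _ (bP.2 y)) E subrr.
have eqf' x z : (forall y, P x y = P z y) -> f' x = f' z.
  move=> E; apply/eqP; rewrite -subr_eq0 -(linN _ fl') -(linD fl'); apply/eqP.
  apply: (rad' _).2 => y.
  by rewrite (linD (W := k^o) (bP.1 y)) (linN (W := k^o) _ (bP.1 y)) E subrr.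
pose S z := f (S0 (pre z)); pose S' z := f' (S0' (pre' z)).
pose Q y z := P (pre' y) (pre z).
have QE y z : Q (f' y) (f z) = P y z.
  by rewrite /Q (eq0 _ z) ?(eq0' _ y) -?preK -?preK'.
(* The antipode descends because it is adjoint to the one on the other side: by [adjS], [P y (S0 x)]
   depends only on the class of x. *)
have fS x : S (f x) = f (S0 x).
  by apply: eqf => y; rewrite -!adjS; apply: eq0; rewrite -preK.
have fS' x : S' (f' x) = f' (S0' x).
  by apply: eqf' => y; rewrite !adjS; apply: eq0'; rewrite -preK'.
have bQ : bl (Q : _ -> _ -> k^o).
  split=> y.
    have [z ->] := fs y; move=> c x1 x2; have [y1 ->] := fs' x1;
      have [y2 ->] := fs' x2.
    by rewrite -(linZ _ _ fl') -(linD fl') !QE (bP.1 z).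
  have [z ->] := fs' y; move=> c x1 x2; have [y1 ->] := fs x1;
    have [y2 ->] := fs x2.
  by rewrite -(linZ _ _ fl) -(linD fl) !QE (bP.2 z).
exists S, S', Q; split.
- exact: (transport_sig_hopf fl fs fM f1 fD fe fg fS shE).
- exact: (transport_sig_hopf fl' fs' fM' f1' fD' fe' fg' fS' shE').
- split; first split.
  + exact: (bl_bilin bQ).
  + move=> h h' a; have [x ->] := fs' h; have [x' ->] := fs' h';
    have [z ->] := fs a.
    rewrite fM' QE (sp_mul spP) (sw_push fD); last by lin.
    by apply: eq_swk => z1 z2; rewrite !QE.
  + move=> h a a'; have [x ->] := fs' h; have [z ->] := fs a;
    have [z' ->] := fs a'.
    rewrite fM QE (sp_mulr spP) (sw_push fD'); last by lin.
    by apply: eq_swk => z1 z2; rewrite !QE.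
  + split=> [a|h].
      by have [z ->] := fs a; rewrite -f1' QE fe (sp_1l spP).
    by have [z ->] := fs' h; rewrite -f1 QE fe' (sp_1r spP).
  + move=> h a; have [x ->] := fs' h; have [z ->] := fs a.
    by rewrite fS fS' !QE adjS.
  move=> i j h a ne; have [x ->] := fs' h; have [z ->] := fs a.
  rewrite fg fg' QE (sp_g spP) (g_g smE) (negPf ne); exact: (lin0 (bP.2 x)).
- split=> [y H0|z H0].
    have [x E] := fs' y; rewrite E -(lin0 fl'); apply: eqf' => z.
    by rewrite (lin0 (bP.1 z)) -QE -E H0.
  have [x E] := fs z; rewrite E -(lin0 fl); apply: eqf => y.
  by rewrite (lin0 (bP.2 y)) -QE -E H0.
split=> [h a|phi v].
  have -> : h ⊗ bone = f' (h ⊗ word [::]) by rewrite /f' bos_pi_tens.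
  have -> : a ⊗ bone = f (a ⊗ word [::]) by rewrite /f bos_pi_tens.
  by rewrite QE (P_tens spP) (ev_nil spP) tcounit_word mulr1.
have -> : bone ⊗ nichols_gen M' sigma phi = f' (bone ⊗ word [:: phi]).
  by rewrite /f' bos_pi_tens.
have -> : bone ⊗ nichols_gen M sigma v = f (bone ⊗ word [:: v]).
  by rewrite /f bos_pi_tens.
have be := sp_e spP.
have lc : lin (@tcounit k V : _ -> k^o) by exact: (lin_tcounit (@lin_id k (talg
  V))).
(* In degree one the braided integer is the identity, so [tder] of the letter v is [v ⊗ 1] and the
   value is [e phi v]. *)
rewrite QE -/(ev P [:: phi] (word [:: v])) (ev_evw spP) /= (tder_cons hA hM
  sigma2).
rewrite (tder1 hA hM) /pushl sw_0; last first.
  have bM := crossed_act hM; have lM := crossed_coact hM.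
  have bt := tmul_bl V; lin.
rewrite scaler0 addr0; swt.
by rewrite tcounit_word mulr1.
Qed.
End Main.

Lemma dual_nondeg (k : fieldType) (V : vectType k) :
  nondeg_form (fun (phi : 'Hom(V, k^o)) (v : V) => phi v).
Proof.
split=> [phi phi0|v v0].
  by apply/lfunP => v; rewrite zero_lfunE phi0.
(* The coordinates of v in a basis are values of linear forms on v, hence all zero. *)
rewrite (coord_vbasis (memvf v)) big1 // => i _.
by have := v0 (@linfun k V k^o (coord (vbasis fullv) i));
  rewrite lfunE /= => ->; rewrite scale0r.
Qed.

Theorem lemma4p10 (k : fieldType) (hk : 2%N \notin [pchar k])
  (A H : bialgData k) (SA : A -> A) (SH : H -> H)
  (hA : is_hopf SA) (hH : is_hopf SH)
  (SA_bij : bijective SA) (SH_bij : bijective SH)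
  (p : H -> A -> k) (hp : hopf_pairing SH SA p) (p_nondeg : nondeg_form p)
  (V : vectType k) (M : crossedData A V) (M' : crossedData H 'Hom(V, k^o))
  (hM : is_crossed SA M) (hM' : is_crossed SH M')
  (adj : mutually_adjoint p (fun (phi : 'Hom(V, k^o)) (v : V) => phi v) M' M) :
  (exists (S : boson (nichols M 1) -> boson (nichols M 1))
          (S' : boson (nichols M' 1) -> boson (nichols M' 1))
          (P : boson (nichols M' 1) -> boson (nichols M 1) -> k),
     [/\ is_hopf S, is_hopf S', hopf_pairing S' S P, nondeg_form P
       & extends_pairings p (fun (phi : 'Hom(V, k^o)) (v : V) => phi v) P])
  /\
  (exists (S : boson (nichols M (-1)) -> boson (nichols M (-1)))
          (S' : boson (nichols M' (-1)) -> boson (nichols M' (-1)))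
          (P : boson (nichols M' (-1)) -> boson (nichols M (-1)) -> k),
     [/\ is_super_hopf (@boson_grade _ _ (nichols M (-1))) S,
         is_super_hopf (@boson_grade _ _ (nichols M' (-1))) S',
         super_hopf_pairing (@boson_grade _ _ (nichols M' (-1)))
           (@boson_grade _ _ (nichols M (-1))) S' S P,
         nondeg_form P
       & extends_pairings p (fun (phi : 'Hom(V, k^o)) (v : V) => phi v) P]).
Proof.
have N sigma := nichols_boson_pairing hA hM hH hM' hp p_nondeg adj (dual_nondeg
  V)
  (sigma := sigma).
split.
  have [S [S' [P [hS hS' [hP _] nP eP]]]] := N 1 (mulr1 1).
  by exists S, S', P; split=> //; [exact: sig_hopf1 hS|exact: sig_hopf1 hS'].
have sq : -1 * -1 = 1 :> k by rewrite mulrNN mulr1.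
exact: (N (-1) sq).
Qed.
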